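(* Let $\alpha\in\mathbb R\setminus\{0\}$, $s>1$, $u_0\in H^s_+(\mathbb S^1)$, and let $u$ be the solution of $i\partial_tu=\Pi(|u|^2u)+\alpha(u|1)$ with $u(0)=u_0$; assume $t\mapsto(1|u(t))$ is not identically zero. Let $\sigma_k>0$ be a singular value of $K_u$. For every time $t$ such that $\Psi_k(t)$ is defined, i.e. $\sigma_k\in\Sigma_K(u(t))$, the zeroes of $\Psi_k(t)$ are the same (they do not depend on $t$, even across crossing times).
   Context: $L^2_+=L^2_+(\mathbb S^1)$ is the Hardy space of $L^2$ functions with only nonnegative frequencies, $H^s_+=H^s(\mathbb S^1)\cap L^2_+$; $\Pi:L^2(\mathbb S^1)\to L^2_+$ is the orthogonal projector; $(u|v)=\int_{\mathbb S^1}u\bar v\,\frac{d\theta}{2\pi}$. $H_u(h)=\Pi(u\bar h)$ is an antilinear operator on $L^2_+$, $S$ is the shift $Sh=zh$, and $K_u:=S^*H_u$. The eigenvalues of $K_{u(t)}^2$, with multiplicities, do not depend on $t$; singular values of $K_u$ are their square roots. $E_u(\tau)=\ker(H_u^2-\tau^2I)$, $F_u(\tau)=\ker(K_u^2-\tau^2I)$, $\Sigma_H(u)=\{\tau>0:u\not\perp E_u(\tau)\}$, $\Sigma_K(u)=\{\tau\ge0:u\not\perp F_u(\tau)\}$. Crossing at $\sigma_k$ at time $t$ means $\sigma_k\in\Sigma_H(u(t))$ with $\dim E_{u(t)}(\sigma_k)\ge2$. The set of $t$ with $\sigma_k\in\Sigma_K(u(t))$ is open, the complement of a discrete closed set of crossing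 times. A finite Blaschke product of degree $d$ is $\Psi(z)=e^{-i\psi}P(z)/D(z)$ with $P$ monic of degree $d$ with all roots in the open unit disc and $D(z)=z^d\overline P(1/z)$. When $\sigma_k\in\Sigma_K(u(t))$, with $m=\dim F_{u(t)}(\sigma_k)$ and $u_k'(t)$ the orthogonal projection of $u(t)$ onto $F_{u(t)}(\sigma_k)$, $\Psi_k(t)$ is the Blaschke product of degree $m-1$ such that $K_{u(t)}(u_k'(t))=\sigma_k\Psi_k(t)u_k'(t)$. *)

(* Defs.v *)
From HB Require Import structures.
From mathcomp Require Import all_boot all_order all_algebra.
From mathcomp Require Import complex.
From mathcomp Require Import all_classical all_reals all_analysis.

Set Implicit Arguments.
Unset Strict Implicit.
Unset Printing Implicit Defensive.

Import Order.TTheory GRing.Theory Num.Theory numFieldNormedType.Exports.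

Local Open Scope classical_set_scope.
Local Open Scope ring_scope.
Local Open Scope complex_scope.

(* A complex function on the unit circle is represented by f : R -> R[i], a   *)
(* function of the angle theta (at the point z = e^(i theta)), of which only  *)
(* the restriction to [0, 2 pi] matters. L^2 "functions" are not quotiented:  *)
(* equality in L^2 is [aeq], almost everywhere equality on [0, 2 pi].         *)

Section Circle.
Context {R : realType}.
Local Notation C := R[i].
Local Notation mu := (@lebesgue_measure R).
Implicit Types (f g h u v w : R -> C) (s tau : R).

Definition circle : set R := `[0, 2 * pi].

Definition aeq f g := ae_eq mu circle f g.

Definition expi (x : R) : C := cos x +i* sin x.

Definition cintegral f : C :=
  (\int[mu]_(x in circle) complex.Re (f x))%R +i*
  (\int[mu]_(x in circle) complex.Im (f x))%R.

Definition normc (z : C) : R := ComplexField.Normc.normc z.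

Definition L2 f :=
  [/\ measurable_fun circle (fun x => complex.Re (f x)),
      measurable_fun circle (fun x => complex.Im (f x)) &
      (\int[mu]_(x in circle) ((normc (f x)) ^+ 2)%:E < +oo)%E].

Definition inner f g : C :=
  ((2 * pi)^-1)%:C * cintegral (fun x => f x * (g x)^*).

Definition fourier f (n : int) : C := inner f (fun x => expi (n%:~R * x)).

Definition L2plus : set (R -> C) :=
  [set f | L2 f /\ forall n : int, n < 0 -> fourier f n = 0].

(* Only meaningful for f in L^2; possibly +oo. *)
Definition Hsnorm s f : \bar R :=
  ((\esum_(n in [set: int])
      ((1 + n%:~R ^+ 2) `^ s * normc (fourier f n) ^+ 2)%:E) `^ 2^-1)%E.

Definition Hsplus s : set (R -> C) :=
  [set f | L2plus f /\ (Hsnorm s f < +oo)%E].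

(* g is the orthogonal projection of f onto the subspace V of L^2. *)
Definition is_orthoproj (V : set (R -> C)) f g :=
  V g /\ forall h, V h -> inner (fun x => f x - g x) h = 0.

(* Determined up to a.e. equality when f is in L^2, junk otherwise. *)
Definition Pi f : R -> C := xget (fun=> 0) [set g | is_orthoproj L2plus f g].

Definition shift h : R -> C := fun x => expi x * h x.

Definition shift_adj h : R -> C :=
  xget (fun=> 0) [set g | L2plus g /\
    forall w, L2plus w -> inner g w = inner h (shift w)].

Definition Hop u h : R -> C := Pi (fun x => u x * (h x)^*).

Definition Kop u h : R -> C := shift_adj (Hop u h).

Definition Feig u tau : set (R -> C) :=
  [set h | L2plus h /\
    aeq (Kop u (Kop u h)) (fun x => (tau ^+ 2)%:C * h x)].

Definition singular_value_K u tau :=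
  0 <= tau /\ exists2 h, Feig u tau h & ~ aeq h (fun=> 0).

Definition Sigma_K u : set R :=
  [set tau | 0 <= tau /\ ~ (forall h, Feig u tau h -> inner u h = 0)].

(* The subspace V of L^2 (modulo a.e. equality) has a basis of m elements. *)
Definition has_dim (V : set (R -> C)) (m : nat) :=
  exists b : 'I_m -> R -> C, (forall i, V (b i)) /\
    forall f, V f ->
      exists! c : 'rV[C]_m, aeq f (fun x => \sum_(i < m) c 0 i * b i x).

(* Numerators of the finite Blaschke products of degree d. *)
Definition blaschke_num (d : nat) (P : {poly C}) :=
  [/\ P \is monic, size P = d.+1 & forall z, root P z -> normc z < 1].

Definition blaschke_den (d : nat) (P : {poly C}) : {poly C} :=
  \poly_(i < d.+1) (P`_(d - i))^*.

Lemma blaschke_denE d (P : {poly C}) (z : C) : size P = d.+1 -> z != 0 ->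
  (blaschke_den d P).[z] = z ^+ d * (map_poly (@conjc R) P).[z^-1].
Proof.
move=> sP z0; rewrite /blaschke_den horner_poly.
rewrite (@horner_coef_wide _ d.+1); last by rewrite -sP size_poly.
rewrite mulr_sumr (reindex_inj rev_ord_inj) /=.
apply: eq_bigr => i _; rewrite subSS subKn -1?ltnS// coef_map.
rewrite mulrCA; congr (_ * _).
by rewrite exprVn -expfB_cond// (negbTE z0) add0n -ltnS.
Qed.

(* As e^(-i psi) P / D, with roots of P inside the disc, Psi has as zeroes    *)
(* the roots of P, with the same multiplicities.                              *)
Definition blaschke (d : nat) (psi : R) (P : {poly C}) (z : C) : C :=
  expi (- psi) * P.[z] / (blaschke_den d P).[z].

(* e^(-i psi) P / D is the Blaschke product Psi of degree dim F_u(tau) - 1    *)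
(* such that K_u u' = tau Psi u', where u' is the projection of u on F_u(tau).*)
Definition is_Psi u tau (psi : R) (P : {poly C}) :=
  exists d : nat, [/\ has_dim (Feig u tau) d.+1, blaschke_num d P &
    exists2 u' : R -> C, is_orthoproj (Feig u tau) u u' &
      aeq (Kop u u')
          (fun x => tau%:C * blaschke d psi P (expi x) * u' x)].

(* v is the derivative at time t of the H^s-valued curve u. *)
Definition is_Hs_derive s (u : R -> R -> C) (t : R) v :=
  Hsnorm s (fun x => (h^-1)%:C * (u (t + h) x - u t x) - v x)
    @[h --> 0^'] --> 0%E.

(* u is a C^1 curve in H^s_+ (the right-hand side is locally Lipschitz on     *)
(* H^s_+, so differentiability gives C^1) and solves the equation.            *)
Definition szego_solution (alpha s : R) (u0 : R -> C) (u : R -> R -> C) :=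
  [/\ forall t, Hsplus s (u t),
      aeq (u 0) u0 &
      forall t, exists v, [/\ Hsplus s v, is_Hs_derive s u t v &
        aeq (fun x => 'i * v x)
            (fun x => Pi (fun y => (normc (u t y) ^+ 2)%:C * u t y) x
                      + alpha%:C * inner (u t) (fun=> 1))]].

End Circle.

(* Main.v *)
Require Import Defs.
From HB Require Import structures.
From mathcomp Require Import all_boot all_order all_algebra.
From mathcomp Require Import complex ring lra zify.
From mathcomp Require Import all_classical all_reals all_analysis.
From mathcomp Require Import measurable_realfun.

(** The zeroes of the Blaschke product Psi can be read off the eigenspace F of
    K_u^2 for sigma^2, which has a rigid structure, and this structure is
    transported by the equation.

    Structure. Write Psi = e^(-i psi) P / D, where D is the reversed conjugate
    polynomial of P, let p be the projection of u on F, and put r = p / D.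
    Since D has no zero in the closed disc, r has nonnegative frequencies
    only. The identity K_u p = sigma Psi p becomes
    K_u r = sigma e^(-i psi) z^d r, whence
    K_u (z^j r) = sigma e^(-i psi) z^(d-j) r for j <= d: the functions z^j r,
    j <= d, belong to F, and they span it because dim F = d + 1. Moreover z^j r
    is orthogonal to u for 0 < j <= d. See [blaschke_quotient], [quotient_F]
    and [is_Psi_structure]. So p = D r is the element of the form q r, with q of
    degree at most d, that is orthogonal to z r, ..., z^d r, normalised by
    q(0) = 1; the polynomial D is determined by the inner products of the
    z^j r.

    Dynamics. Along a solution u, consider the curves x with
    i x' = Pi(|u|^2 x), called flows. By the Lax identity [Kk_lax], and because
    K does not see the constant alpha (u|1), K_u^2 x is a flow when x is; so
    flows preserve F ([flow_F]). They also preserve inner products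
    ([flow_ip]). They do not commute with the backward shift in general.
    But for x in F the pair of the scalars (x|u) and (x|1) solves a linear
    differential system, thanks to the relation H_u^2 = K_u^2 + ( . |u) u. If
    both vanish at the initial time, they vanish for ever ([flow_orth]), and
    then the backward shift of x is again a flow ([flow_shift]). Consequently,
    for the flow X that starts from z^d r at the time t1, the curves z^(-i) X
    are flows in F for all i <= d ([flow_unshift]).

    Comparison. At the time t2, X is divisible by z^(d1) in the second
    eigenspace, which consists of multiples of r2 by polynomials of degree at
    most d2. So d1 <= d2, and d1 = d2 by reversing time ([degree_le]). Then X is
    a constant multiple of z^d r2, and its backward shifts are the same multiple
    of the z^j r2. The inner products of the z^j r1 and of the z^j r2 are thus
    proportional, and both define the same D, hence the same P
    ([same_numerator]). Only the two times enter: it does not matter whether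
    there are crossings in between.

    Setting. The argument takes place in the algebra [wal] of the sequences
    dominated by the weight (1 + n^2)^(-s/2), which contains the coefficients
    of the H^s functions and is closed under products as s > 1; the
    projection, conjugation and the operators H_u and K_u become algebraic
    expressions there, and the flows are solutions of linear differential
    equations with continuous coefficients ([linear_ode], [ode_unique]). The
    link with functions rests on the uniqueness of Fourier coefficients
    ([fourier_uniqueness]) and on the fact that the elements of F, a priori
    only square-integrable, have their coefficients in [wal] ([Feig_wal]). *)

Set Implicit Arguments.
Unset Strict Implicit.
Unset Printing Implicit Defensive.

Import Order.TTheory GRing.Theory Num.Theory numFieldNormedType.Exports.

Local Open Scope classical_set_scope.
Local Open Scope complex_scope.
Local Open Scope ring_scope.

Local Notation Re := complex.Re.
Local Notation Im := complex.Im.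

(** * Complex-valued integration on the circle *)

Section Normc.
Context {R : realType}.
Local Notation C := R[i].
Implicit Types (z w : C).

Lemma normc_sqrtE z : normc z = Num.sqrt (Re z ^+ 2 + Im z ^+ 2).
Proof. by case: z. Qed.

Lemma normc_sqr z : normc z ^+ 2 = Re z ^+ 2 + Im z ^+ 2.
Proof. by rewrite normc_sqrtE sqr_sqrtr// addr_ge0// sqr_ge0. Qed.

Lemma normc_ge0 z : 0 <= normc z.
Proof. by rewrite normc_sqrtE sqrtr_ge0. Qed.

Lemma normc_0 : normc (0 : C) = 0.
Proof. exact: ComplexField.Normc.normc0. Qed.

Lemma normc_1 : normc (1 : C) = 1.
Proof. exact: ComplexField.Normc.normc1. Qed.

Lemma normc_eq0 z : (normc z == 0) = (z == 0).
Proof.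
apply/eqP/eqP => [|->]; last exact: normc_0.
exact: ComplexField.Normc.eq0_normc.
Qed.

Lemma normc_M z w : normc (z * w) = normc z * normc w.
Proof. exact: ComplexField.Normc.normcM. Qed.

Lemma normc_D z w : normc (z + w) <= normc z + normc w.
Proof. exact: le_normcD. Qed.

Lemma normc_N z : normc (- z) = normc z.
Proof. exact: normcN. Qed.

Lemma normc_conj z : normc (z^*) = normc z.
Proof. by case: z => a b; rewrite !normc_sqrtE /= sqrrN. Qed.

Lemma normc_real (x : R) : normc (x%:C) = `|x|.
Proof. by rewrite normc_sqrtE /= expr0n /= addr0 sqrtr_sqr. Qed.

Lemma Re_le_normc z : `|Re z| <= normc z.
Proof.
rewrite -(@ler_pXn2r _ 2)// ?nnegrE ?normr_ge0 ?normc_ge0//.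
by rewrite normc_sqr real_normK ?num_real// lerDl sqr_ge0.
Qed.

Lemma Im_le_normc z : `|Im z| <= normc z.
Proof.
rewrite -(@ler_pXn2r _ 2)// ?nnegrE ?normr_ge0 ?normc_ge0//.
by rewrite normc_sqr real_normK ?num_real// lerDr sqr_ge0.
Qed.

Lemma normc_le_ReIm z : normc z <= `|Re z| + `|Im z|.
Proof.
rewrite -(@ler_pXn2r _ 2)// ?nnegrE ?normc_ge0 ?addr_ge0//.
rewrite normc_sqr sqrrD !real_normK ?num_real//.
by rewrite addrAC lerDl mulrn_wge0// mulr_ge0.
Qed.

Lemma normc_sum (I : Type) (r : seq I) (P : pred I) (F : I -> C) :
  normc (\sum_(i <- r | P i) F i) <= \sum_(i <- r | P i) normc (F i).
Proof.
elim/big_rec2: _ => [|i x y _ h]; first by rewrite normc_0.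
by apply: (le_trans (normc_D _ _)); rewrite lerD2l.
Qed.

Lemma normc_X z n : normc (z ^+ n) = normc z ^+ n.
Proof. by elim: n => [|n IH]; rewrite ?expr0 ?normc_1// !exprS normc_M IH. Qed.

Lemma cReD z w : Re (z + w) = Re z + Re w. Proof. by case: z w => [a b] [c d]. Qed.
Lemma cImD z w : Im (z + w) = Im z + Im w. Proof. by case: z w => [a b] [c d]. Qed.
Lemma cReN z : Re (- z) = - Re z. Proof. by case: z => [a b]. Qed.
Lemma cImN z : Im (- z) = - Im z. Proof. by case: z => [a b]. Qed.
Lemma cReM z w : Re (z * w) = Re z * Re w - Im z * Im w.
Proof. by case: z w => [a b] [c d]. Qed.
Lemma cImM z w : Im (z * w) = Re z * Im w + Im z * Re w.
Proof. by case: z w => [a b] [c d]. Qed.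
Lemma cReJ z : Re (z^*) = Re z. Proof. by case: z => [a b]. Qed.
Lemma cImJ z : Im (z^*) = - Im z. Proof. by case: z => [a b]. Qed.
Lemma ReIm_eq z w : Re z = Re w -> Im z = Im w -> z = w.
Proof. by case: z w => [a b] [c d] /= -> ->. Qed.
Lemma cReR (x : R) : Re (x%:C) = x. Proof. by []. Qed.
Lemma cImR (x : R) : Im (x%:C) = 0. Proof. by []. Qed.

Lemma conjcM z w : (z * w)^* = z^* * w^*. Proof. exact: rmorphM. Qed.
Lemma conjcD z w : (z + w)^* = z^* + w^*. Proof. exact: rmorphD. Qed.
Lemma conjcB z w : (z - w)^* = z^* - w^*. Proof. exact: rmorphB. Qed.

Lemma conjcR (x : R) : (x%:C)^* = x%:C :> C.
Proof. by apply: ReIm_eq; rewrite /= ?oppr0. Qed.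

Lemma mulcJ z : z * z^* = (normc z ^+ 2)%:C.
Proof.
by apply: ReIm_eq; rewrite ?cReR ?cImR ?normc_sqr ?cReM ?cImM cReJ cImJ; ring.
Qed.

End Normc.

Section Integral.
Context {R : realType}.
Local Notation C := R[i].
Local Notation mu := (@lebesgue_measure R).
Implicit Types (f g h u v w : R -> C) (s tau : R).

Lemma measurable_circle : measurable (circle : set (measurableTypeR R)).
Proof. exact: measurable_itv. Qed.
Hint Resolve measurable_circle : core.

Lemma mu_circle : mu circle = (2 * pi)%:E.
Proof.
rewrite /circle lebesgue_measure_itv /= lte_fin mulr_gt0 ?pi_gt0//.
by rewrite -EFinB subr0.
Qed.

Lemma Rintegral_circle_cst (c : R) : \int[mu]_(x in circle) c = c * (2 * pi).
Proof.
rewrite Rintegral_cst; last exact: measurable_circle.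
congr (_ * _); change (fine (mu circle) = 2 * pi); by rewrite mu_circle.
Qed.

Definition cmeas f := measurable_fun circle (fun x => Re (f x)) /\
  measurable_fun circle (fun x => Im (f x)).

Definition cintegrable f :=
  mu.-integrable circle (EFin \o (fun x => Re (f x))) /\
  mu.-integrable circle (EFin \o (fun x => Im (f x))).

Lemma cmeasD f g : cmeas f -> cmeas g -> cmeas (fun x => f x + g x).
Proof.
move=> [a b] [c d]; split.
- by under eq_fun do rewrite cReD; exact: measurable_funD.
- by under eq_fun do rewrite cImD; exact: measurable_funD.
Qed.

Lemma cmeasN f : cmeas f -> cmeas (fun x => - f x).
Proof.
move=> [a b]; split.
- by under eq_fun do rewrite cReN; exact: measurableT_comp.
- by under eq_fun do rewrite cImN; exact: measurableT_comp.
Qed.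

Lemma cmeasM f g : cmeas f -> cmeas g -> cmeas (fun x => f x * g x).
Proof.
move=> [a b] [c d]; split.
- by under eq_fun do rewrite cReM; apply: measurable_funB; exact: measurable_funM.
- by under eq_fun do rewrite cImM; apply: measurable_funD; exact: measurable_funM.
Qed.

Lemma cmeasJ f : cmeas f -> cmeas (fun x => (f x)^*).
Proof.
move=> [a b]; split.
- by under eq_fun do rewrite cReJ.
- by under eq_fun do rewrite cImJ; exact: measurableT_comp.
Qed.

Lemma cmeas_cst (c : C) : cmeas (fun=> c).
Proof. by split; exact: measurable_cst. Qed.

Lemma cmeas_normc2 f : cmeas f -> measurable_fun circle (fun x => normc (f x) ^+ 2).
Proof.
move=> [a b]; under eq_fun do rewrite normc_sqr.
by apply: measurable_funD; exact: measurable_funX.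
Qed.

Lemma cintegrable_meas f : cintegrable f -> cmeas f.
Proof.
by move=> [/measurable_int/measurable_EFinP a /measurable_int/measurable_EFinP b].
Qed.

Lemma le_cintegrable f (g : R -> R) : cmeas f ->
  mu.-integrable circle (EFin \o g) ->
  (forall x, circle x -> normc (f x) <= g x) -> cintegrable f.
Proof.
move=> [a b] ig fg; split; (apply: le_integrable ig => //;
    first exact/measurable_EFinP) => x cx /=; rewrite !lee_fin.
- by apply: (le_trans (Re_le_normc _)); rewrite (le_trans (fg _ cx))// ler_norm.
- by apply: (le_trans (Im_le_normc _)); rewrite (le_trans (fg _ cx))// ler_norm.
Qed.

Lemma integrable_cst (B : R) : mu.-integrable circle (EFin \o (fun=> B)).
Proof.
apply/integrableP; split; first exact/measurable_EFinP/measurable_cst.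
rewrite /= integral_cst//; have mc : (mu circle < +oo)%E by rewrite mu_circle ltry.
by apply: lte_mul_pinfty => //; exact: mc.
Qed.

Lemma bounded_cintegrable f (B : R) : cmeas f ->
  (forall x, circle x -> normc (f x) <= B) -> cintegrable f.
Proof. by move=> mf; apply: le_cintegrable => //; exact: integrable_cst. Qed.

Lemma cintegrableD f g : cintegrable f -> cintegrable g ->
  cintegrable (fun x => f x + g x).
Proof.
move=> [a b] [c d]; split.
- by apply: eq_integrable (integrableD _ a c) => //= x _; rewrite cReD.
- by apply: eq_integrable (integrableD _ b d) => //= x _; rewrite cImD.
Qed.

Lemma normc_integrable f : cintegrable f ->
  mu.-integrable circle (EFin \o (fun x => `|Re (f x)| + `|Im (f x)|)).
Proof.
move=> [a b]; apply: eq_integrable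
  (integrableD _ (integrable_norm a) (integrable_norm b)) => //.
Qed.

Lemma cintegrableMb f g (B : R) : cintegrable f -> cmeas g ->
  (forall x, circle x -> normc (g x) <= B) -> cintegrable (fun x => g x * f x).
Proof.
move=> intf mg gB.
have mf := cintegrable_meas intf.
apply: (@le_cintegrable _ (fun x => B * (`|Re (f x)| + `|Im (f x)|))).
- exact: cmeasM.
- have := normc_integrable intf.
  by move/(@integrableZl _ _ _ mu circle measurable_circle B); apply: eq_integrable.
- move=> x cx; rewrite normc_M ler_pM ?normc_ge0 ?gB//.
  exact: normc_le_ReIm.
Qed.

Lemma cintegrableZ f (c : C) : cintegrable f -> cintegrable (fun x => c * f x).
Proof.
by move=> intf; apply: (@cintegrableMb _ _ (normc c)).
Qed.

Lemma cintegralD f g : cintegrable f -> cintegrable g ->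
  cintegral (fun x => f x + g x) = cintegral f + cintegral g.
Proof.
move=> [a b] [c d]; apply: ReIm_eq.
- rewrite cReD /cintegral /= -RintegralD//.
  by apply: eq_Rintegral => x _; rewrite cReD.
- rewrite cImD /cintegral /= -RintegralD//.
  by apply: eq_Rintegral => x _; rewrite cImD.
Qed.

Lemma cintegral_ext f g : (forall x, circle x -> f x = g x) ->
  cintegral f = cintegral g.
Proof.
move=> fg; rewrite /cintegral; congr (_ +i* _);
  by apply: eq_Rintegral => x /set_mem cx; rewrite fg.
Qed.

Lemma integrableZlR (c : R) (g : R -> R) :
  mu.-integrable circle (EFin \o g) ->
  mu.-integrable circle (EFin \o (fun x => c * g x)).
Proof.
move=> /(@integrableZl _ _ _ mu circle measurable_circle c).
exact: eq_integrable.
Qed.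

Lemma cintegralZ f (c : C) : cintegrable f ->
  cintegral (fun x => c * f x) = c * cintegral f.
Proof.
move=> [a b]; apply: ReIm_eq.
- rewrite cReM /cintegral /= -!RintegralZl// -RintegralB//; try exact: integrableZlR.
  by apply: eq_Rintegral => x _; rewrite cReM.
- rewrite cImM /cintegral /= -!RintegralZl// -RintegralD//; try exact: integrableZlR.
  by apply: eq_Rintegral => x _; rewrite cImM.
Qed.

Lemma cintegralJ f : cintegrable f ->
  cintegral (fun x => (f x)^*) = (cintegral f)^*.
Proof.
move=> [a b]; apply: ReIm_eq.
- by rewrite cReJ /=; apply: eq_Rintegral => x _; rewrite cReJ.
- rewrite cImJ /= -mulN1r -RintegralZl//.
  by apply: eq_Rintegral => x _; rewrite cImJ mulN1r.
Qed.

Lemma cintegrable_sum (I : eqType) (r : seq I) (F : I -> R -> C) :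
  (forall i, i \in r -> cintegrable (F i)) ->
  cintegrable (fun x => \sum_(i <- r) F i x).
Proof.
elim: r => [|i r IH] h.
  rewrite (_ : (fun _ => _) = fun=> 0); last by apply/funext => x; rewrite big_nil.
  apply: (@bounded_cintegrable _ 0); first exact: cmeas_cst.
  by move=> x _; rewrite normc_0.
under [X in cintegrable X]eq_fun do rewrite big_cons.
apply: cintegrableD; first by apply: h; rewrite mem_head.
by apply: IH => j jr; apply: h; rewrite in_cons jr orbT.
Qed.

Lemma cintegral_sum (I : eqType) (r : seq I) (F : I -> R -> C) :
  (forall i, i \in r -> cintegrable (F i)) ->
  cintegral (fun x => \sum_(i <- r) F i x) = \sum_(i <- r) cintegral (F i).
Proof.
elim: r => [|i r IH] h.
  rewrite big_nil; under cintegral_ext do rewrite big_nil.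
  by rewrite /cintegral /= !Rintegral_circle_cst mul0r.
rewrite big_cons; under cintegral_ext do rewrite big_cons.
rewrite cintegralD ?IH//.
- by move=> j jr; apply: h; rewrite in_cons jr orbT.
- by apply: h; rewrite mem_head.
- apply: cintegrable_sum => j jr; apply: h; rewrite in_cons jr orbT//.
Qed.

Lemma cintegral_le f (g : R -> R) : cintegrable f ->
  mu.-integrable circle (EFin \o g) ->
  (forall x, circle x -> normc (f x) <= g x) ->
  normc (cintegral f) <= 2 * \int[mu]_(x in circle) g x.
Proof.
move=> [a b] ig fg.
apply: (le_trans (normc_le_ReIm _)); rewrite mulr2n mulrDl mul1r /=.
apply: lerD; apply: (le_trans (le_normr_Rintegral _ _)) => //;
  apply: le_Rintegral => //.
- exact: integrable_norm a.
- by move=> x cx; apply: le_trans (fg _ cx); exact: Re_le_normc.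
- exact: integrable_norm b.
- by move=> x cx; apply: le_trans (fg _ cx); exact: Im_le_normc.
Qed.

Lemma aeq_refl f : aeq f f. Proof. exact: ae_eq_refl. Qed.
Lemma aeq_sym f g : aeq f g -> aeq g f. Proof. exact: ae_eq_sym. Qed.
Lemma aeq_trans f g h : aeq f g -> aeq g h -> aeq f h. Proof. exact: ae_eq_trans. Qed.

Lemma aeq_comp2 (T : (R -> C) -> (R -> C) -> R -> C) f f' g g' :
  (forall a b a' b' x, a x = a' x -> b x = b' x -> T a b x = T a' b' x) ->
  aeq f f' -> aeq g g' -> aeq (T f g) (T f' g').
Proof.
move=> h; apply: filterS2 => x ef eg cx; apply: h; [exact: ef|exact: eg].
Qed.

Lemma aeq_comp (T : (R -> C) -> R -> C) f f' :
  (forall a a' x, a x = a' x -> T a x = T a' x) ->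
  aeq f f' -> aeq (T f) (T f').
Proof. by move=> h; apply: filterS => x ef cx; apply: h; exact: ef. Qed.

Lemma aeq_cintegral f g : cmeas f -> cmeas g -> aeq f g ->
  cintegral f = cintegral g.
Proof.
move=> [a b] [c d] fg; rewrite /cintegral; congr (_ +i* _);
  rewrite /Rintegral; congr fine; apply: ae_eq_integral => //;
  try exact/measurable_EFinP.
- by apply: filterS fg => x h cx; rewrite /= h.
- by apply: filterS fg => x h cx; rewrite /= h.
Qed.

End Integral.
#[global] Hint Extern 0 (measurable circle) => solve [exact: measurable_circle] : core.

(** * Characters of the circle and multipliers *)

Section Fourier.
Context {R : realType}.
Local Notation C := R[i].
Local Notation mu := (@lebesgue_measure R).
Implicit Types (f g h u v w : R -> C) (n m : int).

Lemma expiD (x y : R) : expi (x + y) = expi x * expi y.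
Proof. by apply: ReIm_eq; rewrite ?cReM ?cImM /= ?cosD ?sinD; ring. Qed.

Lemma expi0 : expi 0 = 1 :> C.
Proof. by apply: ReIm_eq; rewrite /= ?cos0 ?sin0. Qed.

Lemma expiN (x : R) : expi (- x) = (expi x)^*.
Proof. by apply: ReIm_eq; rewrite ?cReJ ?cImJ /= ?cosN ?sinN. Qed.

Lemma normc_expi (x : R) : normc (expi x) = 1.
Proof. by rewrite normc_sqrtE /= cos2Dsin2 sqrtr1. Qed.

Lemma expi_2pi : expi (2 * pi) = 1 :> C.
Proof.
by apply: ReIm_eq; rewrite /= mulrC mulr_natr ?cos2pi ?sin2pi.
Qed.

Definition ei n (x : R) : C := expi (n%:~R * x).

Lemma eiD n m x : ei (n + m) x = ei n x * ei m x.
Proof. by rewrite /ei intrD mulrDl expiD. Qed.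

Lemma ei0 x : ei 0 x = 1.
Proof. by rewrite /ei mul0r expi0. Qed.

Lemma eiJ n x : (ei n x)^* = ei (- n) x.
Proof. by rewrite /ei -expiN intrN mulNr. Qed.

Lemma normc_ei n x : normc (ei n x) = 1.
Proof. exact: normc_expi. Qed.

Lemma ei_nat (k : nat) x : ei k%:Z x = expi x ^+ k.
Proof.
elim: k => [|k IH]; first by rewrite ei0 expr0.
by rewrite exprS -IH -addn1 PoszD eiD mulrC; congr (_ * _); rewrite /ei mul1r.
Qed.

Lemma ei_2pi n : ei n (2 * pi) = 1.
Proof.
have h (k : nat) : ei k (2 * pi) = 1 by rewrite ei_nat expi_2pi expr1n.
case: n => k; first exact: h.
by rewrite NegzE -eiJ h rmorph1.
Qed.

Lemma continuous_lin (a : R) : continuous (fun x : R => a * x).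
Proof. by move=> x; apply: cvgM; [exact: cvg_cst|exact: cvg_id]. Qed.

Lemma cmeas_ei n : cmeas (ei n).
Proof.
split; apply: measurable_funTS; apply: continuous_measurable_fun => x.
- by apply: continuous_comp; [exact: continuous_lin|exact: continuous_cos].
- by apply: continuous_comp; [exact: continuous_lin|exact: continuous_sin].
Qed.

Lemma is_derive_lin (a x : R) : is_derive x (1 : R) (fun x : R => a * x) a.
Proof.
by apply: is_derive_eq; rewrite /GRing.scale /= mulr1.
Qed.

Lemma circle_FTC (F f : R -> R) :
  (forall x, is_derive (x : R) (1 : R) F (f x)) -> continuous f ->
  \int[mu]_(x in circle) (f x) = F (2 * pi) - F 0.
Proof.
move=> dF cf; rewrite /Rintegral (@continuous_FTC2 _ f F)//.
- by rewrite mulr_gt0 ?pi_gt0.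
- exact: continuous_subspaceT.
- have cF : continuous F.
    move=> x; apply: differentiable_continuous; apply/derivable1_diffP.
    exact: (@ex_derive _ _ _ _ _ _ _ (dF x)).
  split => [x _||].
  + exact: (@ex_derive _ _ _ _ _ _ _ (dF x)).
  + exact/cvg_at_right_filter/cF.
  + exact/cvg_at_left_filter/cF.
- by move=> x _; rewrite derive1E; exact: (@derive_val _ _ _ _ _ _ _ (dF x)).
Qed.

Lemma cintegral_ei n : cintegral (ei n) = if n == 0 then (2 * pi)%:C else 0.
Proof.
case: eqP => [->|/eqP n0].
  rewrite (_ : cintegral _ = cintegral (fun=> 1)); last first.
    by apply: cintegral_ext => x _; rewrite ei0.
  by apply: ReIm_eq; rewrite /cintegral /= Rintegral_circle_cst ?mul0r ?mul1r.
have nR : (n%:~R : R) != 0 by rewrite intr_eq0.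
have pi2 : (0 : R) < 2 * pi by rewrite mulr_gt0 ?pi_gt0.
pose S (x : R) := n%:~R^-1 * sin (n%:~R * x).
pose K (x : R) := - (n%:~R^-1 * cos (n%:~R * x)).
have dS x : is_derive (x : R) (1 : R) S (cos (n%:~R * x)).
  have d1 := is_derive_lin n%:~R x.
  apply: is_derive_eq; rewrite /GRing.scale /=; field => //.
have dK x : is_derive (x : R) (1 : R) K (sin (n%:~R * x)).
  have d1 := is_derive_lin n%:~R x.
  apply: is_derive_eq; rewrite /GRing.scale /=; field => //.
have := ei_2pi n; rewrite /ei => /(congr1 (fun z : C => (Re z, Im z))) /= [c1 s1].
apply: ReIm_eq; rewrite /cintegral /=.
- rewrite (circle_FTC dS)//; last first.
    by move=> x; apply: continuous_comp; [exact: continuous_lin|exact: continuous_cos].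
  by rewrite /S s1 !mulr0 sin0 mulr0 subr0.
- rewrite (circle_FTC dK)//; last first.
    by move=> x; apply: continuous_comp; [exact: continuous_lin|exact: continuous_sin].
  by rewrite /K c1 !mulr0 cos0 subrr.
Qed.

Lemma fourierE f n : fourier f n = ((2 * pi)^-1)%:C * cintegral (fun x => f x * ei (- n) x).
Proof.
rewrite /fourier /inner; congr (_ * _); apply: cintegral_ext => x _.
by rewrite -eiJ.
Qed.

Definition zero_fourier f :=
  cintegrable f /\ forall n, cintegral (fun x => f x * ei n x) = 0.

(** Multiplication by a trigonometric polynomial keeps all Fourier coefficients
    zero. Stated as a property with closure lemmas, so that the polynomials
    used below never have to be expanded into characters. *)
Definition multiplier (p : R -> C) :=
  forall f, zero_fourier f -> zero_fourier (fun x => p x * f x).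

Lemma cintegrable_ext f g : f =1 g -> cintegrable f -> cintegrable g.
Proof. by move=> /funext ->. Qed.

Lemma cintegrable_mul_ei f n : cintegrable f -> cintegrable (fun x => f x * ei n x).
Proof.
move=> intf; apply: (@cintegrable_ext (fun x => ei n x * f x)).
  by move=> x; rewrite mulrC.
apply: (@cintegrableMb _ _ _ 1) => //; first exact: cmeas_ei.
by move=> x _; rewrite normc_ei.
Qed.

Lemma multiplier_ei k : multiplier (ei k).
Proof.
move=> f [intf zf]; split.
  apply: (@cintegrableMb _ _ _ 1) => //; first exact: cmeas_ei.
  by move=> x _; rewrite normc_ei.
move=> n; rewrite -(zf (k + n)); apply: cintegral_ext => x _.
by rewrite eiD mulrCA mulrA.
Qed.

Lemma multiplierD p q : multiplier p -> multiplier q ->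
  multiplier (fun x => p x + q x).
Proof.
move=> mp mq f zf; have [ip zp] := mp _ zf; have [iq zq] := mq _ zf; split.
  apply: (@cintegrable_ext (fun x => p x * f x + q x * f x)); last exact: cintegrableD.
  by move=> x; rewrite mulrDl.
move=> n; rewrite -[RHS]addr0 -{1}(zp n) -(zq n) -cintegralD.
- by apply: cintegral_ext => x _; rewrite !mulrDl.
- exact: cintegrable_mul_ei.
- exact: cintegrable_mul_ei.
Qed.

Lemma multiplierM p q : multiplier p -> multiplier q ->
  multiplier (fun x => p x * q x).
Proof.
move=> mp mq f zf; have := mp _ (mq _ zf).
by rewrite (_ : (fun x => p x * (q x * f x)) = (fun x => p x * q x * f x))//;
  apply/funext => x; rewrite mulrA.
Qed.

Lemma multiplier_cst c : multiplier (fun=> c).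
Proof.
move=> f [intf zf]; split; first exact: cintegrableZ.
move=> n; rewrite -(mulr0 c) -(zf n) -cintegralZ; last exact: cintegrable_mul_ei.
by apply: cintegral_ext => x _; rewrite mulrA.
Qed.

Lemma multiplierX p k : multiplier p -> multiplier (fun x => p x ^+ k).
Proof.
move=> mp; elim: k => [|k IH].
  by under [X in multiplier X]eq_fun do rewrite expr0; exact: multiplier_cst.
by under [X in multiplier X]eq_fun do rewrite exprS; exact: multiplierM.
Qed.

Lemma multiplier_cos (c : R) : multiplier (fun x => (cos (x - c))%:C).
Proof.
rewrite (_ : (fun _ => _) = fun x => ((2^-1)%:C * expi (- c)) * ei 1 x +
    ((2^-1)%:C * expi c) * ei (-1) x).
  by apply: multiplierD; apply: multiplierM;
    first [exact: multiplier_cst|exact: multiplier_ei].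
apply/funext => x; rewrite /ei mul1r mulN1r.
by apply: ReIm_eq; rewrite /= !cosN !sinN ?cosB; field.
Qed.

End Fourier.

(** * Uniqueness of Fourier coefficients *)

Section Uniqueness.
Context {R : realType}.
Local Notation C := R[i].
Local Notation mu := (@lebesgue_measure R).
Implicit Types (f g : R -> C).

Lemma bernoulli (a : R) (n : nat) : -1 <= a -> 1 + n%:R * a <= (1 + a) ^+ n.
Proof.
move=> a1; elim: n => [|n IH]; first by rewrite mul0r addr0 expr0.
rewrite exprS; apply: (@le_trans _ _ ((1 + a) * (1 + n%:R * a))); last first.
  by apply: ler_wpM2l => //; lra.
rewrite -natr1; have := sqr_ge0 a; rewrite expr2 => h.
have : 0 <= n%:R * (a * a) by rewrite mulr_ge0.
lra.
Qed.

(** A polynomial in [w] that tends to 1 below 1/2 and to 0 above 1/2: composed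
    with a trigonometric polynomial it approximates the indicator of an arc. *)
Definition step (w : R) (n : nat) : R := (1 - w ^+ n) ^+ (2 ^ n).

Lemma step_ge0 w n : 0 <= w <= 1 -> 0 <= step w n.
Proof.
move=> /andP[w0 w1]; rewrite exprn_ge0// subr_ge0 exprn_ile1//.
Qed.

Lemma step_le1 w n : 0 <= w <= 1 -> step w n <= 1.
Proof.
move=> /andP[w0 w1]; rewrite exprn_ile1 ?subr_ge0 ?exprn_ile1//.
by rewrite lerBlDr lerDl exprn_ge0.
Qed.

(** By Bernoulli, [(1 - w ^ n) ^ (2 ^ n) >= 1 - (2 w) ^ n]. *)
Lemma step_cvg1 w : 0 <= w -> w < 2^-1 -> step w @ \oo --> (1 : R).
Proof.
move=> w0 w2; have w01 : 0 <= w <= 1 by lra.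
have c : (1 - geometric 1 (2 * w) n) @[n --> \oo] --> (1 : R).
  rewrite -[X in _ --> X]subr0; apply: cvgB; first exact: cvg_cst.
  by apply: cvg_geometric; rewrite ger0_norm; lra.
apply: (@squeeze_cvgr _ _ _ _ _ (fun=> 1)) c (cvg_cst _).
near=> n; rewrite step_le1// andbT /step /geometric /= mul1r exprMn.
have := @bernoulli (- w ^+ n) (2 ^ n); rewrite natrX mulrN => -> //.
by rewrite lerN2 exprn_ile1//; lra.
Unshelve. all: by end_near. Qed.

(** Since [(1 - w ^ n) (1 + w ^ n) <= 1], Bernoulli applied to the second
    factor gives [(1 - w ^ n) ^ (2 ^ n) <= 1 / (2 w) ^ n]. *)
Lemma step_cvg0 w : 2^-1 < w -> w <= 1 -> step w @ \oo --> (0 : R).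
Proof.
move=> w0 w1; have w01 : 0 <= w <= 1 by lra.
have wp : 0 < w by lra.
have c : geometric 1 (2 * w)^-1 @ \oo --> (0 : R).
  apply: cvg_geometric; by rewrite ger0_norm ?invr_ge0 ?invf_lt1; lra.
apply: (@squeeze_cvgr _ _ _ _ (fun=> 0)) (cvg_cst _) c.
near=> n; rewrite step_ge0//= mul1r exprVn exprMn.
have wn : 0 < w ^+ n by apply: exprn_gt0; lra.
have wn1 : w ^+ n <= 1 by apply: exprn_ile1; lra.
have : 2 ^+ n * w ^+ n <= (1 + w ^+ n) ^+ (2 ^ n).
  by have := @bernoulli (w ^+ n) (2 ^ n); rewrite natrX; lra.
move=> b; rewrite -[leRHS]mul1r ler_pdivlMr ?mulr_gt0 ?exprn_gt0//.
apply: (@le_trans _ _ (step w n * (1 + w ^+ n) ^+ (2 ^ n))).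
  by rewrite ler_wpM2l ?step_ge0.
rewrite /step -exprMn exprn_ile1//; first by apply: mulr_ge0; lra.
by move: (w ^+ n) => a; have := sqr_ge0 a; rewrite expr2; lra.
Unshelve. all: by end_near. Qed.

(** Below 1/2 exactly when [cos (x - y / 2) > cos (y / 2)], that is on the arc
    from 0 to [y], whose midpoint is [y / 2]. *)
Definition bump (y x : R) : R := 2^-1 + 4^-1 * (cos (y / 2) - cos (x - y / 2)).

Lemma bump01 y x : 0 <= bump y x <= 1.
Proof.
rewrite /bump; have := cos_le1 (y / 2); have := cos_le1 (x - y / 2).
have := cos_geN1 (y / 2); have := cos_geN1 (x - y / 2); lra.
Qed.

Lemma bump_in y x : 0 < y < 2 * pi -> 0 < x < y -> bump y x < 2^-1.
Proof.
move=> /andP[y0 y2] /andP[x0 xy].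
rewrite /bump gtrDl pmulr_rlt0 ?invr_gt0// subr_lt0 -(cos_norm (x - _)).
rewrite ltr_cos ?in_itv/= ?normr_ge0; first by rewrite ltr_norml; lra.
- by rewrite ler_norml; have := @pi_gt0 R; lra.
- by have := @pi_gt0 R; lra.
Qed.

Lemma bump_out y x : 0 < y < 2 * pi -> y < x < 2 * pi -> 2^-1 < bump y x.
Proof.
move=> /andP[y0 y2] /andP[x0 xy].
rewrite /bump ltrDl pmulr_rgt0 ?invr_gt0// subr_gt0.
have [xp|xp] := leP (x - y / 2) pi.
  by rewrite ltr_cos ?in_itv/=; lra.
have -> : x - y / 2 = - (2 * pi - (x - y / 2)) + pi *+ 2 by rewrite mulr2n; ring.
rewrite cosD2pi cosN ltr_cos ?in_itv/=; first lra.
  by apply/andP; split; lra.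
by apply/andP; split; lra.
Qed.

Lemma multiplier_bump y n : multiplier (fun x => (step (bump y x) n)%:C).
Proof.
rewrite (_ : (fun _ => _) = fun x => (1 + (-1) *
   ((2^-1 + 4^-1 * cos (y / 2))%:C + ((- 4^-1)%:C * (cos (x - y / 2))%:C)) ^+ n) ^+ (2 ^ n)).
  apply: multiplierX; apply: multiplierD; first exact: multiplier_cst.
  apply: multiplierM; first exact: multiplier_cst.
  apply: multiplierX; apply: multiplierD; first exact: multiplier_cst.
  apply: multiplierM; first exact: multiplier_cst.
  exact: multiplier_cos.
apply/funext => x; rewrite /step -!rmorphM -rmorphD -rmorphXn /= mulN1r.
rewrite -rmorphN -(rmorph1 (real_complex R)) -rmorphD -rmorphXn.
by congr (((1 - _ ^+ n) ^+ _)%:C); rewrite /bump; ring.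
Qed.

Lemma cmeas_bump y n : measurable_fun circle (fun x => step (bump y x) n).
Proof.
apply: measurable_funTS; apply: continuous_measurable_fun => x.
rewrite /step /bump.
apply: (@continuous_comp _ _ _ (fun x : R => 2^-1 + 4^-1 * (cos (y / 2) - cos (x - y / 2)))
  (fun w : R => (1 - w ^+ n) ^+ (2 ^ n))).
  apply: cvgD; first exact: cvg_cst.
  apply: cvgM; first exact: cvg_cst.
  apply: cvgB; first exact: cvg_cst.
  apply: (@continuous_comp _ _ _ (fun x : R => x - y / 2) cos).
    by apply: cvgB; [exact: cvg_id|exact: cvg_cst].
  exact: continuous_cos.
apply: (@continuous_comp _ _ _ (fun w : R => 1 - w ^+ n) (fun w : R => w ^+ (2 ^ n))).
  by apply: cvgB; [exact: cvg_cst|exact: exprn_continuous].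
exact: exprn_continuous.
Qed.

Lemma ae_neq (a : R) (P : R -> Prop) : (forall x, x != a -> P x) -> {ae mu, forall x, P x}.
Proof.
move=> h; exists [set a]; split; [exact: measurable_set1|exact: lebesgue_measure_set1|].
by move=> x /= nP; apply: contrapT => xa; apply: nP; apply: h; exact/eqP.
Qed.

(** Dominated convergence, as the steps of the bump tend to the indicator of
    the open arc almost everywhere. *)
Lemma integral_prefix_eq0 (g : R -> R) (y : R) :
  mu.-integrable circle (EFin \o g) -> 0 < y < 2 * pi ->
  (forall n, \int[mu]_(x in circle) (step (bump y x) n * g x) = 0) ->
  \int[mu]_(x in `[0, y]) g x = 0.
Proof.
move=> ig y02 h.
have mg : measurable_fun circle g by have /measurable_int/measurable_EFinP := ig.
pose f_ n x := (step (bump y x) n * g x)%:E.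
pose fl x := ((x \in `]0, y[)%:R * g x)%:E.
have mfl : measurable_fun circle fl.
  apply/measurable_EFinP/measurable_funM => //.
  rewrite (_ : (fun x => _) = \1_(`]0, y[%classic)); first exact: measurable_indic.
  by apply/funext => x; rewrite indicE mem_setE.
have mf_ n : measurable_fun circle (f_ n).
  by apply/measurable_EFinP/measurable_funM => //; exact: cmeas_bump.
have f_f : {ae mu, forall x, circle x -> f_ ^~ x @ \oo --> fl x}.
  have n0 := @ae_neq 0 (fun x => x != 0) (fun x => id).
  have ny := @ae_neq y (fun x => x != y) (fun x => id).
  have np := @ae_neq (2 * pi) (fun x => x != 2 * pi) (fun x => id).
  move: n0 ny np; apply: filterS3; first exact: (ae_filter_ringOfSetsType mu).
  move=> x x0 xy xp; rewrite /circle /= in_itv /= => /andP[x0' xp'].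
  have {x0 x0'} x0 : 0 < x by rewrite lt_neqAle eq_sym x0.
  have {xp xp'} xp : x < 2 * pi by rewrite lt_neqAle xp.
  apply/cvg_EFin; first exact: nearW.
  rewrite /f_ /fl /=; apply: cvgMr_tmp.
  have [lxy|lyx|exy] := ltgtP x y; last by rewrite exy eqxx in xy.
  - rewrite in_itv /= x0 lxy /=; apply: step_cvg1.
      by have /andP[] := bump01 y x.
    by apply: bump_in; rewrite ?x0.
  - rewrite in_itv /= x0 (le_gtF (ltW lyx)) /=; apply: step_cvg0.
      by apply: bump_out => //; rewrite lyx xp.
    by have /andP[] := bump01 y x.
have f_g : {ae mu, forall x n, circle x -> (`|f_ n x| <= (EFin \o (Num.Def.normr \o g)) x)%E}.
  apply: aeW => x n _ /=; rewrite lee_fin normrM ler_piMl//.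
  by rewrite ger0_norm ?step_ge0 ?step_le1 ?bump01.
have [|||_ _] := @dominated_convergence _ _ R mu circle measurable_circle f_ fl
  (EFin \o (Num.Def.normr \o g)) mf_ mfl.
- exact: f_f.
- exact: integrable_norm.
- exact: f_g.
rewrite (_ : [sequence _]_n = (fun=> 0%E)); last first.
  apply/funext => n /=.
  have hn : (fine (\int[mu]_(x in circle) (f_ n x)))%:E = 0%:E by congr EFin; exact: h.
  move: hn; rewrite fineK//.
  apply: integrable_fin_num => //.
  apply: le_integrable (integrable_norm ig) => //; first exact: mf_.
  move=> x _ /=; rewrite lee_fin normrM [leRHS]ger0_norm// ler_piMl//.
  by rewrite ger0_norm ?step_ge0 ?step_le1 ?bump01.
move=> /(cvg_lim (@ereal_hausdorff R)); rewrite lim_cst// => e0.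
have iE : (\int[mu]_(x in circle) (fl x) = \int[mu]_(x in `[0%R, y]) (g x)%:E)%E.
  rewrite (@integral_itv_bndoo _ 0 y (EFin \o g) true false)/=; last first.
    apply/measurable_EFinP; apply: measurable_funS mg => //.
    by apply: subset_itv; rewrite bnd_simp//; have /andP[_ /ltW] := y02.
  rewrite (_ : `]0, y[%classic = circle `&` `]0, y[%classic); last first.
    apply/esym/setIidPr.
    by apply: subset_itv; rewrite bnd_simp//; have /andP[_ /ltW] := y02.
  rewrite integral_mkcondr; apply: eq_integral => x _.
  rewrite /fl patchE mem_setE; case: ifP => _; first by rewrite mul1r.
  by rewrite mul0r.
by rewrite /Rintegral -iE -e0.
Qed.

(** Lebesgue differentiation: the primitive of [g] vanishes on the circle, and
    its derivative is [g] almost everywhere. *)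
Lemma integral_prefix_ae_eq0 (g : R -> R) :
  mu.-integrable circle (EFin \o g) ->
  (forall y, 0 < y < 2 * pi -> \int[mu]_(x in `[0, y]) g x = 0) ->
  {ae mu, forall x, circle x -> g x = 0}.
Proof.
move=> ig h.
pose G := g \_ circle.
have iG : mu.-integrable setT (EFin \o G).
  have h1 := (@integrable_mkcond _ _ R mu circle (EFin \o g) measurable_circle).1 ig.
  by rewrite /G -restrict_EFin; exact: h1.
have lG : locally_integrable setT G by exact: integrable_locally.
have iGy (y : R) : mu.-integrable `[0, y] (EFin \o G).
  by apply: (integrableS measurableT _ _ iG); [exact: measurable_itv|].
have F1 := @FTC1 R G (BLeft 0) iGy lG.
have n0 := @ae_neq 0 (fun x => x != 0) (fun x => id).
have np := @ae_neq (2 * pi) (fun x => x != 2 * pi) (fun x => id).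
move: F1 n0 np; apply: filterS3; first exact: (ae_filter_ringOfSetsType mu).
move=> x /= dF x0 xp cx; move: (cx); rewrite /circle /= in_itv /= => /andP[x0' xp'].
have {x0 x0'} x0 : 0 < x by rewrite lt_neqAle eq_sym x0.
have {xp xp'} xp : x < 2 * pi by rewrite lt_neqAle xp.
have [] := dF; first by rewrite lte_fin.
move=> _; rewrite {2}/G patchE mem_set// => <-.
rewrite derive1E (@near_eq_derive _ _ _ _ (cst 0)) ?derive_cst//.
near=> z; rewrite /cst.
have z02 : 0 < z < 2 * pi.
  by apply/andP; split; near: z; [exact: lt_nbhsr|exact: lt_nbhsl].
rewrite -[RHS](h _ z02); apply: eq_Rintegral => t; rewrite inE /= in_itv /= => /andP[t0 tz].
rewrite /G patchE mem_set// /circle /= in_itv /= t0 /=.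
by rewrite (le_trans tz)// ltW//; have /andP[] := z02.
Unshelve. all: by end_near. Qed.

(** All the steps of the bumps are multipliers, hence the integral of [f] over
    every arc from 0 vanishes. *)
Theorem fourier_uniqueness f : zero_fourier f -> aeq f (fun=> 0).
Proof.
move=> zf; have [intf _] := zf; have [iRe iIm] := intf.
have key n y : cintegral (fun x => (step (bump y x) n)%:C * f x) = 0.
  have [_ /(_ 0)] := multiplier_bump y n zf => <-.
  by apply: cintegral_ext => x _; rewrite ei0 mulr1.
have hRe : {ae mu, forall x, circle x -> Re (f x) = 0}.
  apply: integral_prefix_ae_eq0 => // y y02; apply: integral_prefix_eq0 => // n.
  have := congr1 (@Re _) (key n y); rewrite /cintegral /= => <-.
  by apply: eq_Rintegral => x _; rewrite cReM /= mul0r subr0.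
have hIm : {ae mu, forall x, circle x -> Im (f x) = 0}.
  apply: integral_prefix_ae_eq0 => // y y02; apply: integral_prefix_eq0 => // n.
  have := congr1 (@Im _) (key n y); rewrite /cintegral /= => <-.
  by apply: eq_Rintegral => x _; rewrite cImM /= mul0r addr0.
move: hRe hIm; apply: filterS2; first exact: (ae_filter_ringOfSetsType mu).
by move=> x h1 h2 cx; apply: ReIm_eq; [exact: h1|exact: h2].
Qed.

End Uniqueness.

(** * Square-integrable functions and the Bessel inequality *)

Section L2theory.
Context {R : realType}.
Local Notation C := R[i].
Local Notation mu := (@lebesgue_measure R).
Implicit Types (f g h : R -> C) (n m : int) (c : C).

Definition sqint f := mu.-integrable circle (EFin \o (fun x => normc (f x) ^+ 2)).

Lemma L2P f : L2 f <-> cmeas f /\ sqint f.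
Proof.
have eqi : (\int[mu]_(x in circle) `|(EFin \o (fun x => normc (f x) ^+ 2)%R) x| =
    \int[mu]_(x in circle) (normc (f x) ^+ 2)%:E)%E.
  by apply: eq_integral => x _; rewrite /= ger0_norm ?sqr_ge0.
split=> [[a b ub]|[[a b] /integrableP[_]]]; last by rewrite eqi => ub; split.
have mf : cmeas f by split.
split => //; apply/integrableP; rewrite eqi; split => //.
(apply/measurable_EFinP; apply: cmeas_normc2; assumption).
Qed.

Lemma le_L2 f (g : R -> R) : cmeas f -> mu.-integrable circle (EFin \o g) ->
  (forall x, circle x -> normc (f x) ^+ 2 <= g x) -> L2 f.
Proof.
move=> mf ig fg; apply/L2P; split => //.
apply: le_integrable ig => //; first (apply/measurable_EFinP; apply: cmeas_normc2; assumption).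
move=> x cx /=; rewrite lee_fin ger0_norm ?sqr_ge0//.
by rewrite (le_trans (fg _ cx))// ler_norm.
Qed.

Lemma bounded_L2 f (B : R) : cmeas f ->
  (forall x, circle x -> normc (f x) <= B) -> L2 f.
Proof.
move=> mf fB; apply: (@le_L2 _ (fun=> B ^+ 2)) => //; first exact: integrable_cst.
by move=> x cx; rewrite ler_pXn2r ?nnegrE ?normc_ge0 ?fB// (le_trans (normc_ge0 (f x)))// fB.
Qed.

Lemma integrableDR (f g : R -> R) : mu.-integrable circle (EFin \o f) ->
  mu.-integrable circle (EFin \o g) ->
  mu.-integrable circle (EFin \o (fun x => f x + g x)).
Proof. by move=> a b; apply: eq_integrable (integrableD _ a b). Qed.

Lemma sqr_normcD (z w : C) : normc (z + w) ^+ 2 <= 2 * (normc z ^+ 2 + normc w ^+ 2).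
Proof.
apply: (@le_trans _ _ ((normc z + normc w) ^+ 2)).
  by rewrite ler_pXn2r ?nnegrE ?addr_ge0 ?normc_ge0// normc_D.
have := sqr_ge0 (normc z - normc w); rewrite sqrrB sqrrD; lra.
Qed.

Lemma L2D f g : L2 f -> L2 g -> L2 (fun x => f x + g x).
Proof.
move=> /L2P[mf sf] /L2P[mg sg].
apply: (@le_L2 _ (fun x => 2 * (normc (f x) ^+ 2 + normc (g x) ^+ 2))).
- exact: cmeasD.
- exact/integrableZlR/integrableDR.
- by move=> x _; exact: sqr_normcD.
Qed.

Lemma L2Mb f g (B : R) : L2 f -> cmeas g ->
  (forall x, circle x -> normc (g x) <= B) -> L2 (fun x => g x * f x).
Proof.
move=> /L2P[mf sf] mg gB.
apply: (@le_L2 _ (fun x => B ^+ 2 * (normc (f x) ^+ 2))).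
- exact: cmeasM.
- exact/integrableZlR.
- move=> x cx; rewrite normc_M exprMn ler_wpM2r ?sqr_ge0//.
  by rewrite ler_pXn2r ?nnegrE ?normc_ge0 ?gB// (le_trans (normc_ge0 (g x)))// gB.
Qed.

Lemma L2Z f c : L2 f -> L2 (fun x => c * f x).
Proof. by move=> lf; apply: (@L2Mb _ _ (normc c)) => //; exact: cmeas_cst. Qed.

Lemma L2N f : L2 f -> L2 (fun x => - f x).
Proof. by move=> /(L2Z (-1)); under [X in L2 X -> _]eq_fun do rewrite mulN1r. Qed.

Lemma L2B f g : L2 f -> L2 g -> L2 (fun x => f x - g x).
Proof. by move=> lf lg; apply: L2D => //; exact: L2N. Qed.

Lemma L2J f : L2 f -> L2 (fun x => (f x)^*).
Proof.
move=> /L2P[mf sf]; apply: (@le_L2 _ (fun x => normc (f x) ^+ 2)) => //.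
  exact: cmeasJ.
by move=> x _; rewrite normc_conj.
Qed.

Lemma L2_ei n : L2 (ei n : R -> C).
Proof. by apply: (@bounded_L2 _ 1); [exact: cmeas_ei|move=> x _; rewrite normc_ei]. Qed.

Lemma L2_cst c : L2 (fun=> c : C).
Proof. by apply: (@bounded_L2 _ (normc c)) => //; exact: cmeas_cst. Qed.

Lemma L2_mul f g : L2 f -> L2 g -> cintegrable (fun x => f x * g x).
Proof.
move=> /L2P[mf sf] /L2P[mg sg].
apply: (@le_cintegrable _ _ (fun x => normc (f x) ^+ 2 + normc (g x) ^+ 2)).
- exact: cmeasM.
- exact: integrableDR.
- move=> x _; rewrite normc_M.
  have := sqr_ge0 (normc (f x) - normc (g x)); rewrite sqrrB.
  have : 0 <= normc (f x) * normc (g x) by rewrite mulr_ge0 ?normc_ge0.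
  lra.
Qed.

Lemma L2_cintegrable f : L2 f -> cintegrable f.
Proof.
move=> lf; apply: (@cintegrable_ext _ (fun x => 1 * f x)); first by move=> x; rewrite mul1r.
by apply: L2_mul => //; exact: L2_cst.
Qed.

Lemma L2_inner f g : L2 f -> L2 g -> cintegrable (fun x => f x * (g x)^*).
Proof. by move=> lf lg; apply: L2_mul => //; exact: L2J. Qed.

Lemma L2_ae f g : cmeas g -> aeq f g -> L2 f -> L2 g.
Proof.
move=> mg fg lf; have /L2P[mf sf] := lf; apply/L2P; split => //.
apply/integrableP; split; first (apply/measurable_EFinP; apply: cmeas_normc2; assumption).
have /integrableP[_] := sf; congr (_ < _)%E; apply: ae_eq_integral => //.
- by apply: measurableT_comp => //; (apply/measurable_EFinP; apply: cmeas_normc2; assumption).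
- by apply: measurableT_comp => //; (apply/measurable_EFinP; apply: cmeas_normc2; assumption).
- by apply: filterS fg => x h cx /=; rewrite h.
Qed.

Lemma inner_ext f f' g g' : f =1 f' -> g =1 g' -> inner f g = inner f' g'.
Proof. by move=> /funext -> /funext ->. Qed.

Lemma innerDl f g h : L2 f -> L2 g -> L2 h ->
  inner (fun x => f x + g x) h = inner f h + inner g h.
Proof.
move=> lf lg lh; rewrite /inner -mulrDr -cintegralD; try exact: L2_inner.
by congr (_ * _); apply: cintegral_ext => x _; rewrite mulrDl.
Qed.

Lemma innerZl f h c : L2 f -> L2 h -> inner (fun x => c * f x) h = c * inner f h.
Proof.
move=> lf lh; rewrite /inner mulrCA -(cintegralZ c); last exact: L2_inner.
by congr (_ * _); apply: cintegral_ext => x _; rewrite mulrA.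
Qed.

Lemma innerNl f h : L2 f -> L2 h -> inner (fun x => - f x) h = - inner f h.
Proof.
move=> lf lh; rewrite -mulN1r -innerZl//; apply: inner_ext => // x.
by rewrite mulN1r.
Qed.

Lemma innerBl f g h : L2 f -> L2 g -> L2 h ->
  inner (fun x => f x - g x) h = inner f h - inner g h.
Proof. by move=> lf lg lh; rewrite innerDl// ?innerNl//; exact: L2N. Qed.

Lemma inner_conj f g : L2 f -> L2 g -> inner g f = (inner f g)^*.
Proof.
move=> lf lg; rewrite /inner conjcM conjcR -cintegralJ; last exact: L2_inner.
by congr (_ * _); apply: cintegral_ext => x _; rewrite conjcM conjCK mulrC.
Qed.

Lemma inner_ae f f' g g' : L2 f -> L2 f' -> L2 g -> L2 g' ->
  aeq f f' -> aeq g g' -> inner f g = inner f' g'.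
Proof.
move=> lf lf' lg lg' ef eg; rewrite /inner; congr (_ * _); apply: aeq_cintegral.
- exact/cintegrable_meas/L2_inner.
- exact/cintegrable_meas/L2_inner.
- by apply: (aeq_comp2 (T := fun a b x => a x * (b x)^*)) ef eg => a b a' b' x -> ->.
Qed.

Lemma inner_sum (I : eqType) (r : seq I) (F : I -> R -> C) h :
  (forall i, i \in r -> L2 (F i)) -> L2 h ->
  inner (fun x => \sum_(i <- r) F i x) h = \sum_(i <- r) inner (F i) h.
Proof.
move=> lF lh; rewrite /inner -mulr_sumr -cintegral_sum.
  by congr (_ * _); apply: cintegral_ext => x _; rewrite mulr_suml.
by move=> i ir; apply: L2_inner => //; exact: lF.
Qed.

Lemma L2_sum (I : eqType) (r : seq I) (F : I -> R -> C) :
  (forall i, i \in r -> L2 (F i)) -> L2 (fun x => \sum_(i <- r) F i x).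
Proof.
elim: r => [|i r IH] h.
  by under [X in L2 X]eq_fun do rewrite big_nil; exact: L2_cst.
under [X in L2 X]eq_fun do rewrite big_cons.
apply: L2D; first by apply: h; rewrite mem_head.
by apply: IH => j jr; apply: h; rewrite in_cons jr orbT.
Qed.

(** The squared norm, as a real number. *)
Definition energy f : R := (2 * pi)^-1 * \int[mu]_(x in circle) (normc (f x) ^+ 2).

Lemma inner_energy f : inner f f = (energy f)%:C.
Proof.
rewrite /inner /energy rmorphM /=; congr (_ * _).
apply: ReIm_eq; rewrite /cintegral /=.
- by apply: eq_Rintegral => x _; rewrite mulcJ.
- under eq_Rintegral do rewrite mulcJ /=.
  by rewrite Rintegral_circle_cst mul0r.
Qed.

Lemma energy_ge0 f : 0 <= energy f.
Proof.
rewrite /energy mulr_ge0 ?invr_ge0 ?mulr_ge0 ?pi_ge0//.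
by apply: Rintegral_ge0 => x _; exact: sqr_ge0.
Qed.

Lemma fourierI f n : fourier f n = inner f (ei n).
Proof. by []. Qed.

Lemma fourierD f g n : L2 f -> L2 g ->
  fourier (fun x => f x + g x) n = fourier f n + fourier g n.
Proof. by move=> lf lg; rewrite !fourierI innerDl//; exact: L2_ei. Qed.

Lemma fourierZ f n c : L2 f -> fourier (fun x => c * f x) n = c * fourier f n.
Proof. by move=> lf; rewrite !fourierI innerZl//; exact: L2_ei. Qed.

Lemma fourierB f g n : L2 f -> L2 g ->
  fourier (fun x => f x - g x) n = fourier f n - fourier g n.
Proof. by move=> lf lg; rewrite !fourierI innerBl//; exact: L2_ei. Qed.

Lemma fourier_ae f g n : L2 f -> L2 g -> aeq f g -> fourier f n = fourier g n.
Proof.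
move=> lf lg fg; apply: inner_ae => //; try exact: L2_ei.
exact: aeq_refl.
Qed.

Lemma fourier_ei m n : fourier (ei m : R -> C) n = (m == n)%:R.
Proof.
rewrite fourierE (_ : cintegral _ = cintegral (ei (m - n))); last first.
  by apply: cintegral_ext => x _; rewrite eiD.
rewrite cintegral_ei subr_eq0; case: eqP => _; last by rewrite mulr0.
by rewrite -rmorphM /= mulVf// mulf_neq0// gt_eqF// pi_gt0.
Qed.

Lemma fourierJ f n : L2 f -> fourier (fun x => (f x)^*) n = (fourier f (- n))^*.
Proof.
move=> lf; rewrite !fourierE conjcM conjcR opprK -cintegralJ; last first.
  exact/cintegrable_mul_ei/L2_cintegrable.
by congr (_ * _); apply: cintegral_ext => x _; rewrite conjcM eiJ.
Qed.

Lemma fourier_mul_ei f m n : fourier (fun x => ei m x * f x) n = fourier f (n - m).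
Proof.
rewrite !fourierE; congr (_ * _); apply: cintegral_ext => x _.
by rewrite opprB eiD mulrAC mulrC mulrA.
Qed.

Lemma fourier_aeq f g : L2 f -> L2 g ->
  (forall n, fourier f n = fourier g n) -> aeq f g.
Proof.
move=> lf lg h.
have lfg : L2 (fun x => f x - g x) by exact: L2B.
have : zero_fourier (fun x => f x - g x).
  split; first exact: L2_cintegrable.
  move=> n; have /eqP := fourierB (- n) lf lg.
  rewrite h subrr fourierE opprK mulf_eq0 => /orP[|/eqP//].
  rewrite -[0]/(0%:C) (inj_eq (@complexI R)) invr_eq0 mulf_eq0 pnatr_eq0 /=.
  by rewrite gt_eqF// pi_gt0.
move=> /fourier_uniqueness; apply: filterS => x hx cx.
by apply/eqP; rewrite -subr_eq0 hx.
Qed.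

(** The energy of [f] minus its partial Fourier series is nonnegative. *)
Theorem bessel f (r : seq int) : L2 f -> uniq r ->
  \sum_(n <- r) normc (fourier f n) ^+ 2 <= energy f.
Proof.
move=> lf ur; pose g x := \sum_(n <- r) fourier f n * ei n x.
have lt n : L2 (fun x => fourier f n * ei n x) by exact/L2Z/L2_ei.
have lg : L2 g by apply: L2_sum.
have gh h : L2 h -> inner g h = \sum_(n <- r) fourier f n * (fourier h n)^*.
  move=> lh; rewrite inner_sum//; apply: eq_bigr => n _.
  rewrite innerZl//; last exact: L2_ei.
  by rewrite (inner_conj lh)//; exact: L2_ei.
have fg n : n \in r -> fourier g n = fourier f n.
  move=> nr; rewrite fourierI inner_sum//; last exact: L2_ei.
  transitivity (\sum_(m <- r) fourier f m * (m == n)%:R).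
    apply: eq_bigr => m _; rewrite innerZl; [|exact: L2_ei..].
    by rewrite -[inner _ _]/(fourier _ _) fourier_ei.
  rewrite (bigD1_seq n)//= eqxx mulr1 big1 ?addr0// => m /negbTE ->.
  by rewrite mulr0.
pose S := \sum_(n <- r) normc (fourier f n) ^+ 2.
have gf : inner g f = S%:C.
  by rewrite gh// rmorph_sum; apply: eq_bigr => n _; rewrite mulcJ.
have gg : inner g g = S%:C.
  rewrite gh// rmorph_sum big_seq [RHS]big_seq; apply: eq_bigr => n nr.
  by rewrite fg// mulcJ.
have := energy_ge0 (fun x => f x - g x).
rewrite -lecR -inner_energy innerBl//; last exact: L2B.
rewrite (inner_conj (L2B lf lg) lf) (inner_conj (L2B lf lg) lg) !innerBl//.
rewrite gf gg (inner_conj lg lf) gf inner_energy !conjcB !conjcR.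
by rewrite -!rmorphB lecR -/S; lra.
Qed.

Lemma fourier_bound f n : L2 f -> normc (fourier f n) ^+ 2 <= energy f.
Proof. by move=> lf; have := bessel lf (isT : uniq [:: n]); rewrite big_seq1. Qed.

End L2theory.

(** * The weight of the Sobolev space and its convolution inequality *)

Section Weight.
Context {R : realType} (e : {posnum R}).
Local Notation C := R[i].
Local Notation s := (1 + e%:num).

(** A function whose H^s norm is at most [M] has coefficients bounded by
    [M * wt n]; as [s > 1] the weight is summable and, up to a constant, stable
    under convolution, which makes the sequences so bounded an algebra. *)
Definition wt (n : int) : R := ((1 + n%:~R ^+ 2) `^ (s / 2))^-1.

Lemma s_gt0 : 0 < s. Proof. by rewrite addr_gt0. Qed.

Lemma half_s_ge0 : 0 <= s / 2.
Proof. by rewrite divr_ge0// ltW// s_gt0. Qed.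

Lemma wt_base_gt0 (n : int) : 0 < 1 + n%:~R ^+ 2 :> R.
Proof. by rewrite ltr_wpDr// sqr_ge0. Qed.

Lemma wt_gt0 n : 0 < wt n.
Proof. by rewrite invr_gt0 powR_gt0// wt_base_gt0. Qed.

Lemma wt_ge0 n : 0 <= wt n. Proof. exact/ltW/wt_gt0. Qed.

Lemma wtN n : wt (- n) = wt n.
Proof. by rewrite /wt intrN sqrrN. Qed.

Lemma wt_mono (m n : int) : `|m%:~R| <= `|n%:~R| :> R -> wt n <= wt m.
Proof.
move=> mn; rewrite /wt lef_pV2 ?posrE ?powR_gt0 ?wt_base_gt0//.
apply: ge0_ler_powR; rewrite ?half_s_ge0 ?nnegrE ?(ltW (wt_base_gt0 _))//.
by rewrite lerD2l -(real_normK (num_real m%:~R)) -(real_normK (num_real n%:~R)) ler_pXn2r ?nnegrE.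
Qed.

Definition wtA : R := 4 `^ (s / 2).

Lemma wtA_gt0 : 0 < wtA. Proof. exact: powR_gt0. Qed.

(** One of [k] and [n - k] is at least [n / 2] in absolute value, and its
    weight is then at most a constant times the weight of [n]. *)
Lemma wt_conv (k n : int) : wt k * wt (n - k) <= wtA * wt n * (wt k + wt (n - k)).
Proof.
rewrite /wt; set a := 1 + k%:~R ^+ 2; set b := 1 + (n - k)%:~R ^+ 2.
set c := 1 + n%:~R ^+ 2 : R; set p := s / 2.
have [a0 b0 c0] : [/\ 0 < a, 0 < b & 0 < c] by split; exact: wt_base_gt0.
have p0 : 0 <= p by exact: half_s_ge0.
have cab : c <= 2 * (a + b).
  rewrite /a /b /c rmorphB /=; have := sqr_ge0 (n%:~R - 2 * k%:~R : R).
  by rewrite !expr2; lra.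
have h : c `^ p <= wtA * (a `^ p + b `^ p).
  have P (x : R) : 0 < x -> 0 <= x `^ p by move=> x0; exact: powR_ge0.
  have [ab|ba] := leP a b.
    apply: (@le_trans _ _ ((4 * b) `^ p)).
      by apply: ge0_ler_powR; rewrite ?nnegrE; lra.
    by rewrite powRM ?(ltW b0)// ler_pM2l ?wtA_gt0// lerDr P.
  apply: (@le_trans _ _ ((4 * a) `^ p)).
    by apply: ge0_ler_powR; rewrite ?nnegrE; lra.
  by rewrite powRM ?(ltW a0)// ler_pM2l ?wtA_gt0// lerDl P.
have [A0 [B0 C0]] : 0 < a `^ p /\ 0 < b `^ p /\ 0 < c `^ p by rewrite !powR_gt0.
rewrite -(ler_pM2r A0) -(ler_pM2r B0) -(ler_pM2r C0).
rewrite [leLHS](_ : _ = c `^ p); last by field; rewrite !gt_eqF.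
by rewrite [leRHS](_ : _ = wtA * (a `^ p + b `^ p))//; field; rewrite !gt_eqF.
Qed.

Lemma wt_pow2 (i : nat) : (2 ^+ i) * wt (2 ^ i)%N <= (2 `^ (- e%:num)) ^+ i.
Proof.
have x0 : 0 < (2 : R) ^+ i by rewrite exprn_gt0.
rewrite /wt; have -> : ((2 ^ i)%N%:~R : R) = 2 ^+ i by rewrite -pmulrn natrX.
rewrite ler_pdivrMr ?powR_gt0 ?ltr_wpDr ?sqr_ge0//.
apply: (@le_trans _ _ ((2 `^ (- e%:num)) ^+ i * ((2 ^+ i) ^+ 2) `^ (s / 2))); last first.
  rewrite ler_wpM2l ?exprn_ge0 ?powR_ge0//.
  by apply: ge0_ler_powR; rewrite ?half_s_ge0 ?nnegrE ?sqr_ge0 ?addr_ge0 ?sqr_ge0 ?lerDr.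
rewrite -!powR_mulrn ?powR_ge0 ?exprn_ge0 ?ler0n//.
rewrite -!powRrM -powRD; last by rewrite pnatr_eq0 implybT.
rewrite [X in _ <= _ `^ X](_ : _ = i%:R)//.
by field.
Qed.

(** Summability by dyadic blocks: a block of length [2 ^ i] contributes at most
    [2 ^ i * wt (2 ^ i) <= (2 ^ - e) ^ i]. *)
Lemma wt_dyadic (j : nat) : \sum_(k < 2 ^ j) wt k <= 1 + \sum_(i < j) (2 `^ (- e%:num)) ^+ i.
Proof.
elim: j => [|j IH].
  rewrite expn0 big_ord1 big_ord0 addr0 /wt.
  by rewrite expr0n /= addr0 powR1 invr1.
rewrite expnS mul2n -addnn big_split_ord /= big_ord_recr /= addrA lerD//.
apply: le_trans (wt_pow2 j).
rewrite -natrX mulr_natl -[X in _ *+ X]card_ord -sumr_const.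
apply: ler_sum => i _; apply: wt_mono.
by rewrite -!pmulrn !ger0_norm ?ler0n// ler_nat leq_addr.
Qed.

Lemma wt_sum_bounded : exists B, forall N, \sum_(0 <= k < N) wt k <= B.
Proof.
set q := (2 : R) `^ (- e%:num).
have q0 : 0 < q by exact: powR_gt0.
have q1 : q < 1.
  rewrite /q powRN invf_lt1 ?powR_gt0//.
  have : 1 `^ e%:num < 2 `^ e%:num :> R.
    by apply: gt0_ltr_powR; rewrite ?nnegrE ?ler0n ?ltr1n.
  by rewrite powR1.
exists (1 + (1 - q)^-1) => N.
have NN : (N <= 2 ^ N)%N by exact/ltnW/ltn_expl.
apply: (@le_trans _ _ (\sum_(0 <= k < 2 ^ N) wt k)).
  by rewrite [leRHS](@big_cat_nat _ _ _ N)//= lerDl; apply: sumr_ge0 => i _; exact: wt_ge0.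
rewrite big_mkord; apply: (le_trans (wt_dyadic N)); rewrite lerD2l.
have h : \sum_(i < N) q ^+ i = (1 - q ^+ N) / (1 - q).
  have := congr1 (fun f : R^nat => f N) (geometric_seriesE 1 (negbT (lt_eqF q1))).
  rewrite /series /geometric /= big_mkord mul1r => <-.
  by apply: eq_bigr => i _; rewrite mul1r.
rewrite h ler_pdivrMr ?subr_gt0// mulVf ?subr_eq0 ?gt_eqF//.
by rewrite lerBlDr lerDl exprn_ge0// ltW.
Qed.

Definition wts (k : nat) : R := wt k.

Lemma wts_cvg : cvgn (series wts).
Proof.
have [B hB] := wt_sum_bounded.
apply: nondecreasing_is_cvgn.
  by apply: nondecreasing_series => n _ _; exact: wt_ge0.
by exists B => _ [N _ <-]; exact: hB.
Qed.

Definition wtot : R := limn (series wts).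

Definition wtail (N : nat) : R := wtot - series wts N.

Lemma wtail_cvg0 : wtail @ \oo --> 0.
Proof.
rewrite -(subrr wtot); apply: cvgB; [exact: cvg_cst|exact: wts_cvg].
Qed.

Lemma series_wts_le N : series wts N <= wtot.
Proof.
apply: nondecreasing_cvgn_le; last exact: wts_cvg.
by apply: nondecreasing_series => n _ _; exact: wt_ge0.
Qed.

Lemma wtail_ge0 N : 0 <= wtail N.
Proof. by rewrite subr_ge0 series_wts_le. Qed.

Lemma wtot_ge0 : 0 <= wtot.
Proof.
by apply: le_trans (series_wts_le 0); rewrite /series /= big_geq.
Qed.

Lemma wt_negz (k : nat) : wt (Negz k) <= wt k.
Proof. by apply: wt_mono; rewrite NegzE intrN normrN -!pmulrn !ger0_norm ?ler0n ?ler_nat. Qed.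

(** A junk value unless the series of real and imaginary parts converge. *)
Definition csum (z : nat -> C) : C :=
  limn (series (fun k => Re (z k))) +i* limn (series (fun k => Im (z k))).

Lemma Re_sum (z : nat -> C) (m n : nat) :
  Re (\sum_(m <= k < n) z k) = \sum_(m <= k < n) Re (z k).
Proof. by elim/big_rec2: _ => // i x y _ <-; rewrite cReD. Qed.

Lemma Im_sum (z : nat -> C) (m n : nat) :
  Im (\sum_(m <= k < n) z k) = \sum_(m <= k < n) Im (z k).
Proof. by elim/big_rec2: _ => // i x y _ <-; rewrite cImD. Qed.

Lemma real_series_tail (z a : nat -> R) (A : R) (N : nat) :
  (forall k, `|z k| <= a k) -> series a @ \oo --> A ->
  cvgn (series z) /\ `|limn (series z) - series z N| <= A - series a N.
Proof.
move=> za cA; have cz : cvgn (series z).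
  apply: normed_cvg; apply: (series_le_cvg _ _ za) => //.
    by move=> k; exact: le_trans (za k).
  by apply/cvg_ex; exists A.
split=> //.
have c1 : `|series z M - series z N| @[M --> \oo] --> `|limn (series z) - series z N|.
  by apply: cvg_norm; apply: cvgB => //; exact: cvg_cst.
have c2 : (series a M - series a N) @[M --> \oo] --> A - series a N.
  by apply: cvgB => //; exact: cvg_cst.
apply: (ler_cvg_to c1 c2); near=> M.
have NM : (N <= M)%N by near: M; exact: nbhs_infty_ge.
rewrite !sub_series_geq//; apply: (le_trans (ler_norm_sum _ _ _)).
exact: ler_sum.
Unshelve. all: by end_near. Qed.

Lemma csum_tail (z : nat -> C) (a : nat -> R) (A : R) (N : nat) :
  (forall k, normc (z k) <= a k) -> series a @ \oo --> A ->
  normc (csum z - \sum_(0 <= k < N) z k) <= 2 * (A - series a N).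
Proof.
move=> za cA.
have [_ h1] := @real_series_tail (fun k => Re (z k)) a A N
  (fun k => le_trans (Re_le_normc _) (za k)) cA.
have [_ h2] := @real_series_tail (fun k => Im (z k)) a A N
  (fun k => le_trans (Im_le_normc _) (za k)) cA.
apply: (le_trans (normc_le_ReIm _)); rewrite mulr2n mulrDl mul1r.
by rewrite cReD cReN cImD cImN Re_sum Im_sum lerD.
Qed.

Lemma csum_cvg (z : nat -> C) (a : nat -> R) :
  (forall k, normc (z k) <= a k) -> cvgn (series a) ->
  (Re (\sum_(0 <= k < N) z k) @[N --> \oo] --> Re (csum z)) /\
  (Im (\sum_(0 <= k < N) z k) @[N --> \oo] --> Im (csum z)).
Proof.
move=> za cA.
have [h1 _] := @real_series_tail (fun k => Re (z k)) a _ 0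
  (fun k => le_trans (Re_le_normc _) (za k)) cA.
have [h2 _] := @real_series_tail (fun k => Im (z k)) a _ 0
  (fun k => le_trans (Im_le_normc _) (za k)) cA.
by split; [under eq_fun do rewrite Re_sum|under eq_fun do rewrite Im_sum].
Qed.

End Weight.

(** * Absolutely convergent Fourier series *)

Section Synthesis.
Context {R : realType} (e : {posnum R}).
Local Notation C := R[i].
Local Notation mu := (@lebesgue_measure R).
Local Notation wt := (wt e).
Implicit Types (c d : int -> C) (M : R) (n : int) (N k : nat).

Definition bnd c M := forall n, normc (c n) <= M * wt n.

Lemma bnd_ge0 c M : bnd c M -> 0 <= M.
Proof.
move=> h; have := le_trans (normc_ge0 _) (h 0).
by rewrite pmulr_lge0// wt_gt0.
Qed.

Lemma le_bnd c M M' : M <= M' -> bnd c M -> bnd c M'.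
Proof. by move=> MM' h n; apply: (le_trans (h n)); rewrite ler_wpM2r// wt_ge0. Qed.

Lemma bndD c d M M' : bnd c M -> bnd d M' -> bnd (fun n => c n + d n) (M + M').
Proof.
by move=> hc hd n; apply: (le_trans (normc_D _ _)); rewrite mulrDl lerD.
Qed.

Lemma bndN c M : bnd c M -> bnd (fun n => - c n) M.
Proof. by move=> hc n; rewrite normc_N. Qed.

Lemma bndB c d M M' : bnd c M -> bnd d M' -> bnd (fun n => c n - d n) (M + M').
Proof. by move=> hc /bndN; exact: bndD. Qed.

Lemma bndZ (a : C) c M : bnd c M -> bnd (fun n => a * c n) (normc a * M).
Proof. by move=> hc n; rewrite normc_M -mulrA ler_wpM2l ?normc_ge0. Qed.

Definition pterm c (x : R) (k : nat) : C :=
  c (Posz k) * ei k x + c (Negz k) * ei (Negz k) x.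

Definition psum c (N : nat) (x : R) : C := \sum_(0 <= k < N) pterm c x k.

(** The function with coefficients [c]. The frequencies [k] and [- k - 1] are
    paired in [pterm], so that one series over the natural numbers runs over
    all the integers. *)
Definition synth c (x : R) : C := csum (pterm c x).

Lemma pterm_le c M x k : bnd c M -> normc (pterm c x k) <= 2 * M * wts e k.
Proof.
move=> hc; have M0 := bnd_ge0 hc.
apply: (le_trans (normc_D _ _)); rewrite !normc_M !normc_ei !mulr1.
rewrite -mulrA mulr2n mulrDl mul1r lerD//.
apply: (le_trans (hc _)); rewrite ler_wpM2l//; exact: wt_negz.
Qed.

Lemma wts_scaled (a : R) : series (fun k => a * wts e k) @ \oo --> a * wtot e.
Proof.
rewrite (_ : series _ = (fun N => a * series (wts e) N)); last first.
  by apply/funext => N; rewrite /series /= mulr_sumr.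
by apply: cvgMl_tmp; exact: wts_cvg.
Qed.

Lemma synth_tail c M x N : bnd c M ->
  normc (synth c x - psum c N x) <= 4 * M * wtail e N.
Proof.
move=> hc; have := @csum_tail R (pterm c x) _ _ N (fun k => pterm_le x k hc)
  (@wts_scaled (2 * M)).
rewrite (_ : series _ N = 2 * M * series (wts e) N); last first.
  by rewrite /series /= mulr_sumr.
by rewrite /wtail -mulrBr !mulrA -natrM.
Qed.

Lemma synth_bound c M x : bnd c M -> normc (synth c x) <= 4 * M * wtot e.
Proof.
move=> /(@synth_tail _ _ x 0); rewrite /psum big_geq// subr0 /wtail.
by rewrite /series /= big_geq// subr0.
Qed.

Lemma cmeas_pterm c k : cmeas (fun x => pterm c x k).
Proof. by apply: cmeasD; apply: cmeasM; try exact: cmeas_cst; exact: cmeas_ei. Qed.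

Lemma cmeas_psum c N : cmeas (psum c N).
Proof.
elim: N => [|N IH].
  under [X in cmeas X]funext do rewrite /psum big_geq//.
  exact: cmeas_cst.
rewrite (_ : psum c N.+1 = fun x => psum c N x + pterm c x N); last first.
  by apply/funext => x; rewrite /psum big_nat_recr.
by apply: cmeasD => //; exact: cmeas_pterm.
Qed.

Lemma cmeas_synth c M : bnd c M -> cmeas (synth c).
Proof.
move=> hc.
have h x := @csum_cvg R (pterm c x) _ (fun k => pterm_le x k hc)
  (cvgP _ (@wts_scaled (2 * M))).
split.
- apply: (@measurable_fun_cvg _ _ _ _ (fun N x => Re (psum c N x))).
  + by move=> N; case: (cmeas_psum c N).
  + by move=> x _; case: (h x).
- apply: (@measurable_fun_cvg _ _ _ _ (fun N x => Im (psum c N x))).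
  + by move=> N; case: (cmeas_psum c N).
  + by move=> x _; case: (h x).
Qed.

Lemma L2_synth c M : bnd c M -> L2 (synth c).
Proof.
move=> hc; apply: (@bounded_L2 _ _ (4 * M * wtot e)); first exact: cmeas_synth hc.
by move=> x _; exact: synth_bound.
Qed.

Lemma L2_synth_mul c M w : bnd c M -> L2 w -> L2 (fun x => synth c x * w x).
Proof.
move=> hc lw; apply: (@L2Mb _ _ _ (4 * M * wtot e)) => //; first exact: cmeas_synth hc.
by move=> x _; exact: synth_bound.
Qed.

(** The partial sum of the convolution of [c] and [w] at [n], in the order of
    the partial sums of [synth]. *)
Definition cpart c (w : int -> C) n N : C := \sum_(0 <= k < N)
  (c (Posz k) * w (n - Posz k) + c (Negz k) * w (n - Negz k)).

Lemma L2_ei_mul n (w : R -> C) : L2 w -> L2 (fun x => ei n x * w x).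
Proof.
move=> lw; apply: (@L2Mb _ _ _ 1) => //; first exact: cmeas_ei.
by move=> x _; rewrite normc_ei.
Qed.

Lemma L2_psum_mul c N w : L2 w -> L2 (fun x => psum c N x * w x).
Proof.
move=> lw; elim: N => [|N IH].
  under [X in L2 X]funext do rewrite /psum big_geq// mul0r.
  exact: L2_cst.
rewrite (_ : (fun x => _) = fun x => psum c N x * w x +
  (c N * (ei N x * w x) + c (Negz N) * (ei (Negz N) x * w x))).
  by apply: L2D => //; apply: L2D; apply: L2Z; exact: L2_ei_mul.
by apply/funext => x; rewrite /psum big_nat_recr//= mulrDl /pterm; ring.
Qed.

Lemma fourier_psum_mul c N w n : L2 w ->
  fourier (fun x => psum c N x * w x) n = cpart c (fourier w) n N.
Proof.
move=> lw; elim: N => [|N IH].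
  rewrite /cpart big_geq//.
  rewrite (_ : (fun x => _) = fun x => 0 * w x) ?fourierZ ?mul0r//.
  by apply/funext => x; rewrite /psum big_geq.
rewrite (_ : (fun x => _) = fun x => psum c N x * w x +
  (c N * (ei N x * w x) + c (Negz N) * (ei (Negz N) x * w x))); last first.
  by apply/funext => x; rewrite /psum big_nat_recr//= mulrDl /pterm; ring.
have l1 m := L2_ei_mul m lw.
rewrite fourierD; [|exact: L2_psum_mul|by apply: L2D; exact: L2Z].
rewrite IH /cpart big_nat_recr//=; congr (_ + _).
by rewrite fourierD ?fourierZ ?fourier_mul_ei//; exact: L2Z.
Qed.

Definition l1norm (w : R -> C) : R :=
  \int[mu]_(x in circle) (`|Re (w x)| + `|Im (w x)|).

Lemma fourier_le g w (B : R) n : cmeas g -> L2 w -> 0 <= B ->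
  (forall x, circle x -> normc (g x) <= B) ->
  normc (fourier (fun x => g x * w x) n) <= pi^-1 * l1norm w * B.
Proof.
move=> mg lw B0 gB; rewrite fourierE normc_M normc_real.
rewrite ger0_norm ?invr_ge0 ?mulr_ge0 ?pi_ge0//.
have iw := L2_cintegrable lw.
have ig : cintegrable (fun x => g x * w x) by exact: (cintegrableMb iw mg gB).
have h := @cintegral_le R (fun x => g x * w x * ei (- n) x)
  (fun x => B * (`|Re (w x)| + `|Im (w x)|)) (cintegrable_mul_ei (- n) ig)
  (integrableZlR _ (normc_integrable iw)).
rewrite RintegralZl in h => //; last exact: normc_integrable.
apply: (@le_trans _ _ ((2 * pi)^-1 * (2 * (B * l1norm w)))).
  rewrite ler_wpM2l ?invr_ge0 ?mulr_ge0 ?pi_ge0//; apply: h => x cx.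
  rewrite !normc_M normc_ei mulr1 ler_pM ?normc_ge0 ?gB//.
  exact: normc_le_ReIm.
have pi0 := @pi_gt0 R.
have aux (p b l : R) : p != 0 -> (2 * p)^-1 * (2 * (b * l)) = p^-1 * l * b.
  by move=> p0; field.
by rewrite aux// gt_eqF.
Qed.

(** The Fourier coefficients of a product with an absolutely convergent series
    are convolutions; the error of the partial sums is uniform, since the
    partial sums of the series converge uniformly. *)
Lemma fourier_synth_tail c M w n N : bnd c M -> L2 w ->
  normc (fourier (fun x => synth c x * w x) n - cpart c (fourier w) n N) <=
  pi^-1 * l1norm w * (4 * M * wtail e N).
Proof.
move=> hc lw; have M0 := bnd_ge0 hc.
rewrite -fourier_psum_mul// -fourierB; [|exact: L2_synth_mul hc _|exact: L2_psum_mul].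
rewrite (_ : (fun x => _) = fun x => (synth c x - psum c N x) * w x).
  apply: fourier_le => //.
  - apply: cmeasD; first exact: cmeas_synth hc.
    by apply: cmeasN; exact: cmeas_psum.
  - by rewrite !mulr_ge0// wtail_ge0.
  - by move=> x _; exact: synth_tail.
by apply/funext => x; rewrite mulrBl.
Qed.

Lemma wtail_le (x D K : R) : (forall N, x <= D + K * wtail e N) -> x <= D.
Proof.
move=> h; have c1 : (D + K * wtail e N) @[N --> \oo] --> D + K * 0.
  apply: cvgD; first exact: cvg_cst.
  by apply: cvgMl_tmp; exact: wtail_cvg0.
rewrite mulr0 addr0 in c1.
by apply: (ler_cvg_to (cvg_cst x) c1); exact: nearW.
Qed.

Lemma fourier_synth_le c M w n (D : R) : bnd c M -> L2 w ->
  (forall N, normc (cpart c (fourier w) n N) <= D) ->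
  normc (fourier (fun x => synth c x * w x) n) <= D.
Proof.
move=> hc lw h; apply: (@wtail_le _ _ (pi^-1 * l1norm w * (4 * M))) => N.
rewrite -(subrK (cpart c (fourier w) n N) (fourier _ n)) addrC.
apply: (le_trans (normc_D _ _)); rewrite lerD//.
by apply: (le_trans (fourier_synth_tail n N hc lw)); rewrite !mulrA.
Qed.

Lemma fourier_synth_eq c M w n (z : C) (N0 : nat) : bnd c M -> L2 w ->
  (forall N, (N0 <= N)%N -> cpart c (fourier w) n N = z) ->
  fourier (fun x => synth c x * w x) n = z.
Proof.
move=> hc lw h; apply/eqP; rewrite -subr_eq0 -normc_eq0 eq_le normc_ge0 andbT.
pose K := pi^-1 * l1norm w * (4 * M).
have c1 : (K * wtail e N) @[N --> \oo] --> K * 0.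
  by apply: cvgMl_tmp; exact: wtail_cvg0.
rewrite mulr0 in c1; apply: (ler_cvg_to (cvg_cst _) c1).
near=> N; rewrite -(h N); last by near: N; exact: nbhs_infty_ge.
by apply: (le_trans (fourier_synth_tail n N hc lw)); rewrite /K !mulrA.
Unshelve. all: by end_near. Qed.

Lemma cpart_delta c n (N : nat) : (`|n| < N)%N ->
  cpart c (fun m : int => (m == 0)%:R) n N = c n.
Proof.
move=> nN; rewrite /cpart.
case: n nN => m mN.
- rewrite (bigD1_seq m) ?mem_index_iota ?iota_uniq//=.
  rewrite subrr eqxx mulr1 subr_eq0 mulr0 addr0 big1 ?addr0// => k km.
  by rewrite !subr_eq0 eqz_nat eq_sym (negbTE km) !mulr0 addr0.
- have mN' : (m < N)%N by exact: leq_ltn_trans mN.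
  rewrite (bigD1_seq m) ?mem_index_iota ?iota_uniq//=.
  rewrite subrr eqxx mulr1 subr_eq0 mulr0 add0r big1 ?addr0// => k km.
  rewrite !subr_eq0 [Negz m == Negz k](_ : _ = false) ?mulr0 ?addr0//.
  by apply/negbTE; apply: contra km => /eqP[->].
Qed.

Lemma fourier_synth c M n : bnd c M -> fourier (synth c) n = c n.
Proof.
move=> hc; rewrite (_ : synth c = fun x => synth c x * 1); last first.
  by apply/funext => x; rewrite mulr1.
apply: (@fourier_synth_eq _ M (fun=> 1) _ _ `|n|.+1) => //; first exact: L2_cst.
move=> N nN; rewrite -[RHS](@cpart_delta c n N)//.
rewrite /cpart; apply: eq_bigr => k _.
have f1 m : fourier (fun=> 1) m = (m == 0)%:R :> C.
  rewrite (_ : (fun=> 1) = ei 0); first by rewrite fourier_ei eq_sym.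
  by apply/funext => x; rewrite ei0.
by rewrite !f1.
Qed.

Lemma wt_sum_uniq (r : seq int) : uniq r -> \sum_(m <- r) wt m <= 2 * wtot e.
Proof.
move=> ur; pose K := (\max_(m <- r) `|m|).+1.
pose t := [seq Posz k | k <- iota 0 K] ++ [seq Negz k | k <- iota 0 K].
have ut : uniq t.
  rewrite cat_uniq; apply/and3P; split.
  - by rewrite map_inj_uniq ?iota_uniq// => x y [].
  - by apply/hasPn => x /mapP[k _ ->]; apply/mapP => -[].
  - by rewrite map_inj_uniq ?iota_uniq// => x y [].
have rt m : m \in r -> m \in t.
  move=> mr; have mK : (`|m| < K)%N.
    by rewrite ltnS; exact: (@leq_bigmax_seq _ r xpredT (fun m : int => `|m|%N)).
  rewrite mem_cat; apply/orP; case: m {mr} mK => k kK; [left|right];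
    apply: map_f; rewrite mem_iota //=; exact: ltnW.
apply: (@le_trans _ _ (\sum_(m <- t) wt m)).
  have pr : perm_eq r [seq m <- t | m \in r].
    apply: uniq_perm => //; first exact: filter_uniq.
    by move=> m; rewrite mem_filter; case mr : (m \in r) => //=; rewrite rt.
  rewrite (perm_big _ pr) big_filter [leRHS](bigID (mem r))/= lerDl.
  by apply: sumr_ge0 => m _; exact: wt_ge0.
have h : \sum_(0 <= k < K) wt k <= wtot e by exact: series_wts_le.
move: h; rewrite /index_iota subn0 => h.
rewrite /t big_cat !big_map mulr2n mulrDl mul1r.
apply: lerD => //; apply: le_trans h.
by apply: ler_sum => k _; exact: wt_negz.
Qed.

Definition convM : R := wtA e * (8 * wtot e).

Lemma convM_ge0 : 0 <= convM.
Proof. by rewrite /convM !mulr_ge0 ?wtot_ge0// ltW// wtA_gt0. Qed.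

(** By [wt_conv] each term of the convolution is at most a constant times
    [wt n (wt m + wt (n - m))], and the weight is summable. *)
Lemma cpart_conv_le c d M M' n N : bnd c M -> bnd d M' ->
  normc (cpart c d n N) <= M * M' * convM * wt n.
Proof.
move=> hc hd; have M0 := bnd_ge0 hc; have M0' := bnd_ge0 hd.
have u1 (f : nat -> int) : injective f ->
    \sum_(0 <= k < N) wt (f k) <= 2 * wtot e.
  by move=> fi; rewrite -(big_map f xpredT) wt_sum_uniq// map_inj_uniq ?iota_uniq.
have h1 : \sum_(0 <= k < N) wt (Posz k) <= 2 * wtot e by apply: u1 => x y [].
have h2 : \sum_(0 <= k < N) wt (Negz k) <= 2 * wtot e by apply: u1 => x y [].
have h3 : \sum_(0 <= k < N) wt (n - Posz k) <= 2 * wtot e.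
  by apply: u1 => x y /addrI /oppr_inj [].
have h4 : \sum_(0 <= k < N) wt (n - Negz k) <= 2 * wtot e.
  by apply: u1 => x y /addrI /oppr_inj [].
apply: (le_trans (normc_sum _ _ _)).
have K0 : 0 <= M * M' * (wtA e * wt n).
  by rewrite !mulr_ge0// ?wt_ge0// ltW// wtA_gt0.
apply: (@le_trans _ _ (\sum_(0 <= k < N) M * M' * (wtA e * wt n) *
    (wt k + wt (n - Posz k) + (wt (Negz k) + wt (n - Negz k))))).
  apply: ler_sum => k _; apply: (le_trans (normc_D _ _)).
  have t m : normc (c m * d (n - m)) <= M * M' * (wtA e * wt n) * (wt m + wt (n - m)).
    rewrite normc_M; apply: (@le_trans _ _ (M * wt m * (M' * wt (n - m)))).
      by rewrite ler_pM ?normc_ge0.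
    by rewrite mulrACA -[leRHS]mulrA ler_wpM2l ?mulr_ge0//; exact: wt_conv.
  by rewrite mulrDr lerD.
rewrite -mulr_sumr !big_split /=.
have -> : M * M' * convM * wt n = M * M' * (wtA e * wt n) * (8 * wtot e).
  by rewrite /convM; ring.
by rewrite ler_wpM2l//; lra.
Qed.

End Synthesis.

(** * The convolution algebra of weighted sequences *)

(** The sequences dominated by a multiple of the weight. They contain the
    coefficients of all H^s functions, and have a product. *)
Record wal (R : realType) (e : {posnum R}) :=
  Wal { wcoef :> int -> R[i]; walP : exists M, bnd e wcoef M }.

#[global] Arguments normc : simpl never.
#[global] Arguments fourier : simpl never.
#[global] Arguments inner : simpl never.
#[global] Arguments synth : simpl never.

Section WienerAlgebra.
Context {R : realType} {e : {posnum R}}.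
Local Notation C := R[i].
Local Notation wt := (wt e).
Local Notation bnd := (bnd e).
Local Notation wal := (wal e).
Implicit Types (c d h : wal) (M : R) (m n : int).

Lemma walE c d : (forall n, c n = d n) -> c = d.
Proof.
case: c d => [c hc] [d hd] /= /funext cd; subst d.
by congr Wal; exact: Prop_irrelevance.
Qed.

HB.instance Definition _ := gen_eqMixin wal.
HB.instance Definition _ := gen_choiceMixin wal.

Fact wzero_subproof : exists M, bnd (fun=> 0) M.
Proof. by exists 0 => n; rewrite normc_0 mul0r. Qed.
Definition wzero : wal := Wal wzero_subproof.

Fact wadd_subproof c d : exists M, bnd (fun n => c n + d n) M.
Proof.
by case: (walP c) (walP d) => M hM [M' hM']; exists (M + M'); exact: bndD.
Qed.
Definition wadd c d : wal := Wal (wadd_subproof c d).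

Fact wopp_subproof c : exists M, bnd (fun n => - c n) M.
Proof. by case: (walP c) => M hM; exists M; exact: bndN. Qed.
Definition wopp c : wal := Wal (wopp_subproof c).

Fact waddA : associative wadd.
Proof. by move=> a b c; apply: walE => n /=; rewrite addrA. Qed.
Fact waddC : commutative wadd.
Proof. by move=> a b; apply: walE => n /=; rewrite addrC. Qed.
Fact wadd0 : left_id wzero wadd.
Proof. by move=> a; apply: walE => n /=; rewrite add0r. Qed.
Fact waddN : left_inverse wzero wopp wadd.
Proof. by move=> a; apply: walE => n /=; rewrite addNr. Qed.
HB.instance Definition _ := GRing.isZmodule.Build wal waddA waddC wadd0 waddN.

Lemma wL2 c : L2 (synth c).
Proof. by case: (walP c) => M; exact: L2_synth. Qed.

Lemma wL2_mul c w : L2 w -> L2 (fun x => synth c x * w x).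
Proof. by case: (walP c) => M hM; exact: L2_synth_mul hM. Qed.

Lemma wfourier c n : fourier (synth c) n = c n.
Proof. by case: (walP c) => M hM; exact: fourier_synth hM. Qed.

Lemma aeq_synth f c : L2 f -> (forall n, fourier f n = c n) -> aeq f (synth c).
Proof.
by move=> lf fc; apply: fourier_aeq => //; [exact: wL2|move=> n; rewrite fc wfourier].
Qed.

Lemma fourier_mul_ae (f f' g g' : R -> C) n :
  L2 (fun x => f x * g x) -> L2 (fun x => f' x * g' x) ->
  aeq f f' -> aeq g g' ->
  fourier (fun x => f x * g x) n = fourier (fun x => f' x * g' x) n.
Proof.
move=> l l' ff' gg'; apply: fourier_ae => //.
by apply: (aeq_comp2 (T := fun a b x => a x * b x)) ff' gg' => a b a' b' x -> ->.
Qed.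

Lemma fourier_mul_le c (w : R -> C) (M D : R) n : bnd c M -> L2 w -> bnd (fourier w) D ->
  normc (fourier (fun x => synth c x * w x) n) <= M * D * convM e * wt n.
Proof.
move=> hc lw hw; apply: (fourier_synth_le hc lw) => N.
exact: (cpart_conv_le n N hc hw).
Qed.

(** The product is defined through functions, as the coefficients of the
    product of the two sums; associativity and the other ring axioms are then
    inherited from the pointwise product, with no rearrangement of double
    series. *)
Fact wmul_subproof c d :
  exists M, bnd (fourier (fun x => synth c x * synth d x)) M.
Proof.
case: (walP c) (walP d) => M hM [M' hM']; exists (M * M' * convM e) => n.
apply: fourier_mul_le => //; first exact: wL2.
by move=> m; rewrite wfourier.
Qed.
Definition wmul c d : wal := Wal (wmul_subproof c d).

Lemma wmulE c d n : wmul c d n = fourier (fun x => synth c x * synth d x) n.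
Proof. by []. Qed.

Fact wdelta_subproof m : exists M, bnd (fun n => (n == m)%:R) M.
Proof.
exists (wt m)^-1 => n; case: eqP => [->|_].
  by rewrite normc_1 mulVf// gt_eqF// wt_gt0.
by rewrite mulr0n normc_0 mulr_ge0 ?wt_ge0// invr_ge0 wt_ge0.
Qed.
(** The coefficients of [z ^ m]. *)
Definition wdelta m : wal := Wal (wdelta_subproof m).

Lemma synth_delta m : aeq (ei m) (synth (wdelta m)).
Proof.
by apply: aeq_synth; [exact: L2_ei|move=> n; rewrite fourier_ei /= eq_sym].
Qed.

Lemma synth_mul c d : aeq (fun x => synth c x * synth d x) (synth (wmul c d)).
Proof. by apply: aeq_synth => //; exact/wL2_mul/wL2. Qed.

Lemma synth_add c d : aeq (fun x => synth c x + synth d x) (synth (wadd c d)).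
Proof.
apply: aeq_synth; first by apply: L2D; exact: wL2.
by move=> n; rewrite fourierD ?wfourier//; exact: wL2.
Qed.

Fact wmulC : commutative wmul.
Proof.
move=> c d; apply: walE => n; rewrite !wmulE.
by rewrite (_ : (fun x => _) = (fun x => synth d x * synth c x))//;
  apply/funext => x; rewrite mulrC.
Qed.

Fact wmulA : associative wmul.
Proof.
move=> a b c; apply: walE => n; rewrite !wmulE.
have E : (fun x => synth a x * synth b x * synth c x) =
         (fun x => synth a x * (synth b x * synth c x)).
  by apply/funext => x; rewrite mulrA.
transitivity (fourier (fun x => synth a x * (synth b x * synth c x)) n).
  apply: fourier_mul_ae.
  - exact/wL2_mul/wL2.
  - exact/wL2_mul/wL2_mul/wL2.
  - exact: aeq_refl.
  - exact/aeq_sym/synth_mul.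
transitivity (fourier (fun x => (synth a x * synth b x) * synth c x) n).
  by rewrite E.
apply: fourier_mul_ae.
- by rewrite E; exact/wL2_mul/wL2_mul/wL2.
- exact/wL2_mul/wL2.
- exact: synth_mul.
- exact: aeq_refl.
Qed.

Lemma wdeltaM m c n : wmul (wdelta m) c n = c (n - m).
Proof.
rewrite wmulE -(wfourier c) -fourier_mul_ei; apply: fourier_mul_ae.
- exact/wL2_mul/wL2.
- exact/L2_ei_mul/wL2.
- exact/aeq_sym/synth_delta.
- exact: aeq_refl.
Qed.

Fact wmul1 : left_id (wdelta 0) wmul.
Proof. by move=> c; apply: walE => n; rewrite wdeltaM subr0. Qed.

Fact wmulDl : left_distributive wmul wadd.
Proof.
move=> a b c; apply: walE => n; rewrite wmulE -[RHS]/(wmul a c n + wmul b c n) !wmulE.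
rewrite -fourierD; [|exact/wL2_mul/wL2..].
have E : (fun x => synth a x * synth c x + synth b x * synth c x) =
         (fun x => (synth a x + synth b x) * synth c x).
  by apply/funext => x; rewrite mulrDl.
rewrite E; apply: fourier_mul_ae.
- exact/wL2_mul/wL2.
- by rewrite -E; apply: L2D; exact/wL2_mul/wL2.
- exact/aeq_sym/synth_add.
- exact: aeq_refl.
Qed.

Fact w1_neq0 : wdelta 0 != wzero.
Proof.
by apply/eqP => /(congr1 (fun c : wal => c 0)) /= /eqP; rewrite oner_eq0.
Qed.

HB.instance Definition _ :=
  GRing.Zmodule_isComNzRing.Build wal wmulA wmulC wmul1 wmulDl w1_neq0.

Lemma wcoefD c d n : (c + d) n = c n + d n. Proof. by []. Qed.
Lemma wcoefN c n : (- c) n = - c n. Proof. by []. Qed.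
Lemma wcoefB c d n : (c - d) n = c n - d n. Proof. by []. Qed.
Lemma wcoef0 n : (0 : wal) n = 0. Proof. by []. Qed.
Lemma wcoef1 n : (1 : wal) n = (n == 0)%:R. Proof. by []. Qed.
Lemma wcoef_delta m c n : (wdelta m * c) n = c (n - m).
Proof. exact: wdeltaM. Qed.

Lemma wcoefM c d n : (c * d) n = fourier (fun x => synth c x * synth d x) n.
Proof. by []. Qed.

Lemma wdeltaD m n : wdelta (m + n) = wdelta m * wdelta n.
Proof.
by apply: walE => k; rewrite wcoef_delta /= subr_eq addrC.
Qed.

Lemma wmul_bnd c d M M' : bnd c M -> bnd d M' -> bnd (c * d) (M * M' * convM e).
Proof.
move=> hc hd n; rewrite wcoefM; apply: fourier_mul_le => //; first exact: wL2.
by move=> m; rewrite wfourier.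
Qed.

(** A coefficient of a product is a convolution, so it vanishes when each of
    the pairs of frequencies that contribute to it does. *)
Lemma wmul_coef_eq0 c d n : (forall m, c m * d (n - m) = 0) -> (c * d) n = 0.
Proof.
move=> h; rewrite wcoefM; case: (walP c) => M hM.
apply: (fourier_synth_eq (N0 := 0) hM); first exact: wL2.
move=> N _; rewrite /cpart big1// => k _.
by rewrite !wfourier !h addr0.
Qed.

Fact wscale_subproof (a : C) c : exists M, bnd (fun n => a * c n) M.
Proof. by case: (walP c) => M hM; exists (normc a * M); exact: bndZ. Qed.
Definition wscale (a : C) c : wal := Wal (wscale_subproof a c).

Definition scal (a : C) : wal := wscale a 1.

Lemma synth_scale a c : aeq (fun x => a * synth c x) (synth (wscale a c)).
Proof.
apply: aeq_synth; first exact/L2Z/wL2.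
by move=> n; rewrite fourierZ ?wfourier//; exact: wL2.
Qed.

Lemma scalM a c n : (scal a * c) n = a * c n.
Proof.
rewrite wcoefM -(wfourier c) -fourierZ; last exact: wL2.
have E : (fun x => a * synth c x) = (fun x => (a * ei 0 x) * synth c x).
  by apply/funext => x; rewrite ei0 mulr1.
rewrite E; apply: fourier_mul_ae.
- exact/wL2_mul/wL2.
- by rewrite -E; exact/L2Z/wL2.
- apply: aeq_trans (aeq_sym (synth_scale a 1)) _.
  apply: (aeq_comp (T := fun f x => a * f x)); first by move=> ? ? ? ->.
  exact/aeq_sym/synth_delta.
- exact: aeq_refl.
Qed.

Fact scal_is_additive : additive scal.
Proof. by move=> a b; apply: walE => n /=; rewrite mulrBl. Qed.
Fact scal_is_multiplicative : multiplicative scal.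
Proof.
split; last by apply: walE => n /=; rewrite mul1r.
by move=> a b; apply: walE => n; rewrite scalM /= mulrA.
Qed.
HB.instance Definition _ := GRing.isAdditive.Build C wal scal scal_is_additive.
HB.instance Definition _ := GRing.isMultiplicative.Build C wal scal scal_is_multiplicative.

Fact wstar_subproof c : exists M, bnd (fun n => (c (- n))^*) M.
Proof.
by case: (walP c) => M hM; exists M => n; rewrite normc_conj -wtN.
Qed.
(** The coefficients of the complex conjugate function. *)
Definition wstar c : wal := Wal (wstar_subproof c).

Lemma synth_star c : aeq (fun x => (synth c x)^*) (synth (wstar c)).
Proof.
apply: aeq_synth; first exact/L2J/wL2.
by move=> n; rewrite fourierJ ?wfourier//; exact: wL2.
Qed.

Fact wstar_is_additive : additive wstar.
Proof. by move=> a b; apply: walE => n /=; rewrite rmorphB. Qed.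
Fact wstar_is_multiplicative : multiplicative wstar.
Proof.
split; last first.
  by apply: walE => n /=; rewrite oppr_eq0; case: eqP => _; rewrite ?rmorph1 ?rmorph0.
move=> a b; apply: walE => n.
rewrite -[LHS]/((wmul a b (- n))^*) wmulE -fourierJ; last exact/wL2_mul/wL2.
have E : (fun x => (synth a x * synth b x)^*) = (fun x => (synth a x)^* * (synth b x)^*).
  by apply/funext => x; rewrite rmorphM.
rewrite wcoefM E; apply: fourier_mul_ae.
- by rewrite -E; exact/L2J/wL2_mul/wL2.
- exact/wL2_mul/wL2.
- exact: synth_star.
- exact: synth_star.
Qed.
HB.instance Definition _ := GRing.isAdditive.Build wal wal wstar wstar_is_additive.
HB.instance Definition _ := GRing.isMultiplicative.Build wal wal wstar wstar_is_multiplicative.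

Lemma wstarE c n : wstar c n = (c (- n))^*. Proof. by []. Qed.

Lemma wstarK c : wstar (wstar c) = c.
Proof. by apply: walE => n; rewrite !wstarE opprK conjCK. Qed.

Lemma wstar_delta m : wstar (wdelta m) = wdelta (- m).
Proof.
apply: walE => n /=; rewrite eqr_oppLR.
by case: eqP => _; rewrite ?rmorph1 ?rmorph0.
Qed.

Lemma wstar_scal a : wstar (scal a) = scal (a^*).
Proof.
apply: walE => n /=; rewrite rmorphM /= oppr_eq0.
by case: eqP => _; rewrite ?rmorph1 ?rmorph0.
Qed.

Lemma wstar_bnd c M : bnd c M -> bnd (wstar c) M.
Proof. by move=> h n; rewrite wstarE normc_conj -wtN. Qed.

Definition wtr_fun (c : int -> C) (n : int) : C := if n is Posz _ then c n else 0.

Fact wtr_subproof c : exists M, bnd (wtr_fun c) M.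
Proof.
case: (walP c) => M hM; exists M => -[n|n]; first exact: hM.
have -> : wtr_fun c (Negz n) = 0 by [].
by rewrite normc_0 mulr_ge0 ?wt_ge0// (bnd_ge0 hM).
Qed.
(** The coefficients of the projection on the Hardy space. *)
Definition wtr c : wal := Wal (wtr_subproof c).

Fact wtr_is_additive : additive wtr.
Proof. by move=> a b; apply: walE => -[n|n] /=; rewrite ?subr0. Qed.
HB.instance Definition _ := GRing.isAdditive.Build wal wal wtr wtr_is_additive.

Lemma wtr_bnd c M : bnd c M -> bnd (wtr c) M.
Proof.
move=> hM [n|n]; first exact: hM.
have -> : wtr c (Negz n) = 0 by [].
by rewrite normc_0 mulr_ge0 ?wt_ge0// (bnd_ge0 hM).
Qed.

Lemma wscale_bnd a c M : bnd c M -> bnd (scal a * c) (normc a * M).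
Proof. by move=> hc n; rewrite scalM; exact: bndZ. Qed.

End WienerAlgebra.

(** * Hankel and Toeplitz operators on sequences *)

Section HardyAlgebra.
Context {R : realType} {e : {posnum R}}.
Local Notation C := R[i].
Local Notation wal := (wal e).
Implicit Types (c d h x y p : wal) (m n : int) (k : nat).

(** [plus] singles out the functions of the Hardy space, [minus] those with
    negative frequencies only, which the projection kills. *)
Definition plus c := forall k, c (Negz k) = 0.
Definition minus c := forall k, c (Posz k) = 0.

Lemma wstarM c d : wstar (c * d) = wstar c * wstar d. Proof. exact: rmorphM. Qed.

Lemma plus_wtr c : plus (wtr c). Proof. by []. Qed.

Lemma wtr_id c : plus c -> wtr c = c.
Proof. by move=> h; apply: walE => -[n|n] //=; rewrite h. Qed.

Lemma wtr_minus c : minus c -> wtr c = 0.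
Proof. by move=> h; apply: walE => -[n|n] //=; rewrite h. Qed.

Lemma minus_sub c : minus (c - wtr c).
Proof. by move=> k; rewrite wcoefB /= subrr. Qed.

Lemma wtr_eq0_minus c : wtr c = 0 -> minus c.
Proof. by move=> h k; exact: (congr1 (fun d : wal => d (Posz k)) h). Qed.

Lemma plus_minus_eq0 c : plus c -> minus c -> c = 0.
Proof. by move=> /wtr_id h1 /wtr_minus h2; rewrite -h1 h2. Qed.

Lemma plusD c d : plus c -> plus d -> plus (c + d).
Proof. by move=> hc hd k; rewrite wcoefD hc hd addr0. Qed.
Lemma plusN c : plus c -> plus (- c).
Proof. by move=> hc k; rewrite wcoefN hc oppr0. Qed.
Lemma plusB c d : plus c -> plus d -> plus (c - d).
Proof. by move=> hc hd; apply: plusD => //; exact: plusN. Qed.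
Lemma plus_scal (a : C) c : plus c -> plus (scal a * c).
Proof. by move=> hc k; rewrite scalM hc mulr0. Qed.
Lemma plus_delta k : plus (wdelta k).
Proof. by []. Qed.
Lemma plus1 : plus 1. Proof. exact: (plus_delta 0). Qed.

Lemma plusM c d : plus c -> plus d -> plus (c * d).
Proof.
move=> hc hd k; apply: wmul_coef_eq0 => -[m|m]; last by rewrite hc mul0r.
by rewrite (_ : Negz k - m%:Z = Negz (k + m)%N) ?hd ?mulr0// !NegzE; lia.
Qed.

Lemma minus_mul c d : minus c -> plus d -> minus (c * wstar d).
Proof.
move=> hc hd k; apply: wmul_coef_eq0 => -[m|m]; first by rewrite hc mul0r.
rewrite wstarE (_ : - (k%:Z - Negz m) = Negz (k + m)%N) ?hd ?rmorph0 ?mulr0//.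
by rewrite !NegzE; lia.
Qed.

Lemma wtr_scal (a : C) c : wtr (scal a * c) = scal a * wtr c.
Proof.
by apply: walE => n; rewrite scalM; case: n => n; [exact: scalM|rewrite /= mulr0].
Qed.

(** Multiplication by a function with nonpositive frequencies preserves the
    negative frequencies, so that truncating first does not matter. *)
Lemma wtr_nonpos p y : plus p -> wtr (wstar p * wtr y) = wtr (wstar p * y).
Proof.
move=> hp; apply/eqP; rewrite -subr_eq0 -raddfB -mulrBr; apply/eqP/wtr_minus.
rewrite -opprB mulrN mulrC => k; rewrite wcoefN minus_mul ?oppr0//.
exact: minus_sub.
Qed.

Local Notation Z := (wdelta 1).
Local Notation Zm := (wdelta (-1)).

Lemma ZZm : Z * Zm = 1 :> wal. Proof. by rewrite -wdeltaD subrr. Qed.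
Lemma ZmZ : Zm * Z = 1 :> wal. Proof. by rewrite mulrC ZZm. Qed.
Lemma starZ : wstar Z = Zm :> wal. Proof. exact: wstar_delta. Qed.
Lemma starZm : wstar Zm = Z :> wal. Proof. by rewrite wstar_delta opprK. Qed.

Lemma minus_star c : minus c -> plus (Zm * wstar c).
Proof.
move=> hc k; rewrite wcoef_delta wstarE.
by rewrite (_ : - _ = Posz k) ?hc ?rmorph0// NegzE; lia.
Qed.

Lemma wtr_ZmE y : wtr (Zm * y) = Zm * (wtr y - scal (y 0)).
Proof.
apply: walE => -[n|n]; rewrite [RHS]wcoef_delta wcoefB.
  rewrite -[LHS]/((Zm * y) n) wcoef_delta (_ : n%:Z - (-1) = n.+1); last by lia.
  by rewrite /= mulr0 subr0.
rewrite -[LHS]/(0 : C); case: n => [|n]; first by rewrite /= mulr1 subrr.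
rewrite (_ : _ - _ = Negz n); last by rewrite !NegzE; lia.
by rewrite /= mulr0 subr0.
Qed.

(** The Toeplitz operator of symbol [b] and the Hankel operators H and K of
    symbol [c], on sequences of coefficients. *)
Definition Top b h := wtr (b * h).
Definition Hk c h := wtr (c * wstar h).
Definition Kk c h := wtr (Zm * c * wstar h).

Lemma plus_Kk c h : plus (Kk c h). Proof. by []. Qed.
Lemma KkDl c d h : Kk (c + d) h = Kk c h + Kk d h.
Proof. by rewrite /Kk mulrDr mulrDl raddfD. Qed.
Lemma KkDr c h x : Kk c (h + x) = Kk c h + Kk c x.
Proof. by rewrite /Kk rmorphD mulrDr raddfD. Qed.
Lemma KkNr c h : Kk c (- h) = - Kk c h.
Proof. by rewrite /Kk rmorphN mulrN raddfN. Qed.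
Lemma KkNl c h : Kk (- c) h = - Kk c h.
Proof. by rewrite /Kk mulrN mulNr raddfN. Qed.
Lemma KkBr c h x : Kk c (h - x) = Kk c h - Kk c x.
Proof. by rewrite KkDr KkNr. Qed.
Lemma KkZl (a : C) c h : Kk (scal a * c) h = scal a * Kk c h.
Proof. by rewrite /Kk -wtr_scal; congr wtr; ring. Qed.
Lemma KkZr (a : C) c h : Kk c (scal a * h) = scal (a^*) * Kk c h.
Proof. by rewrite /Kk rmorphM /= wstar_scal -wtr_scal; congr wtr; ring. Qed.
(** The reason why a constant term in the equation is invisible to K. *)
Lemma Kk_scal (a : C) h : plus h -> Kk (scal a) h = 0.
Proof.
move=> hh; apply: wtr_minus; rewrite mulrAC -mulrA => k.
have := @minus_mul (Zm * scal a) h _ hh k; rewrite mulrAC -mulrA; apply => j.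
by rewrite wcoef_delta /=; case: eqP => //; rewrite ?mulr0//; lia.
Qed.

(** The Lax identity: for [b = |c|^2], the operator K of symbol [Pi(b c)] is
    [T_b K + K T_b - K^3]. All three terms come from splitting
    [g = Zm c h^*] into its truncation, which gives [T_b K h], and its negative
    part [nu = z^-1 rho^*], for which [Pi(b nu)] is [K (c rho)], where
    [c rho = b h - Zm c (K h)^*] truncates to [T_b h - K (K h)]. *)
Lemma Kk_lax c h (b := c * wstar c) : plus c -> plus h ->
  Kk (wtr (b * c)) h = Top b (Kk c h) + Kk c (Top b h) - Kk c (Kk c (Kk c h)).
Proof.
move=> hc hh; pose g := Zm * c * wstar h; pose nu := g - wtr g.
have hnu : minus nu by exact: minus_sub.
pose rho := Zm * wstar nu.
have hrho : plus rho by exact: minus_star.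
(* dropping the truncation of the symbol changes only negative frequencies *)
have -> : Kk (wtr (b * c)) h = wtr (b * g).
  apply/eqP; rewrite /Kk -subr_eq0 -raddfB; apply/eqP/wtr_minus.
  rewrite (_ : _ - _ = - (Zm * (b * c - wtr (b * c)) * wstar h)); last first.
    by rewrite /g; ring.
  move=> k; rewrite wcoefN minus_mul ?oppr0// mulrC -starZ => j.
  by apply: minus_mul; [exact: minus_sub|exact: plus_delta].
have -> : b * g = b * wtr g + b * nu by rewrite /nu; ring.
rewrite raddfD /= -addrA; congr (_ + _).
have hcr : plus (c * rho) by exact: plusM.
have -> : wtr (b * nu) = Kk c (c * rho).
  rewrite /Kk rmorphM /= /rho rmorphM /= starZm wstarK; congr wtr.
  rewrite (_ : Zm * c * (wstar c * (Z * nu)) = (Z * Zm) * (b * nu)).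
    by rewrite ZZm mul1r.
  by rewrite /b; ring.
rewrite -KkBr; congr Kk.
rewrite -[LHS]wtr_id// -(_ : b * h - Zm * c * wstar (wtr g) = c * rho).
  by rewrite raddfB.
rewrite /rho /nu rmorphB /= /g !rmorphM /= starZm wstarK.
rewrite (_ : c * _ = (Zm * Z) * (c * wstar c * h) - Zm * c * wstar (wtr g)).
  by rewrite ZmZ mul1r.
by rewrite /g; ring.
Qed.

Definition ip x y : C := (x * wstar y) 0.

Lemma ip_inner x y : ip x y = inner (synth x) (synth y).
Proof.
rewrite /ip wcoefM fourierE oppr0.
have l := L2_inner (wL2 x) (wL2 y).
have -> : cintegral (fun t => synth x t * synth (wstar y) t * ei 0 t) =
          cintegral (fun t => synth x t * (synth y t)^*).
  apply: aeq_cintegral.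
  - apply: cintegrable_meas; apply: cintegrable_mul_ei.
    by apply: L2_mul; exact: wL2.
  - exact: cintegrable_meas.
  - apply: filterS (synth_star y) => t ht ct.
    by rewrite ht// ei0 mulr1.
by [].
Qed.

Lemma ipDl x y h : ip (x + y) h = ip x h + ip y h.
Proof. by rewrite /ip mulrDl. Qed.
Lemma ipNl x h : ip (- x) h = - ip x h.
Proof. by rewrite /ip mulNr. Qed.
Lemma ipBl x y h : ip (x - y) h = ip x h - ip y h.
Proof. by rewrite ipDl ipNl. Qed.
Lemma ipZl (a : C) x h : ip (scal a * x) h = a * ip x h.
Proof. by rewrite /ip -mulrA scalM. Qed.
Lemma ip_conj x y : ip y x = (ip x y)^*.
Proof.
by rewrite -[RHS]/((wstar (x * wstar y)) 0) wstarM wstarK mulrC.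
Qed.
Lemma ip_suml (I : Type) (r : seq I) (F : I -> wal) h :
  ip (\sum_(i <- r) F i) h = \sum_(i <- r) ip (F i) h.
Proof.
elim: r => [|i r IH]; first by rewrite !big_nil /ip mul0r.
by rewrite !big_cons ipDl IH.
Qed.
Lemma ip1 x : ip x 1 = x 0.
Proof. by rewrite /ip rmorph1 mulr1. Qed.

Lemma ip_wtr x y : plus y -> ip (wtr x) y = ip x y.
Proof.
move=> hy; apply/eqP; rewrite eq_sym -subr_eq0 -ipBl.
by apply/eqP; apply: (@minus_mul _ _ _ hy 0%N); exact: minus_sub.
Qed.

(** By the Bessel inequality, each coefficient is at most the norm. *)
Lemma ip_eq0 x : ip x x = 0 -> x = 0.
Proof.
rewrite ip_inner inner_energy => /complexI e0; apply: walE => n.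
apply/eqP; rewrite -normc_eq0 -sqrf_eq0 eq_le sqr_ge0 andbT.
by rewrite -[leRHS]e0 -wfourier; apply: fourier_bound; exact: wL2.
Qed.

(** The rank one relation H^2 = K^2 + ( . | c) c: the truncation defining K
    drops exactly the coefficient of index 0 of [H x], which is the conjugate
    of [(x | c)]. *)
Lemma Hk2 c x : plus c -> plus x ->
  Hk c (Hk c x) = Kk c (Kk c x) + scal (ip x c) * c.
Proof.
move=> hc hx; pose a := (c * wstar x) 0.
have aE : ip x c = a^* by rewrite /a ip_conj.
have K1 : Kk c x = Zm * (Hk c x - scal a).
  by rewrite /Kk -mulrA wtr_ZmE.
have -> : Kk c (Kk c x) = wtr (c * wstar (Hk c x) - scal (a^*) * c).
  rewrite {1}/Kk K1 rmorphM /= starZm rmorphB /= wstar_scal; congr wtr.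
  rewrite (_ : Zm * c * _ = (Zm * Z) * (c * wstar (Hk c x) - scal a^* * c)).
    by rewrite ZmZ mul1r.
  by ring.
by rewrite raddfB /= wtr_scal (wtr_id hc) aE subrK.
Qed.

(** With [Hk2], this expresses the mean of [|c|^2 x] through [K^2 x] and the
    inner product of [x] with [c]; on an eigenspace of [K^2] the system of
    these two scalars closes up. *)
Lemma Hk2_coef0 c x : plus c -> plus x -> (Hk c (Hk c x)) 0 = (c * wstar c * x) 0.
Proof.
move=> hc hx; rewrite -[LHS]/((c * wstar (wtr (c * wstar x))) 0).
pose nu := c * wstar x - wtr (c * wstar x).
have hnu : minus nu by exact: minus_sub.
have -> : wstar (wtr (c * wstar x)) = wstar c * x - wstar nu.
  by rewrite /nu rmorphB rmorphM /= wstarK; ring.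
rewrite mulrBr wcoefB mulrA [X in _ - X](_ : _ = 0) ?subr0//.
have -> : c * wstar nu = Z * (c * (Zm * wstar nu)).
  transitivity ((Z * Zm) * (c * wstar nu)); first by rewrite ZZm mul1r.
  by ring.
rewrite wcoef_delta; have hp : plus (c * (Zm * wstar nu)).
  by apply: plusM => //; exact: minus_star.
exact: (hp 0%N).
Qed.

End HardyAlgebra.

(** * Derivatives of scalar curves *)

Section ScalarCalculus.
Context {R : realType}.
Local Notation C := R[i].
Local Notation mu := (@lebesgue_measure R).

Definition rder (f : R -> R) (t l : R) := is_derive (t : R) (1 : R) f l.

Lemma rder_eps (f : R -> R) (t l : R) :
  (forall eps, 0 < eps -> exists2 delta, 0 < delta &
    forall h, `|h| < delta -> `|f (t + h) - f t - h * l| <= eps * `|h|) ->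
  rder f t l.
Proof.
move=> H.
have c : h^-1 *: (f (h *: (1 : R) + t) - f t) @[h --> 0^'] --> (l : R).
  apply/cvgrPdist_le => eps eps0; have [delta d0 hd] := H _ eps0.
  near=> h.
  have h0 : h != 0 by near: h; exact: nbhs_dnbhs_neq.
  have hdelta : `|h| < delta by near: h; apply: dnbhs0_lt.
  have := hd _ hdelta; rewrite [h *: _]mulr1 (addrC h t).
  set D := f (t + h) - f t => hD.
  rewrite -normrN opprB /GRing.scale /=.
  have -> : h^-1 * D - l = h^-1 * (D - h * l) by field.
  by rewrite normrM normfV mulrC ler_pdivrMr ?normr_gt0.
exact: (DeriveDef (cvgP _ c) (cvg_lim _ c)).
Unshelve. all: by end_near. Qed.

Lemma rder_cont (f : R -> R) t l : rder f t l -> {for t, continuous f}.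
Proof.
move=> h; apply: differentiable_continuous; apply/derivable1_diffP.
exact: (@ex_derive _ _ _ _ _ _ _ h).
Qed.

Lemma rder_opp (f : R -> R) t l : rder f t l -> rder (fun s => - f s) t (- l).
Proof. exact: is_deriveN. Qed.

Lemma rder_reflect (f : R -> R) t l : rder f (- t) l -> rder (fun s => f (- s)) t (- l).
Proof.
by move=> h; rewrite -mulrN1; apply: (@is_derive1_comp _ f -%R).
Qed.

Lemma rder_shift (f : R -> R) a t l : rder f (a + t) l -> rder (fun s => f (a + s)) t l.
Proof.
move=> h; rewrite -[l]mulr1; apply: (@is_derive1_comp _ f (fun s => a + s)) => //.
rewrite (_ : (fun s => a + s) = shift a); first exact: is_derive_shift.
by apply/funext => s; rewrite /= addrC.
Qed.

(** The mean value theorem against a monomial: this form is what iterates in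
    the Picard estimates, where the k-th term is of size [t ^ k / k!]. *)
Lemma rder_le_pos (g g' : R -> R) (A t : R) (k : nat) : 0 <= t ->
  (forall s, 0 <= s <= t -> rder g s (g' s) /\ g' s <= A * s ^+ k) ->
  g t - g 0 <= A * (t ^+ k.+1 / k.+1%:R).
Proof.
rewrite le_eqVlt => /predU1P[<-|t0] H; first by rewrite subrr expr0n /= mul0r mulr0.
pose f s := g s - A * (s ^+ k.+1 / k.+1%:R).
have df s : 0 <= s <= t -> rder f s (g' s - A * s ^+ k).
  move=> st; apply: is_deriveB; first by case: (H s st).
  have d1 : is_derive s (1 : R) (fun s => (A / k.+1%:R) * s ^+ k.+1) (A * s ^+ k).
    have d2 := @is_deriveX _ _ id k.+1 s 1 1 (is_derive_id _ _).
    have d3 := @is_deriveZ _ _ _ _ (A / k.+1%:R) s 1 _ d2.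
    rewrite (_ : (fun s => _) = (A / k.+1%:R) \*: (id ^+ k.+1)); last first.
      by apply/funext => x; rewrite /= exprfctE.
    apply: (is_derive_eq d3); rewrite /GRing.scale /= mulr1 mulrA divfK ?pnatr_eq0//.
  by rewrite (_ : (fun s => _) = (fun s => (A / k.+1%:R) * s ^+ k.+1))//;
    apply/funext => x; rewrite /=; ring.
have dd x : x \in `]0, t[ -> is_derive x (1 : R) f (g' x - A * x ^+ k).
  by rewrite in_itv /= => /andP[x0 xt]; apply: df; rewrite !ltW.
have cc : {within `[0, t], continuous f}.
  apply: continuous_in_subspaceT => x; rewrite inE /= in_itv /= => xt.
  exact: (rder_cont (df _ xt)).
have [c] := MVT_segment (ltW t0) dd cc.
rewrite in_itv /= => ct E; have [_ hc] := H c ct.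
have : f t - f 0 <= 0 by rewrite E subr0 mulr_le0_ge0 ?subr_le0// ltW.
by rewrite /f expr0n /= mul0r mulr0 subr0 addrAC subr_le0.
Qed.

Lemma rder_le (g g' : R -> R) (A t : R) (k : nat) :
  (forall s, `|s| <= `|t| -> rder g s (g' s) /\ `|g' s| <= A * `|s| ^+ k) ->
  `|g t - g 0| <= A * (`|t| ^+ k.+1 / k.+1%:R).
Proof.
have base (f f' : R -> R) u : 0 <= u ->
    (forall s, 0 <= s <= u -> rder f s (f' s) /\ `|f' s| <= A * `|s| ^+ k) ->
    `|f u - f 0| <= A * (`|u| ^+ k.+1 / k.+1%:R).
  move=> u0 H; rewrite ler_norml (ger0_norm u0); apply/andP; split.
  - rewrite lerNl opprB addrC -[f 0]opprK -opprD opprB.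
    have -> : f 0 - f u = (- f u) - (- f 0) by ring.
    apply: (@rder_le_pos (fun s => - f s) (fun s => - f' s)) => // s su.
    have [d hd] := H s su; split; first exact: rder_opp.
    have s0 : 0 <= s by case/andP: su.
    by move: hd; rewrite (ger0_norm s0) ler_norml => /andP[]; lra.
  - apply: (@rder_le_pos f f') => // s su; have [d hd] := H s su; split => //.
    have s0 : 0 <= s by case/andP: su.
    by move: hd; rewrite (ger0_norm s0) ler_norml => /andP[].
move=> H; have [t0|t0] := leP 0 t.
  apply: (base g g') => // s /andP[s0 st]; apply: H.
  by rewrite !ger0_norm.
rewrite -(normrN t) (_ : g t - g 0 = g (- - t) - g (- 0)); last by rewrite opprK oppr0.
apply: (base (fun s => g (- s)) (fun s => - g' (- s))); first by rewrite oppr_ge0 ltW.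
move=> s /andP[s0 st]; have [|d hd] := H (- s).
  by rewrite normrN ger0_norm// ltr0_norm.
by split; [exact: rder_reflect|rewrite normrN -(normrN s)].
Qed.

Definition cder (f : R -> C) (t : R) (l : C) :=
  rder (fun s => Re (f s)) t (Re l) /\ rder (fun s => Im (f s)) t (Im l).

Lemma cder_eps (f : R -> C) (t : R) (l : C) :
  (forall eps, 0 < eps -> exists2 delta, 0 < delta &
    forall h, `|h| < delta -> normc (f (t + h) - f t - h%:C * l) <= eps * `|h|) ->
  cder f t l.
Proof.
move=> H; split; apply: rder_eps => eps eps0; have [delta d0 hd] := H _ eps0;
  exists delta => // h hh; apply: le_trans (hd _ hh).
- apply: le_trans (Re_le_normc _).
  by rewrite cReD cReN cReD cReN cReM cReR cImR mul0r subr0.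
- apply: le_trans (Im_le_normc _).
  by rewrite cImD cImN cImD cImN cImM cReR cImR mul0r addr0.
Qed.

Lemma cder_le (g g' : R -> C) (A t : R) (k : nat) :
  (forall s, `|s| <= `|t| -> cder g s (g' s) /\ normc (g' s) <= A * `|s| ^+ k) ->
  normc (g t - g 0) <= 2 * A * (`|t| ^+ k.+1 / k.+1%:R).
Proof.
move=> H; apply: (le_trans (normc_le_ReIm _)).
rewrite -mulrA mulr2n mulrDl mul1r cReD cReN cImD cImN; apply: lerD.
- apply: (@rder_le (fun s => Re (g s)) (fun s => Re (g' s))) => s st.
  by have [[d1 _] d2] := H s st; split => //; exact: le_trans (Re_le_normc _) _.
- apply: (@rder_le (fun s => Im (g s)) (fun s => Im (g' s))) => s st.
  by have [[_ d1] d2] := H s st; split => //; exact: le_trans (Im_le_normc _) _.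
Qed.

(** The base point of the integral must lie to the left of both 0 and [t]; the
    primitive does not depend on it once normalised at 0. *)
Lemma rder_primitive (f : R -> R) : continuous f ->
  exists2 F : R -> R, F 0 = 0 & forall t, rder F t (f t).
Proof.
move=> cf.
have int a b : mu.-integrable `[a, b] (EFin \o f).
  apply: continuous_compact_integrable; first exact: segment_compact.
  exact: continuous_subspaceT.
pose P a t := \int[mu]_(x in `[a, t]) f x.
have dP a t : a < t -> rder (P a) t (f t).
  move=> at_; have tt : t < t + 1 by rewrite ltrDl.
  have [d v] := continuous_FTC1_closed tt (int _ _) at_ (cf t).
  by apply: DeriveDef; [exact: d|rewrite -derive1E; exact: v].
have Padd a b t : a <= b -> b <= t -> P a t = P a b + P b t.
  move=> ab bt; rewrite /P; have := @Rintegral_itvB R f (BLeft a) (BRight t) b (int _ _).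
  rewrite !bnd_simp => /(_ ab bt); rewrite (Rintegral_itv_obnd_cbnd); last first.
    by apply: integrableS (int b t) => //; apply: subset_itvr; rewrite bnd_simp.
  by move=> <-; rewrite addrC subrK.
pose F t := P (- (`|t| + 1)) t - P (- (`|t| + 1)) 0.
have FE a t : a < t -> a < 0 -> F t = P a t - P a 0.
  move=> at_ a0; rewrite /F; set b := - (`|t| + 1).
  have b0 : b < 0 by rewrite /b oppr_lt0 ltr_wpDl.
  have bt : b < t by rewrite /b ltrNl; have := ler_norm (- t); rewrite normrN; lra.
  by have [ab|ba] := leP a b; [rewrite (Padd a b t) ?(Padd a b 0)//; try exact: ltW; ring|
    rewrite (Padd b a t) ?(Padd b a 0)//; try exact: ltW; ring].
exists F; first by rewrite /F subrr.
move=> t; pose a := - (`|t| + 1).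
have a0 : a < 0 by rewrite /a oppr_lt0 ltr_wpDl.
have at_ : a < t by rewrite /a ltrNl; have := ler_norm (- t); rewrite normrN; lra.
apply: (@near_eq_is_derive _ _ _ (fun s => P a s - P a 0)) => //.
- near=> s; apply/esym; apply: FE; last exact: a0.
  by near: s; exact: lt_nbhsr.
- rewrite -[f t]subr0; apply: is_deriveB; exact: dP.
Unshelve. all: by end_near. Qed.

End ScalarCalculus.

(** * Derivatives of curves of weighted sequences *)

Section WalCalculus.
Context {R : realType} {e : {posnum R}}.
Local Notation C := R[i].
Local Notation wal := (wal e).
Local Notation bnd := (bnd e).
Local Notation rs t := (scal (t%:C)).
Implicit Types (x y : R -> wal) (c d : wal) (t h M eps delta : R) (k n : nat).

Definition ncont x t := forall eps, 0 < eps -> exists2 delta, 0 < delta &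
  forall h, `|h| < delta -> bnd (x (t + h) - x t) eps.

(** Differentiability for the weighted supremum norm, with the norm spelled
    out as a bound. *)
Definition nder x t c := forall eps, 0 < eps -> exists2 delta, 0 < delta &
  forall h, `|h| < delta -> bnd (x (t + h) - x t - rs h * c) (eps * `|h|).

Lemma wbndD c d M M' : bnd c M -> bnd d M' -> bnd (c + d) (M + M').
Proof. exact: bndD. Qed.
Lemma wbndB c d M M' : bnd c M -> bnd d M' -> bnd (c - d) (M + M').
Proof. exact: bndB. Qed.
Lemma wbndN c M : bnd c M -> bnd (- c) M.
Proof. exact: bndN. Qed.
Lemma bnd0 M : 0 <= M -> bnd (0 : wal) M.
Proof. by move=> M0 n; rewrite normc_0 mulr_ge0// wt_ge0. Qed.
Lemma rs_bnd h c M : bnd c M -> bnd (rs h * c) (`|h| * M).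
Proof. by move=> /(wscale_bnd h%:C); rewrite normc_real. Qed.

Lemma nder_ncont x t c : nder x t c -> ncont x t.
Proof.
move=> H eps eps0; have [M hM] := walP c; have M0 := bnd_ge0 hM.
have [delta d0 hd] := H 1 ltr01.
have q0 : 0 < eps / (1 + M) by rewrite divr_gt0// ltr_wpDr.
exists (Num.min delta (eps / (1 + M))); first by rewrite lt_min d0 q0.
move=> h; rewrite lt_min => /andP[h1 h2].
have := wbndD (hd _ h1) (rs_bnd h hM); rewrite subrK; apply: le_bnd.
by rewrite mul1r -[X in X + _]mulr1 -mulrDr -ler_pdivlMr ?ltW// ltr_wpDr.
Qed.

Lemma ncont_cst c t : ncont (fun=> c) t.
Proof. by move=> eps eps0; exists 1 => // h _; rewrite subrr; exact/bnd0/ltW. Qed.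

Lemma nder_cst c t : nder (fun=> c) t 0.
Proof.
move=> eps eps0; exists 1 => // h _; rewrite subrr sub0r mulr0 oppr0.
by apply: bnd0; rewrite mulr_ge0// ltW.
Qed.

Lemma two_eps (P Q : R -> R -> Prop) :
  (forall eps, 0 < eps -> exists2 delta, 0 < delta & forall h, `|h| < delta -> P eps h) ->
  (forall eps, 0 < eps -> exists2 delta, 0 < delta & forall h, `|h| < delta -> Q eps h) ->
  forall a b, 0 < a -> 0 < b ->
  exists2 delta, 0 < delta & forall h, `|h| < delta -> P a h /\ Q b h.
Proof.
move=> HP HQ a b a0 b0; have [d1 d10 h1] := HP a a0; have [d2 d20 h2] := HQ b b0.
exists (Num.min d1 d2); first by rewrite lt_min d10 d20.
by move=> h; rewrite lt_min => /andP[x1 x2]; split; [exact: h1|exact: h2].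
Qed.

Lemma nderD x y t c d : nder x t c -> nder y t d -> nder (fun s => x s + y s) t (c + d).
Proof.
move=> hx hy eps eps0; have e2 : 0 < eps / 2 by rewrite divr_gt0.
have [delta d0 hd] := two_eps hx hy e2 e2; exists delta => // h hh.
have [h1 h2] := hd _ hh; have := wbndD h1 h2.
rewrite (_ : _ + _ = x (t + h) + y (t + h) - (x t + y t) - rs h * (c + d)); last by ring.
by rewrite -mulrDl -splitr.
Qed.

(** Bounds for operators that are only real linear, such as conjugation. *)
Definition rbounded (L : wal -> wal) := exists2 K, 0 <= K &
  forall c M, bnd c M -> bnd (L c) (K * M).

Lemma nder_lin (L : wal -> wal) x t c : rbounded L ->
  (forall a b, L (a - b) = L a - L b) -> (forall h a, L (rs h * a) = rs h * L a) ->
  nder x t c -> nder (fun s => L (x s)) t (L c).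
Proof.
move=> [K K0 hK] LB LZ hx eps eps0.
have q0 : 0 < eps / (1 + K) by rewrite divr_gt0// ltr_wpDr.
have [delta d0 hd] := hx _ q0; exists delta => // h hh.
rewrite -LZ -!LB; apply: le_bnd (hK _ _ (hd _ hh)).
rewrite mulrA ler_wpM2r// mulrC mulrAC ler_pdivrMr ?ltr_wpDr//.
by rewrite ler_wpM2l ?ltW// ltrDr.
Qed.

Lemma ncont_lin (L : wal -> wal) x t : rbounded L ->
  (forall a b, L (a - b) = L a - L b) -> ncont x t -> ncont (fun s => L (x s)) t.
Proof.
move=> [K K0 hK] LB hx eps eps0.
have q0 : 0 < eps / (1 + K) by rewrite divr_gt0// ltr_wpDr.
have [delta d0 hd] := hx _ q0; exists delta => // h hh.
rewrite -!LB; apply: le_bnd (hK _ _ (hd _ hh)).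
rewrite mulrC mulrAC ler_pdivrMr ?ltr_wpDr//.
by rewrite ler_wpM2l ?ltW// ltrDr.
Qed.

Lemma rbounded_wtr : rbounded wtr.
Proof. by exists 1 => // c M hM; rewrite mul1r; exact: wtr_bnd. Qed.
Lemma rbounded_wstar : rbounded wstar.
Proof. by exists 1 => // c M hM; rewrite mul1r; exact: wstar_bnd. Qed.
Lemma rbounded_mul d : rbounded (fun c => d * c).
Proof.
have [D hD] := walP d; exists (D * convM e).
  by rewrite mulr_ge0 ?convM_ge0// (bnd_ge0 hD).
by move=> c M hM; rewrite mulrAC; exact: wmul_bnd.
Qed.
Lemma rbounded_coef0 : rbounded (fun c => scal (c 0)).
Proof.
exists 1 => // c M hM n; rewrite mul1r -[scal (c 0) n]/(c 0 * (n == 0)%:R).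
have [->|_] := eqVneq n 0; first by rewrite mulr1; exact: hM.
by rewrite mulr0 normc_0 mulr_ge0 ?wt_ge0// (bnd_ge0 hM).
Qed.

Lemma nder_wtr x t c : nder x t c -> nder (fun s => wtr (x s)) t (wtr c).
Proof.
apply: (@nder_lin wtr); first exact: rbounded_wtr.
- by move=> a b; rewrite raddfB.
- by move=> h a; rewrite wtr_scal.
Qed.

Lemma nder_wstar x t c : nder x t c -> nder (fun s => wstar (x s)) t (wstar c).
Proof.
apply: (@nder_lin wstar); first exact: rbounded_wstar.
- by move=> a b; rewrite rmorphB.
- by move=> h a; rewrite wstarM wstar_scal conjcR.
Qed.

Lemma nder_mull d x t c : nder x t c -> nder (fun s => d * x s) t (d * c).
Proof.
apply: (@nder_lin (fun c => d * c)); first exact: rbounded_mul.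
- by move=> a b; rewrite mulrBr.
- by move=> h a; rewrite mulrCA.
Qed.

Lemma nder_coef0 x t c : nder x t c -> nder (fun s => scal ((x s) 0)) t (scal (c 0)).
Proof.
apply: (@nder_lin (fun c => scal (c 0))); first exact: rbounded_coef0.
- by move=> a b; rewrite wcoefB rmorphB.
- by move=> h a; rewrite scalM rmorphM.
Qed.

Lemma nderN x t c : nder x t c -> nder (fun s => - x s) t (- c).
Proof.
move=> /(nder_mull (-1)); rewrite mulN1r.
by rewrite (_ : (fun s => -1 * x s) = (fun s => - x s))//; apply/funext => s; rewrite mulN1r.
Qed.

Lemma nderB x y t c d : nder x t c -> nder y t d -> nder (fun s => x s - y s) t (c - d).
Proof. by move=> hx hy; exact: (nderD hx (nderN hy)). Qed.

Lemma ncont_wtr x t : ncont x t -> ncont (fun s => wtr (x s)) t.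
Proof. by apply: (@ncont_lin wtr); [exact: rbounded_wtr|move=> a b; rewrite raddfB]. Qed.

Lemma ncont_wstar x t : ncont x t -> ncont (fun s => wstar (x s)) t.
Proof. by apply: (@ncont_lin wstar); [exact: rbounded_wstar|move=> a b; rewrite rmorphB]. Qed.

Lemma ncont_mull d x t : ncont x t -> ncont (fun s => d * x s) t.
Proof. by apply: (@ncont_lin (fun c => d * c)); [exact: rbounded_mul|move=> a b; rewrite mulrBr]. Qed.

Lemma ncontD x y t : ncont x t -> ncont y t -> ncont (fun s => x s + y s) t.
Proof.
move=> hx hy eps eps0; have e2 : 0 < eps / 2 by rewrite divr_gt0.
have [delta d0 hd] := two_eps hx hy e2 e2; exists delta => // h hh.
have [h1 h2] := hd _ hh; have := wbndD h1 h2; rewrite -splitr.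
by rewrite (_ : _ + _ = x (t + h) + y (t + h) - (x t + y t)) //; ring.
Qed.

Lemma ncontM x y t : ncont x t -> ncont y t -> ncont (fun s => x s * y s) t.
Proof.
move=> hx hy eps eps0.
have [Mx hMx] := walP (x t); have [My hMy] := walP (y t).
have [Mx0 My0] := (bnd_ge0 hMx, bnd_ge0 hMy).
pose K := 1 + convM e; have K0 : 0 < K by rewrite ltr_wpDr// convM_ge0.
pose a := Num.min 1 (eps / (K * (Mx + My + 1))).
have D0 : 0 < K * (Mx + My + 1) by rewrite mulr_gt0// ltr_wpDl// addr_ge0.
have a0 : 0 < a by rewrite lt_min ltr01 divr_gt0.
have a1 : a <= 1 by rewrite ge_min lexx.
have ae : a * (K * (Mx + My + 1)) <= eps.
  by rewrite -ler_pdivlMr// ge_min lexx orbT.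
have [delta d0 hd] := two_eps hx hy a0 a0; exists delta => // h hh.
have [h1 h2] := hd _ hh.
rewrite (_ : _ - _ = (x (t + h) - x t) * (y (t + h) - y t) +
   ((x (t + h) - x t) * y t + x t * (y (t + h) - y t))); last by ring.
apply: le_bnd ae _; apply: le_bnd
  (wbndD (wmul_bnd h1 h2) (wbndD (wmul_bnd h1 hMy) (wmul_bnd hMx h2))).
have cK : convM e <= K by rewrite lerDr.
have : a * a * convM e <= a * 1 * K.
  apply: ler_pM => //; [by rewrite mulr_ge0// ltW|exact: convM_ge0|].
  by rewrite ler_wpM2l// ltW.
have : a * My * convM e <= a * My * K by rewrite ler_wpM2l// mulr_ge0// ltW.
have : Mx * a * convM e <= Mx * a * K by rewrite ler_wpM2l// mulr_ge0// ltW.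
lra.
Qed.

(** The increment of a product is the sum of the four products below; each of
    them is controlled by [wmul_bnd]. *)
Lemma nderM x y t c d : nder x t c -> nder y t d ->
  nder (fun s => x s * y s) t (c * y t + x t * d).
Proof.
move=> hx hy eps eps0; have cy := nder_ncont hy.
have [Mx hMx] := walP (x t); have [My hMy] := walP (y t); have [Mc hMc] := walP c.
have [Mx0 My0 Mc0] := And3 (bnd_ge0 hMx) (bnd_ge0 hMy) (bnd_ge0 hMc).
pose K := 1 + convM e; have K0 : 0 < K by rewrite ltr_wpDr// convM_ge0.
pose S := K * (Mx + My + Mc + 1).
have S0 : 0 < S by rewrite mulr_gt0// ltr_wpDl// !addr_ge0.
pose a := Num.min 1 (eps / S).
have a0 : 0 < a by rewrite lt_min ltr01 divr_gt0.
have a1 : a <= 1 by rewrite ge_min lexx.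
have ae : a * S <= eps by rewrite -ler_pdivlMr// ge_min lexx orbT.
have [d1 d10 hd1] := two_eps hx hy a0 a0; have [d2 d20 hd2] := cy a a0.
exists (Num.min d1 d2); first by rewrite lt_min d10 d20.
move=> h; rewrite lt_min => /andP[hh1 hh2].
have [h1 h2] := hd1 _ hh1; have h3 := hd2 _ hh2.
rewrite (_ : _ - _ = (x (t + h) - x t - rs h * c) * (y (t + h) - y t) +
  ((x (t + h) - x t - rs h * c) * y t + (rs h * c * (y (t + h) - y t) +
   x t * (y (t + h) - y t - rs h * d)))); last by ring.
have p0 := normr_ge0 h; set p := `|h| in p0 h1 h2 *.
have hc := rs_bnd h hMc; rewrite -/p in hc.
apply: (@le_bnd _ _ _ (a * S * p)); first by rewrite ler_wpM2r.
apply: le_bnd (wbndD (wmul_bnd h1 h3) (wbndD (wmul_bnd h1 hMy)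
  (wbndD (wmul_bnd hc h3) (wmul_bnd hMx h2)))).
have cK : convM e <= K by rewrite lerDr.
have ap : 0 <= a * p by rewrite mulr_ge0// ltW.
have i1 : a * p * a * convM e <= a * p * 1 * K.
  apply: ler_pM => //; [by rewrite mulr_ge0// ltW|exact: convM_ge0|].
  by rewrite ler_wpM2l.
have i2 : a * p * My * convM e <= a * p * My * K by rewrite ler_wpM2l// mulr_ge0.
have i3 : a * p * Mc * convM e <= a * p * Mc * K by rewrite ler_wpM2l// mulr_ge0.
have i4 : a * p * Mx * convM e <= a * p * Mx * K by rewrite ler_wpM2l// mulr_ge0.
rewrite /S; lra.
Qed.

Lemma nder_cder x t c (m : int) : nder x t c -> cder (fun s => x s m) t (c m).
Proof.
move=> hx; apply: cder_eps => eps eps0.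
have q0 : 0 < eps / wt e m by rewrite divr_gt0// wt_gt0.
have [delta d0 hd] := hx _ q0; exists delta => // h hh.
have := hd _ hh m; rewrite !wcoefB scalM => H; apply: (le_trans H).
by rewrite mulrAC divfK// gt_eqF// wt_gt0.
Qed.

(** Coordinate by coordinate, from the scalar estimate. *)
Lemma wal_mvi x (x' : R -> wal) (A : R) (k : nat) t :
  (forall s, `|s| <= `|t| -> nder x s (x' s) /\ bnd (x' s) (A * `|s| ^+ k)) ->
  bnd (x t - x 0) (2 * A * (`|t| ^+ k.+1 / k.+1%:R)).
Proof.
move=> H m; rewrite wcoefB.
have := @cder_le R (fun s => x s m) (fun s => x' s m) (A * wt e m) t k.
rewrite (_ : 2 * (A * wt e m) * _ = 2 * A * (`|t| ^+ k.+1 / k.+1%:R) * wt e m); last by ring.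
apply=> s st; have [h1 h2] := H s st; split; first exact: nder_cder.
by rewrite mulrAC; exact: h2.
Qed.

End WalCalculus.

(** * Uniqueness for linear differential equations *)

Section LinearODE.
Context {R : realType} {e : {posnum R}}.
Local Notation C := R[i].
Local Notation wal := (wal e).
Local Notation bnd := (bnd e).
Implicit Types (x y g : R -> wal) (c d : wal) (t h M eps delta : R) (k n : nat).

(** By compactness of the segment, continuity at a point giving a local bound. *)
Lemma ncont_bounded x (a b : R) : (forall t, a <= t <= b -> ncont x t) ->
  exists M, forall t, a <= t <= b -> bnd (x t) M.
Proof.
move=> cx.
have /compact_near_coveringP cov := @segment_compact R a b.
have := cov R (pinfty_nbhs R) (fun M t => bnd (x t) M) _ _.
have H : forall t, `[a, b]%classic t ->
    \forall t' \near t & M \near pinfty_nbhs R, bnd (x t') M.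
  move=> t; rewrite /= in_itv /= => tab.
  have [delta d0 hd] := cx _ tab 1 ltr01; have [M hM] := walP (x t).
  exists (ball t delta, [set N | 1 + M < N]).
    split; first exact: nbhsx_ballx.
    by exists (1 + M); split => //; exact: num_real.
  move=> [t' N] /= [tt' MN]; apply: le_bnd (ltW MN) _.
  have E : t + (t' - t) = t' by rewrite addrC subrK.
  have h1 : bnd (x t' - x t) 1.
    by rewrite -{1}E; apply: hd; rewrite distrC; exact: tt'.
  by have := wbndD h1 hM; rewrite subrK.
move=> /(_ _ H) [M [_ hM]]; exists (M + 1) => t tab.
by apply: (hM (M + 1)); rewrite ?ltrDl//= in_itv.
Qed.

(** The estimate by which the k-th Picard iterate is of order [t ^ k / k!]. *)
Lemma picard_step x (x' : R -> wal) (B M : R) k t : x 0 = 0 ->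
  (forall s, `|s| <= `|t| -> nder x s (x' s) /\
    bnd (x' s) (M * (B * (2 * M) ^+ k * (`|s| ^+ k / k`!%:R)))) ->
  bnd (x t) (B * (2 * M) ^+ k.+1 * (`|t| ^+ k.+1 / k.+1`!%:R)).
Proof.
move=> x0 H; have f0 : k`!%:R != 0 :> R by rewrite pnatr_eq0 -lt0n fact_gt0.
have k0 : k.+1%:R != 0 :> R by rewrite pnatr_eq0.
have auxl (b m mk f q u : R) : f != 0 -> q != 0 ->
    b * (2 * m * mk) * (u / (q * f)) = 2 * (m * (b * mk / f)) * (u / q).
  by move=> f0' q0; field; rewrite f0' q0.
have auxr (b m mk f u : R) : f != 0 -> m * (b * mk * (u / f)) = m * (b * mk / f) * u.
  by move=> f0'; field.
rewrite -[x t]subr0 -x0 factS natrM exprS auxl//.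
apply: (@wal_mvi _ _ x x') => s st; have [d hd] := H s st; split=> //.
by rewrite -auxr.
Qed.
(** A linear bound on the derivative forces [|y t| <= B (2 M |t|)^k / k!] for
    all [k] by induction on [k], and the right-hand side tends to 0. *)
Lemma ode_unique y (y' : R -> wal) (M : R) : 0 <= M ->
  (forall t, `|t| <= 1 -> nder y t (y' t)) ->
  (forall t M', `|t| <= 1 -> bnd (y t) M' -> bnd (y' t) (M * M')) ->
  y 0 = 0 -> forall t, `|t| <= 1 -> y t = 0.
Proof.
move=> M0 dy by' y0.
have [|B hB] := @ncont_bounded y (-1) 1.
  by move=> t t1; apply: nder_ncont (dy t _); rewrite ler_norml.
have step k : forall t, `|t| <= 1 -> bnd (y t) (B * (2 * M) ^+ k * (`|t| ^+ k / k`!%:R)).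
  elim: k => [|k IH] t t1.
    by rewrite expr0 mulr1 fact0 divr1 mulr1; apply: hB; rewrite -ler_norml.
  apply: (picard_step (x' := y') y0) => s st.
  have s1 := le_trans st t1; split; [exact: dy|exact: by' s _ s1 (IH s s1)].
move=> t t1; apply: walE => n; rewrite wcoef0.
apply/eqP; rewrite -normc_eq0 eq_le normc_ge0 andbT.
have c1 : (B * wt e n * exp_coeff (2 * M * `|t|) k) @[k --> \oo] --> B * wt e n * 0.
  by apply: cvgMl_tmp; exact: cvg_exp_coeff.
rewrite mulr0 in c1; apply: (ler_cvg_to (cvg_cst _) c1); apply: nearW => k.
have := step k t t1 n; rewrite /exp_coeff /= exprMn.
rewrite (_ : B * _ * _ * _ = B * wt e n * ((2 * M) ^+ k * `|t| ^+ k / k`!%:R)) ?exprMn//.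
by rewrite -!mulrA; congr (_ * _); rewrite [RHS]mulrC -!mulrA.
Qed.

End LinearODE.

(** * Existence for linear differential equations *)

Section Picard.
Context {R : realType} {e : {posnum R}}.
Local Notation C := R[i].
Local Notation wal := (wal e).
Local Notation bnd := (bnd e).
Local Notation rs t := (scal (t%:C)).
Implicit Types (x y g : R -> wal) (c d : wal) (t h M eps delta : R) (k n N : nat).

Lemma rsD (a b : R) : rs (a + b) = rs a + rs b :> wal.
Proof. by rewrite -[RHS]rmorphD; congr scal; rewrite rmorphD. Qed.

Lemma rs0 : rs 0 = 0 :> wal.
Proof. exact: (rmorph0 scal). Qed.

Lemma nder_shift x t s c : nder x (t + s) c -> nder (fun s => x (t + s)) s c.
Proof.
move=> H eps eps0; have [delta d0 hd] := H _ eps0; exists delta => // h hh.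
by rewrite addrA; exact: hd.
Qed.

Lemma nder_rs c t : nder (fun s => rs s * c) t c.
Proof.
move=> eps eps0; exists 1 => // h _.
have -> : rs (t + h) * c - rs t * c - rs h * c = 0 by rewrite rsD; ring.
by apply: bnd0; rewrite mulr_ge0// ltW.
Qed.

(** Near a point, a curve is close to its tangent as far as its derivative is
    close to being constant. *)
Lemma wal_tangent x (x' : R -> wal) c (A : R) t h :
  (forall s, `|s| <= `|h| -> nder x (t + s) (x' (t + s)) /\ bnd (x' (t + s) - c) A) ->
  bnd (x (t + h) - x t - rs h * c) (2 * A * `|h|).
Proof.
move=> H; pose f s := x (t + s) - rs s * c.
have -> : x (t + h) - x t - rs h * c = f h - f 0.
  by rewrite /f addr0 rs0; ring.
have := @wal_mvi _ _ f (fun s => x' (t + s) - c) A 0 h.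
rewrite expr1 divr1; apply => s sh.
have [h1 h2] := H s sh; split; last by rewrite expr0 mulr1.
by apply: nderB; [exact: nder_shift|exact: nder_rs].
Qed.

Lemma ncont_coef g t (m : int) : ncont g t ->
  {for t, continuous (fun s => Re (g s m))} /\ {for t, continuous (fun s => Im (g s m))}.
Proof.
move=> cg; have H eps : 0 < eps -> exists2 delta, 0 < delta &
    forall h, `|h| < delta -> normc (g (t + h) m - g t m) <= eps.
  move=> eps0; have q0 : 0 < eps / wt e m by rewrite divr_gt0// wt_gt0.
  have [delta d0 hd] := cg _ q0; exists delta => // h hh.
  by have := hd _ hh m; rewrite wcoefB divfK// gt_eqF// wt_gt0.
split; apply/cvgrPdist_le => eps eps0; have [delta d0 hd] := H _ eps0;
  exists delta => // s /= hs; have := hd (s - t); rewrite [t + _]addrC subrK distrC => /(_ hs);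
  apply: le_trans; rewrite distrC.
- by apply: le_trans (Re_le_normc _); rewrite cReD cReN.
- by apply: le_trans (Im_le_normc _); rewrite cImD cImN.
Qed.

(** The primitive is taken coordinate by coordinate; the bounds of [cder_le]
    are uniform in the coordinate, which makes it a primitive in norm. *)
Lemma nder_primitive g : (forall t, ncont g t) ->
  exists2 G : R -> wal, G 0 = 0 & forall t, nder G t (g t).
Proof.
move=> cg.
have H (m : int) : exists F : R -> C, F 0 = 0 /\ forall t, cder F t (g t m).
  have [F1 F10 d1] := @rder_primitive R (fun s => Re (g s m))
    (fun t => proj1 (ncont_coef m (cg t))).
  have [F2 F20 d2] := @rder_primitive R (fun s => Im (g s m))
    (fun t => proj2 (ncont_coef m (cg t))).
  exists (fun t => F1 t +i* F2 t); split; first by rewrite F10 F20.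
  by move=> t; split; [exact: d1|exact: d2].
have [F hF] := choice H.
have F0 m : F m 0 = 0 by case: (hF m).
have dF m t : cder (F m) t (g t m) by case: (hF m).
have bF t : exists M, bnd (fun m => F m t) M.
  have [|M hM] := @ncont_bounded R e g (- `|t|) `|t|; first by move=> s _; exact: cg.
  exists (2 * M * `|t|) => m; rewrite -[F m t]subr0 -(F0 m).
  have := @cder_le R (F m) (fun s => g s m) (M * wt e m) t 0.
  rewrite expr1 divr1 mulrA mulrAC; apply=> s st; split; first exact: dF.
  by rewrite expr0 mulr1; apply: hM; rewrite -ler_norml.
exists (fun t => Wal (bF t)).
  by apply: walE => m /=; rewrite F0.
move=> t eps eps0; have e2 : 0 < eps / 2 by rewrite divr_gt0.
have [delta d0 hd] := cg t _ e2; exists delta => // h hh m.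
rewrite !wcoefB scalM /=.
have := @cder_le R (fun s => F m (t + s) - s%:C * g t m) (fun s => g (t + s) m - g t m)
  (eps / 2 * wt e m) h 0.
rewrite addr0 mul0r subr0 expr1 divr1 addrAC.
rewrite (_ : 2 * _ * _ = eps * `|h| * wt e m); last by field.
apply=> s sh; split; last first.
  by rewrite expr0 mulr1; have := hd s (le_lt_trans sh hh) m; rewrite wcoefB.
have [d1 d2] := dF m (t + s).
split.
- rewrite cReD cReN (_ : (fun s => _) =
    (fun s => Re (F m (t + s)) - Re (g t m) * s)); last first.
    by apply/funext => z; rewrite cReD cReN cReM cReR cImR mul0r subr0 mulrC.
  apply: (@is_deriveB _ _ _ (fun s => Re (F m (t + s))) (fun s => Re (g t m) * s)).
    exact: (@rder_shift _ (fun s => Re (F m s))).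
  exact: is_derive_lin.
- rewrite cImD cImN (_ : (fun s => _) =
    (fun s => Im (F m (t + s)) - Im (g t m) * s)); last first.
    by apply/funext => z; rewrite cImD cImN cImM cReR cImR mul0r addr0 mulrC.
  apply: (@is_deriveB _ _ _ (fun s => Im (F m (t + s))) (fun s => Im (g t m) * s)).
    exact: (@rder_shift _ (fun s => Im (F m s))).
  exact: is_derive_lin.
Qed.

Lemma bnd_lim c D (a : nat -> R) : a @ \oo --> 0 ->
  (forall n, bnd c (D + a n)) -> bnd c D.
Proof.
move=> a0 H m.
have c1 : ((D + a n) * wt e m) @[n --> \oo] --> (D + 0) * wt e m.
  by apply: cvgMr_tmp; apply: cvgD => //; exact: cvg_cst.
rewrite addr0 in c1; apply: (ler_cvg_to (cvg_cst _) c1); apply: nearW => n.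
exact: H.
Qed.

(** Completeness of the weighted supremum norm, for series. *)
Lemma wal_series (y : nat -> wal) (q : nat -> R) (Q : R) :
  (forall k, bnd (y k) (q k)) -> series q @ \oo --> Q ->
  exists z : wal, forall N, bnd (z - \sum_(0 <= k < N) y k) (2 * (Q - series q N)).
Proof.
move=> hy hq.
have sE N m : (\sum_(0 <= k < N) y k) m = \sum_(0 <= k < N) y k m.
  by elim: N => [|N IH]; [rewrite !big_geq|rewrite big_nat_recr// [RHS]big_nat_recr//= -IH].
have cq m : series (fun k => q k * wt e m) @ \oo --> Q * wt e m.
  rewrite (_ : series _ = fun N => series q N * wt e m); first exact: cvgMr_tmp.
  by apply/funext => N; rewrite /series /= mulr_suml.
have T N m : normc (csum (fun k => y k m) - \sum_(0 <= k < N) y k m) <=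
    2 * (Q - series q N) * wt e m.
  have := @csum_tail R (fun k => y k m) _ _ N (fun k => hy k m) (cq m).
  rewrite (_ : series _ N = series q N * wt e m); last by rewrite /series /= mulr_suml.
  by rewrite -mulrBl mulrA.
have P : exists M, bnd (fun m => csum (fun k => y k m)) M.
  exists (2 * (Q - series q 0)) => m.
  by have := T 0%N m; rewrite big_geq// subr0.
by exists (Wal P) => N m; rewrite wcoefB sE; exact: T.
Qed.

(** Picard iteration: [X] is the sum of the terms [Y k], where [Y 0 = x0] and
    [Y k.+1] is the primitive of [A (Y k)] that vanishes at 0. On a bounded
    interval the terms are dominated by an exponential series; the equation
    passes to the limit by [wal_tangent], as the derivatives of the partial
    sums converge uniformly. *)
Lemma linear_ode (beta : R -> wal) (x0 : wal) : (forall t, ncont beta t) ->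
  exists2 X : R -> wal, X 0 = x0 &
    forall t, `|t| < 2 -> nder X t (wtr (beta t * X t)).
Proof.
move=> cb; pose A t c := wtr (beta t * c).
(* [I g] is a primitive of [A g] when [g] is continuous, a junk value otherwise *)
have H g : exists G : R -> wal, (forall t, ncont g t) ->
    G 0 = 0 /\ forall t, nder G t (A t (g t)).
  have [cg|ncg] := pselect (forall t, ncont g t); last by exists (fun=> 0).
  have [|G G0 dG] := @nder_primitive (fun t => A t (g t)); last by exists G.
  by move=> t; apply: ncont_wtr; exact: ncontM.
have [I hI] := choice H.
pose Y := fix Y k := if k is k'.+1 then I (Y k') else fun=> x0.
have cY k : forall t, ncont (Y k) t.
  elim: k => [|k IH] t; first exact: ncont_cst.
  by have [_ d] := hI _ IH; exact: nder_ncont (d t).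
have Y0 k : Y k.+1 0 = 0 by have [] := hI _ (cY k).
have dY k t : nder (Y k.+1) t (A t (Y k t)) by have [_] := hI _ (cY k); exact.
have [|B hB] := @ncont_bounded R e beta (- 2) 2; first by move=> t _; exact: cb.
have B0 : 0 <= B by apply: bnd_ge0 (hB 0 _); lra.
pose M := B * convM e.
have M0 : 0 <= M by rewrite mulr_ge0// convM_ge0.
have bA t c D : `|t| <= 2 -> bnd c D -> bnd (A t c) (M * D).
  move=> t2 hc; apply: wtr_bnd; rewrite /M mulrAC; apply: wmul_bnd => //.
  by apply: hB; rewrite -ler_norml.
clearbody M.
have [C0 hC0] := walP x0; have C00 := bnd_ge0 hC0.
have bY k : forall t, `|t| <= 2 -> bnd (Y k t) (C0 * (2 * M) ^+ k * (`|t| ^+ k / k`!%:R)).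
  elim: k => [|k IH] t t2; first by rewrite !expr0 mulr1 fact0 divr1 mulr1.
  apply: (picard_step (x' := fun s => A s (Y k s)) (Y0 k)) => s st.
  have s2 := le_trans st t2; split; [exact: dY|exact: bA (IH s s2)].
pose q k := C0 * exp_coeff (4 * M) k.
have bYq k t : `|t| <= 2 -> bnd (Y k t) (q k).
  move=> t2; apply: le_bnd (bY k t t2).
  rewrite /q /exp_coeff /= -mulrA ler_wpM2l// mulrA ler_wpM2r ?invr_ge0 ?ler0n//.
  have m1 : 0 <= 2 * M * `|t| by rewrite !mulr_ge0.
  have m2 : 2 * M * `|t| <= 4 * M.
    by rewrite (_ : 4 * M = 2 * M * 2) ?ler_wpM2l ?mulr_ge0//; ring.
  by rewrite -exprMn; apply: lerXn2r; rewrite ?nnegrE ?(le_trans m1).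
have cq : series q @ \oo --> C0 * limn (series (exp_coeff (4 * M))).
  rewrite (_ : series q = fun N => C0 * series (exp_coeff (4 * M)) N).
    by apply: cvgMl_tmp; exact: is_cvg_series_exp_coeff.
  by apply/funext => N; rewrite /series /= mulr_sumr.
set Q := C0 * _ in cq.
pose tl N := 2 * (Q - series q N).
have tl0 : tl @ \oo --> 0.
  have -> : (0 : R) = 2 * (Q - Q) by rewrite subrr mulr0.
  by apply: cvgMl_tmp; apply: cvgB => //; exact: cvg_cst.
pose P N t := \sum_(0 <= k < N) Y k t.
have HX t : exists z : wal, `|t| <= 2 -> forall N, bnd (z - P N t) (tl N).
  have [t2|_] := leP `|t| 2; last by exists 0.
  by have [z hz] := wal_series (fun k => bYq k t t2) cq; exists z.
have [X hX] := choice HX.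
have PS N t : P N.+1 t = P N t + Y N t by rewrite /P big_nat_recr.
have dP N t : nder (P N.+1) t (A t (P N t)).
  elim: N => [|N IH].
    rewrite /A /P big_geq// mulr0 raddf0.
    rewrite (_ : (fun t => _) = fun=> x0); first exact: nder_cst.
    by apply/funext => s; rewrite big_nat1.
  rewrite (_ : P N.+2 = fun t => P N.+1 t + Y N.+1 t); last by apply/funext => s; exact: PS.
  have -> : A t (P N.+1 t) = A t (P N t) + A t (Y N t).
    by rewrite /A PS mulrDr raddfD.
  exact: (nderD IH (dY N t)).
have cP N t : ncont (P N) t.
  case: N => [|N]; last exact: nder_ncont (dP N t).
  rewrite (_ : P 0%N = fun=> 0); first exact: ncont_cst.
  by apply/funext => s; rewrite /P big_geq.
have cX t : `|t| < 2 -> ncont X t.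
  move=> t2 eps eps0.
  have e3 : 0 < eps / 3 by rewrite divr_gt0.
  have [N hN] : exists N, tl N < eps / 3.
    have /cvgr_dist_lt := tl0; move=> /(_ _ e3) [N _ /(_ N (leqnn N))] /=.
    by rewrite sub0r normrN => hN; exists N; exact: le_lt_trans (ler_norm _) hN.
  have [delta d0 hd] := cP N t _ e3.
  exists (Num.min delta (2 - `|t|)); first by rewrite lt_min d0 subr_gt0.
  move=> h; rewrite lt_min => /andP[h1 h2].
  have th : `|t + h| <= 2 by apply: (le_trans (ler_normD _ _)); lra.
  rewrite (_ : _ - _ = (X (t + h) - P N (t + h)) + ((P N (t + h) - P N t) - (X t - P N t))).
    have := wbndD (hX _ th N) (wbndB (hd _ h1) (hX _ (ltW t2) N)).
    by apply: le_bnd; lra.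
  by ring.
have cA t : `|t| < 2 -> ncont (fun s => A s (X s)) t.
  by move=> t2; apply: ncont_wtr; apply: ncontM => //; exact: cX.
have X0 : X 0 = x0.
  have z2 : `|0 : R| <= 2 by rewrite normr0.
  apply/eqP; rewrite -subr_eq0; apply/eqP/walE => m; rewrite wcoef0.
  apply/eqP; rewrite -normc_eq0 eq_le normc_ge0 andbT.
  have P0 N : P N.+1 0 = x0.
    elim: N => [|N IH]; first by rewrite /P big_nat1.
    by rewrite PS IH Y0 addr0.
  have := @bnd_lim (X 0 - x0) 0 (fun N => tl N.+1) _ _ m; rewrite mul0r; apply.
    by move: tl0; rewrite -(cvg_shiftS tl).
  by move=> N; rewrite add0r -(P0 N); exact: hX.
exists X => // t t2 eps eps0.
have e4 : 0 < eps / 4 by rewrite divr_gt0.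
have [delta d0 hd] := cA t t2 _ e4.
exists (Num.min delta (2 - `|t|)); first by rewrite lt_min d0 subr_gt0.
move=> h; rewrite lt_min => /andP[h1 h2].
have th s : `|s| <= `|h| -> `|t + s| <= 2.
  by move=> sh; apply: (le_trans (ler_normD _ _)); lra.
apply: (@bnd_lim _ _ (fun N => 2 * M * tl N * `|h| + 2 * tl N.+1)).
  have -> : (0 : R) = 2 * M * 0 * `|h| + 2 * 0 by ring.
  apply: cvgD; first by apply: cvgMr_tmp; apply: cvgMl_tmp.
  by apply: cvgMl_tmp; move: tl0; rewrite -(cvg_shiftS tl).
move=> N.
have T := @wal_tangent (P N.+1) (fun s => A s (P N s)) (A t (X t)) (M * tl N + eps / 4) t h _.
rewrite (_ : _ - _ = (X (t + h) - P N.+1 (t + h)) - (X t - P N.+1 t) +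
   (P N.+1 (t + h) - P N.+1 t - rs h * A t (X t))); last by rewrite /A; ring.
apply: le_bnd (wbndD (wbndB (hX _ (th h (lexx _)) N.+1) (hX _ (ltW t2) N.+1)) (T _)).
  have := mulr_ge0 (ltW eps0) (normr_ge0 h).
  move: (tl N) (tl N.+1) (`|h|) => a b p; lra.
move=> s sh; split; first exact: dP.
rewrite (_ : _ - _ = - A (t + s) (X (t + s) - P N (t + s)) +
   (A (t + s) (X (t + s)) - A t (X t))).
  apply: wbndD; last by apply: hd; exact: le_lt_trans h1.
  by apply: wbndN; apply: bA; [exact: th|apply: hX; exact: th].
by rewrite /A mulrBr raddfB /=; ring.
Qed.

End Picard.

(** * Linear flows along a solution *)

(** Time is rescaled: a segment of length [delta] of the time axis is run over
    by the parameter between 0 and 1, and every derivative carries the factor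
    [i delta]. *)
Definition speed {R : realType} {e : {posnum R}} (delta : R) : wal e :=
  scal ('i * delta%:C).

Definition modsq {R : realType} {e : {posnum R}} (c : R -> wal e) (t : R) : wal e :=
  c t * wstar (c t).

Definition szego_field {R : realType} {e : {posnum R}} (c : R -> wal e)
    (delta alpha t : R) : wal e :=
  - speed delta * (wtr (modsq c t * c t) + scal (alpha%:C * c t 0)).

Section SzegoFlow.
Context {R : realType} {e : {posnum R}}.
Local Notation C := R[i].
Local Notation wal := (wal e).
Local Notation bnd := (bnd e).
Local Notation Z := (wdelta 1).
Local Notation Zm := (wdelta (-1)).
Variables (c : R -> wal) (delta alpha sigma : R).
Implicit Types (x y : R -> wal) (t h M : R).

Local Notation J := (@speed R e delta).
Local Notation b := (modsq c).
Local Notation c' := (szego_field c delta alpha).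

Hypothesis plus_c : forall t, plus (c t).
Hypothesis der_c : forall t, nder c t (c' t).

(** Solutions of [i x' = delta Pi(|c|^2 x)], the linear equation that
    transports the eigenspaces. *)
Definition flow x := (forall t, `|t| <= 1 -> plus (x t)) /\
  (forall t, `|t| <= 1 -> nder x t (- J * Top (b t) (x t))).

Lemma scal_coef0 (a : C) : (scal a : wal) 0 = a.
Proof. by rewrite -[scal a]mulr1 scalM wcoef1 eqxx mulr1. Qed.

Lemma scal_inj (a a' : C) : scal a = scal a' :> wal -> a = a'.
Proof. by move=> h; rewrite -(scal_coef0 a) h scal_coef0. Qed.

Lemma ncont_c t : ncont c t. Proof. exact: nder_ncont (der_c t). Qed.

Lemma ncont_b t : ncont b t.
Proof. by apply: ncontM; [exact: ncont_c|apply: ncont_wstar; exact: ncont_c]. Qed.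

Lemma wtr_speed (d x : wal) : wtr (- J * d * x) = - J * Top d x.
Proof. by rewrite /Top -mulrA mulNr raddfN /= wtr_scal mulNr. Qed.

Lemma Top_bounded : exists2 M, 0 <= M &
  forall t (x : wal) M', `|t| <= 1 -> bnd x M' -> bnd (- J * Top (b t) x) (M * M').
Proof.
have [|B hB] := @ncont_bounded R e b (-1) 1; first by move=> t _; exact: ncont_b.
have B0 : 0 <= B by apply: bnd_ge0 (hB 0 _); lra.
exists (normc ('i * delta%:C) * (B * convM e)).
  by apply: mulr_ge0; [exact: normc_ge0|apply: mulr_ge0 => //; exact: convM_ge0].
move=> t x M' t1 hx; rewrite mulNr; apply: wbndN; rewrite -mulrA.
apply: wscale_bnd; apply: wtr_bnd; rewrite [B * _ * _]mulrAC; apply: wmul_bnd => //.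
by apply: hB; rewrite -ler_norml.
Qed.

Lemma flow_unique y : y 0 = 0 ->
  (forall t, `|t| <= 1 -> nder y t (- J * Top (b t) (y t))) ->
  forall t, `|t| <= 1 -> y t = 0.
Proof.
move=> y0 dy; have [M M0 hM] := Top_bounded.
by apply: (@ode_unique _ _ y (fun t => - J * Top (b t) (y t)) M) => // t M' t1; exact: hM.
Qed.

Lemma ode_const y : y 0 = 0 -> (forall t, `|t| <= 1 -> nder y t 0) ->
  forall t, `|t| <= 1 -> y t = 0.
Proof.
move=> y0 dy; apply: (@ode_unique _ _ y (fun=> 0) 0) => // t M' t1 hM.
by rewrite mul0r; exact: bnd0.
Qed.

(** The solution of the linear equation stays in the Hardy space, because its
    difference with its own truncation has derivative 0. *)
Lemma flow_exists (x0 : wal) : plus x0 -> exists2 x, x 0 = x0 & flow x.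
Proof.
move=> hx0.
have [|X X0 dX] := @linear_ode R e (fun t => - J * b t) x0.
  by move=> t; apply: ncont_mull; exact: ncont_b.
have dX' t : `|t| <= 1 -> nder X t (- J * Top (b t) (X t)).
  by move=> t1; rewrite -wtr_speed; apply: dX; lra.
exists X => //; split => // t t1.
have /(_ t t1) : forall t, `|t| <= 1 -> X t - wtr (X t) = 0.
  apply: ode_const; first by rewrite X0 wtr_id// subrr.
  move=> s s1; have d := dX' s s1.
  rewrite -(subrr (- J * Top (b s) (X s))); apply: nderB => //.
  rewrite -[X in nder _ _ X]wtr_id; first exact: nder_wtr.
  by rewrite -wtr_speed.
by move=> /eqP; rewrite subr_eq0 => /eqP ->.
Qed.

Lemma Kk_opp_speed (d h : wal) : Kk d (- J * h) = J * Kk d h.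
Proof. by rewrite mulNr KkNr KkZr conjcM conjcR conjCi mulNr raddfN /= mulNr opprK. Qed.

Lemma Kk_speed (d h : wal) : Kk d (J * h) = - J * Kk d h.
Proof. by rewrite -[J * h]opprK KkNr -mulNr Kk_opp_speed mulNr. Qed.

Lemma Kk_speed_regroup (d X A B D : wal) :
  Kk d (- J * (A + B - D) + Kk d (- J * X)) =
  J * (Kk d A + Kk d B - Kk d D) - J * Kk d (Kk d X).
Proof.
rewrite (KkDr d (- J * (A + B - D)) (Kk d (- J * X))) (Kk_opp_speed d (A + B - D)).
rewrite (KkBr d (A + B) D) (KkDr d A B) (Kk_opp_speed d X) (Kk_speed d (Kk d X)).
by rewrite mulNr.
Qed.

Lemma Kk_szego_field t (h : wal) : plus h -> Kk (c' t) h =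
  - J * (Top (b t) (Kk (c t) h) + Kk (c t) (Top (b t) h) - Kk (c t) (Kk (c t) (Kk (c t) h))).
Proof.
move=> hh; rewrite /szego_field mulNr KkNl KkZl KkDl (Kk_scal _ hh) addr0 mulNr.
by congr (- (J * _)); exact: Kk_lax.
Qed.

Lemma nder_Kk x (x' : wal) t : nder x t x' -> nder (fun s => Kk (c s) (x s)) t
  (Kk (c' t) (x t) + Kk (c t) x').
Proof.
move=> dx; rewrite /Kk -raddfD; apply: nder_wtr.
have := nderM (nder_mull Zm (der_c t)) (nder_wstar dx).
by [].
Qed.

(** The Lax pair: K is antilinear, so the two terms [T K + K T - K^3] coming
    from the two occurrences of K have opposite signs, and everything cancels
    but [T K^2]. *)
Lemma nder_Kk2 x t : flow x -> `|t| <= 1 -> nder (fun s => Kk (c s) (Kk (c s) (x s))) t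
  (- J * Top (b t) (Kk (c t) (Kk (c t) (x t)))).
Proof.
move=> [px dx] t1; have := nder_Kk (nder_Kk (dx t t1)).
rewrite (Kk_szego_field t (plus_Kk (c t) (x t))) (Kk_szego_field t (px t t1)).
rewrite (Kk_speed_regroup (c t) (Top (b t) (x t)) (Top (b t) (Kk (c t) (x t)))
  (Kk (c t) (Top (b t) (x t))) (Kk (c t) (Kk (c t) (Kk (c t) (x t))))).
congr (nder _ _ _).
move: (Kk (c t) (Kk (c t) (Kk (c t) (Kk (c t) (x t))))) => K4.
move: (Kk (c t) (Kk (c t) (Top (b t) (x t)))) => KKT.
move: (Kk (c t) (Top (b t) (Kk (c t) (x t)))) => KTK.
move: (Top (b t) _) => TKK.
by move: J => j; ring.
Qed.

Definition in_F (d h : wal) := Kk d (Kk d h) = scal ((sigma ^+ 2)%:C) * h.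

(** [K^2 x - sigma^2 x] is again a solution, with initial value 0. *)
Lemma flow_F x : flow x -> in_F (c 0) (x 0) -> forall t, `|t| <= 1 -> in_F (c t) (x t).
Proof.
move=> fx F0 t t1; have [px dx] := fx.
have : forall t, `|t| <= 1 ->
   Kk (c t) (Kk (c t) (x t)) - scal ((sigma ^+ 2)%:C) * x t = 0.
  apply: flow_unique; first by rewrite F0 subrr.
  move=> s s1; rewrite /Top mulrBr raddfB mulrBr /=.
  apply: nderB; first exact: nder_Kk2.
  have := nder_mull (scal ((sigma ^+ 2)%:C)) (dx s s1).
  by congr (nder _ _ _); rewrite [b s * _]mulrCA wtr_scal mulrCA.
by move=> /(_ t t1)/eqP; rewrite subr_eq0 => /eqP.
Qed.

Lemma nder_ip x y (x' y' : wal) t : nder x t x' -> nder y t y' ->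
  nder (fun s => scal (ip (x s) (y s)) : wal) t (scal (ip x' (y t) + ip (x t) y') : wal).
Proof.
move=> dx dy; rewrite /ip.
rewrite -[X in scal X](wcoefD (x' * wstar (y t)) (x t * wstar y') 0).
exact (nder_coef0 (nderM dx (nder_wstar dy))).
Qed.

Lemma ip_Top (d h k : wal) : plus k -> ip (Top d h) k = ip (d * h) k.
Proof. exact: ip_wtr. Qed.

Lemma wstar_b t : wstar (b t) = b t.
Proof. by rewrite /modsq wstarM wstarK mulrC. Qed.

Lemma ip_adj (d h k : wal) : wstar d = d -> ip h (d * k) = ip (d * h) k.
Proof. by move=> dd; rewrite /ip wstarM dd mulrA (mulrC h d). Qed.

Lemma ip_Zr (a : C) (h k : wal) : ip h (scal a * k) = a^* * ip h k.
Proof. by rewrite ip_conj ipZl conjcM -ip_conj. Qed.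

Lemma ipNr (h k : wal) : ip h (- k) = - ip h k.
Proof. by rewrite /ip rmorphN mulrN wcoefN. Qed.

Lemma ip_NJr (h k : wal) : ip h (- J * k) = ('i * delta%:C) * ip h k.
Proof.
by rewrite mulNr ipNr /speed ip_Zr conjcM conjcR conjCi !mulNr opprK.
Qed.

Lemma ip_NJl (h k : wal) : ip (- J * h) k = - (('i * delta%:C) * ip h k).
Proof. by rewrite mulNr ipNl ipZl. Qed.

(** The generator is skew-adjoint, its symbol [|c|^2] being real. *)
Lemma flow_ip x y : flow x -> flow y ->
  forall t, `|t| <= 1 -> ip (x t) (y t) = ip (x 0) (y 0).
Proof.
move=> [px dx] [py dy] t t1.
have : forall t, `|t| <= 1 -> scal (ip (x t) (y t)) - scal (ip (x 0) (y 0)) = 0 :> wal.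
  apply: ode_const; first by rewrite subrr.
  move=> s s1; have := nderB (nder_ip (dx s s1) (dy s s1)) (nder_cst (scal (ip (x 0) (y 0)) : wal) s).
  congr (nder _ _ _); rewrite subr0 ip_NJl ip_NJr.
  rewrite (@ip_Top (b s))//; last exact: py.
  rewrite [ip (x s) _]ip_conj (@ip_Top (b s))//; last exact: px.
  by rewrite -ip_conj ip_adj ?wstar_b// addNr rmorph0.
by move=> /(_ t t1)/eqP; rewrite subr_eq0 => /eqP /scal_inj.
Qed.

(** On the eigenspace, [a = (x | c)] and [b = x_0] satisfy the linear system
    [a' = i delta alpha conj(c_0) b] and
    [b' = - i delta (sigma^2 b + c_0 a)], so they vanish together with their
    initial values. The first equation holds because the cubic terms cancel,
    the second because the mean of [|c|^2 x] is that of [H^2 x], that is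
    of [K^2 x + a c]. *)
Lemma flow_orth x : flow x -> (forall t, `|t| <= 1 -> in_F (c t) (x t)) ->
  ip (x 0) (c 0) = 0 -> x 0 0 = 0 ->
  forall t, `|t| <= 1 -> ip (x t) (c t) = 0 /\ x t 0 = 0.
Proof.
move=> [px dx] Fx a0 b0.
(* both scalars are stored in one sequence, at the indices 0 and 1, so that
   uniqueness for curves of sequences applies *)
pose y t : wal := scal (ip (x t) (c t)) + Z * scal (x t 0).
have y_0 t : y t 0 = ip (x t) (c t).
  rewrite /y wcoefD wcoef_delta scal_coef0 -[scal (x t 0)]mulr1 scalM wcoef1.
  by rewrite mulr0 addr0.
have y_1 t : (Zm * y t) 0 = x t 0.
  rewrite /y wcoef_delta wcoefD wcoef_delta -[scal (ip _ _)]mulr1 scalM wcoef1.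
  by rewrite mulr0 add0r scal_coef0.
pose j := 'i * delta%:C : C.
pose kb t : wal := scal (j * alpha%:C) * wstar (scal (c t 0)) - Z * scal (j * (sigma ^+ 2)%:C).
pose ka t : wal := - Z * scal j * scal (c t 0).
pose y' t : wal := kb t * scal ((Zm * y t) 0) + ka t * scal (y t 0).
have y'E t : y' t = scal (j * alpha%:C * (c t 0)^* * x t 0) +
    Z * scal (- (j * (sigma ^+ 2)%:C * x t 0) - j * c t 0 * ip (x t) (c t)).
  rewrite /y' y_0 y_1 /kb /ka wstar_scal rmorphB rmorphN !rmorphM /=.
  by move: (scal _) (scal _) (scal _) => *; ring.
have dy t : `|t| <= 1 -> nder y t (y' t).
  move=> t1; have d1 := nder_ip (dx t t1) (der_c t).
  have d2 := nder_mull Z (nder_coef0 (dx t t1)).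
  have := nderD d1 d2; congr (nder _ _ _).
  rewrite y'E; congr (scal _ + Z * scal _).
  - rewrite ip_NJl (@ip_Top (b t))// /szego_field ip_NJr.
    have e1 : ip (wtr (b t * c t)) (x t) = (ip (b t * x t) (c t))^*.
      by rewrite ip_wtr; [rewrite -ip_conj (ip_adj _ _ (wstar_b t))|exact: px].
    have e2 (a : C) : ip (scal a) (x t) = a * (x t 0)^*.
      by rewrite -[scal a]mulr1 ipZl ip_conj ip1.
    rewrite (ip_conj _ (x t)) ipDl e1 e2 conjcD conjCK !conjcM conjcR conjCK /j.
    by ring.
  - rewrite mulNr wcoefN scalM -[Top _ _ 0]/((b t * x t) 0).
    rewrite -(Hk2_coef0 (plus_c t) (px t t1)) (Hk2 (plus_c t) (px t t1)) Fx//.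
    by rewrite wcoefD !scalM /j; ring.
have cc0 t : ncont (fun s => scal (c s 0) : wal) t by exact: nder_ncont (nder_coef0 (der_c t)).
have cka t : ncont ka t by exact: ncont_mull.
have ckb t : ncont kb t.
  apply: ncontD; last exact: ncont_cst.
  by apply: ncont_mull; exact: ncont_wstar.
have [|A hA] := @ncont_bounded R e ka (-1) 1; first by move=> t _; exact: cka.
have [|B hB] := @ncont_bounded R e kb (-1) 1; first by move=> t _; exact: ckb.
have A0 : 0 <= A by apply: bnd_ge0 (hA 0 _); lra.
have B0 : 0 <= B by apply: bnd_ge0 (hB 0 _); lra.
have [Km Km0 hKm] := @rbounded_mul R e Zm.
have [K0 K00 hK0] := @rbounded_coef0 R e.
pose M := B * (K0 * Km) * convM e + A * K0 * convM e.
have hy' t M' : `|t| <= 1 -> bnd (y t) M' -> bnd (y' t) (M * M').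
  rewrite ler_norml => t1 hM.
  have h := wbndD (wmul_bnd (hB t t1) (hK0 _ _ (hKm _ _ hM))) (wmul_bnd (hA t t1) (hK0 _ _ hM)).
  apply: le_bnd h; rewrite le_eqVlt; apply/orP; left; apply/eqP.
  by rewrite /M; ring.
have M0 : 0 <= M by rewrite /M; have := @convM_ge0 R e; move: (convM e) => k k0; rewrite !(mulr_ge0, addr_ge0).
have y0 : y 0 = 0 by rewrite /y a0 b0 rmorph0 mulr0 addr0.
move=> t t1; have yt := ode_unique M0 dy hy' y0 t1.
by rewrite -y_0 -y_1 yt mulr0.
Qed.

(** Truncation commutes with the backward shift on the sequences without
    coefficient of index 0, and this coefficient of [|c|^2 x] is that of
    [K^2 x + (x | c) c], namely 0. *)
Lemma flow_shift x : flow x -> (forall t, `|t| <= 1 -> in_F (c t) (x t)) ->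
  (forall t, `|t| <= 1 -> ip (x t) (c t) = 0 /\ x t 0 = 0) ->
  flow (fun t => Zm * x t).
Proof.
move=> [px dx] Fx Ox; split=> t t1.
  move=> k; rewrite wcoef_delta; case: k => [|k].
    by rewrite (_ : _ - _ = 0)//; case: (Ox t t1).
  by rewrite (_ : _ - _ = Negz k) ?px// !NegzE; lia.
have [ipx x0] := Ox t t1.
have bx0 : (b t * x t) 0 = 0.
  rewrite -(Hk2_coef0 (plus_c t) (px t t1)) (Hk2 (plus_c t) (px t t1)) (Fx t t1).
  by rewrite wcoefD !scalM x0 ipx mulr0 mul0r addr0.
have E : Zm * (- J * Top (b t) (x t)) = - J * Top (b t) (Zm * x t).
  rewrite (mulrCA Zm (- J)) /Top (mulrCA (b t) Zm (x t)) (wtr_ZmE (b t * x t)) bx0.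
  by rewrite (rmorph0 scal) subr0.
by rewrite -E; exact: nder_mull (dx t t1).
Qed.

End SzegoFlow.

(** * Inverses of linear factors *)

Section Geometric.
Context {R : realType} {e : {posnum R}}.
Local Notation C := R[i].
Local Notation wal := (wal e).
Local Notation bnd := (bnd e).
Local Notation s := (1 + e%:num).

(** Bernoulli: with [q = 1 / (1 + eta)], [(1 + eta) ^ k >= 1 + k eta]. *)
Lemma linear_geometric_bound (q : R) : 0 < q < 1 ->
  exists B, 0 <= B /\ forall k : nat, (1 + k%:R) * q ^+ k <= B.
Proof.
move=> /andP[q0 q1]; pose eta := q^-1 - 1.
have eta0 : 0 < eta by rewrite subr_gt0 invf_gt1.
exists (1 + eta^-1); split=> [|k]; first by rewrite addr_ge0// invr_ge0 ltW.
have eta1 : -1 <= eta by apply: le_trans (ltW eta0); rewrite lerN10.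
have eE : 1 + eta = q^-1 by rewrite /eta addrC subrK.
have := @bernoulli R eta k eta1; rewrite eE => b.
have qk : 0 < q ^+ k by exact: exprn_gt0.
rewrite exprVn in b.
rewrite -(ler_pdivlMr _ _ qk).
apply: (@le_trans _ _ ((1 + eta^-1) * (1 + k%:R * eta))); last first.
  by rewrite ler_wpM2l// addr_ge0// invr_ge0 ltW.
rewrite mulrDr mulr1 mulrDl mul1r mulrCA mulVf ?gt_eqF// mulr1.
have : 0 <= eta^-1 by rewrite invr_ge0 ltW.
have : 0 <= k%:R * eta by rewrite mulr_ge0// ltW.
lra.
Qed.

(** A geometric sequence beats every power: with [r = q ^ s], the bound
    [(1 + k) q ^ k <= B] is raised to the power [s]. *)
Lemma geometric_wt (r : R) : 0 <= r < 1 -> exists M, forall k : nat, r ^+ k <= M * wt e k.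
Proof.
move=> /andP[]; rewrite le_eqVlt => /predU1P[<-|r0] r1.
  exists (wt e 0)^-1 => -[|k].
    by rewrite expr0 mulVf// gt_eqF// wt_gt0.
  by rewrite expr0n /= mulr_ge0 ?wt_ge0// invr_ge0 wt_ge0.
have s0 := @s_gt0 R e.
pose q := r `^ (s^-1).
have q0 : 0 < q by exact: powR_gt0.
have q1 : q < 1.
  have : r `^ (s^-1) < 1 `^ (s^-1).
    by apply: gt0_ltr_powR; rewrite ?invr_gt0 ?nnegrE ?ltW.
  by rewrite powR1.
have qs : q `^ s = r by rewrite -powRrM mulVf ?gt_eqF// powRr1// ltW.
have [B [B0 hB]] := linear_geometric_bound (introT andP (conj q0 q1)).
exists (B `^ s) => k; rewrite /wt ler_pdivlMr ?powR_gt0 ?wt_base_gt0//.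
have rk : r ^+ k = (q ^+ k) `^ s.
  by rewrite -(powR_mulrn k (ltW q0)) -powRrM mulrC powRrM qs powR_mulrn// ltW.
have k0 : 0 <= 1 + k%:R :> R by rewrite addr_ge0.
apply: (@le_trans _ _ ((q ^+ k) `^ s * (1 + k%:R) `^ s)).
  rewrite rk ler_wpM2l ?powR_ge0//.
  have -> : (1 + k%:R) `^ s = ((1 + k%:R) ^+ 2) `^ (s / 2).
    rewrite -powR_mulrn// -powRrM; congr (_ `^ _); by field.
  apply: ge0_ler_powR; rewrite ?half_s_ge0 ?nnegrE ?sqr_ge0 ?(ltW (wt_base_gt0 _))//.
  by rewrite -pmulrn sqrrD expr1n mul1r -addrA lerD2l lerDr mulrn_wge0.
rewrite -powRM ?exprn_ge0 ?(ltW q0)//.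
apply: ge0_ler_powR; rewrite ?nnegrE ?(ltW s0) ?mulr_ge0 ?exprn_ge0 ?(ltW q0)//.
by rewrite mulrC.
Qed.

Definition geo_fun (a : C) (n : int) : C := if n is Posz k then a ^+ k else 0.

(** The inverse is the geometric series of [a z], which lies in the algebra
    since [|a| < 1]. *)
Lemma plus_inverse (a : C) : normc a < 1 ->
  exists2 g : wal, plus g & g * (1 - scal a * wdelta 1) = 1.
Proof.
move=> a1; have [M hM] := @geometric_wt (normc a) (introT andP (conj (normc_ge0 a) a1)).
have P : exists M, bnd (geo_fun a) M.
  exists M => -[k|k]; first by rewrite /geo_fun normc_X.
  have -> : geo_fun a (Negz k) = 0 by [].
  rewrite normc_0 mulr_ge0 ?wt_ge0//.
  have := le_trans _ (hM 0%N); rewrite expr0 => /(_ _ ler01).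
  by rewrite pmulr_lge0// wt_gt0.
exists (Wal P) => //; apply: walE => n.
rewrite (_ : Wal P * (1 - scal a * wdelta 1) =
  Wal P - scal a * (wdelta 1 * Wal P)); last by ring.
rewrite wcoefB scalM wcoef_delta wcoef1.
case: n => [[|k]|k].
- by rewrite /= mulr0 subr0.
- rewrite (_ : k.+1%:Z - 1 = k); last by lia.
  by rewrite /= exprS subrr.
- rewrite (_ : Negz k - 1 = Negz k.+1); last by rewrite !NegzE; lia.
  by rewrite /= mulr0 subr0.
Qed.

End Geometric.

(** * The eigenspace attached to a Blaschke product *)

Section PolynomialAction.
Context {R : realType} {e : {posnum R}}.
Local Notation C := R[i].
Local Notation wal := (wal e).
Implicit Types (f g : {poly C}) (r : wal).

(** The polynomial [f] seen as a sequence of coefficients. *)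
Definition evZ f : wal := (map_poly scal f).[wdelta 1].

Lemma evZD f g : evZ (f + g) = evZ f + evZ g.
Proof. by rewrite /evZ rmorphD hornerD. Qed.
Lemma evZB f g : evZ (f - g) = evZ f - evZ g.
Proof. by rewrite /evZ rmorphB hornerD hornerN. Qed.
Lemma evZM f g : evZ (f * g) = evZ f * evZ g.
Proof. by rewrite /evZ rmorphM hornerM. Qed.
Lemma evZC (a : C) : evZ a%:P = scal a.
Proof. by rewrite /evZ map_polyC hornerC. Qed.
Lemma evZ1 : evZ 1 = 1.
Proof. by rewrite -[1]/(1%:P) evZC rmorph1. Qed.
Lemma evZX : evZ 'X = wdelta 1.
Proof. by rewrite /evZ map_polyX hornerX. Qed.
Lemma evZ0 : evZ 0 = 0.
Proof. by rewrite /evZ rmorph0 horner0. Qed.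
Lemma wdelta_nat (k : nat) : wdelta k = wdelta 1 ^+ k :> wal.
Proof.
elim: k => [|k IH]; first by rewrite expr0.
by rewrite exprS -IH -wdeltaD; congr wdelta; lia.
Qed.
Lemma evZXn k : evZ 'X^k = wdelta k.
Proof. by rewrite /evZ map_polyXn hornerXn wdelta_nat. Qed.

Lemma evZ_coef f (n : int) : evZ f n = if n is Posz k then f`_k else 0.
Proof.
elim/poly_ind: f n => [|f a IH] n.
  by rewrite evZ0 wcoef0; case: n => // k; rewrite coef0.
rewrite evZD evZM evZX evZC mulrC wcoefD wcoef_delta IH.
rewrite -[scal a]mulr1 scalM wcoef1.
case: n => [[|k]|k].
- by rewrite coefD coefMX coefC /= mulr1.
- rewrite (_ : k.+1%:Z - 1 = k); last by lia.
  by rewrite coefD coefMX coefC /= mulr0.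
- rewrite (_ : Negz k - 1 = Negz k.+1); last by rewrite !NegzE; lia.
  by rewrite /= mulr0 addr0.
Qed.

Lemma plus_evZ f : plus (evZ f).
Proof. by move=> k; rewrite evZ_coef. Qed.

Lemma evZ_sum f : evZ f = \sum_(i < size f) scal f`_i * wdelta i.
Proof.
rewrite -{1}[f]coefK poly_def.
elim/big_ind2: _ => [|g x h y <- <-|i _].
- exact: evZ0.
- exact: evZD.
- by rewrite -mul_polyC evZM evZC evZXn.
Qed.

Lemma evZ_prod (I : Type) (l : seq I) (F : I -> {poly C}) :
  evZ (\prod_(i <- l) F i) = \prod_(i <- l) evZ (F i).
Proof.
elim: l => [|i l IH]; first by rewrite !big_nil evZ1.
by rewrite !big_cons evZM IH.
Qed.

(** The recursion [r_(n-1) = a r_n] starts from [r_(-1) = 0]. *)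
Lemma linear_factor_eq0 (a : C) r : plus r -> (wdelta 1 - scal a) * r = 0 -> r = 0.
Proof.
move=> hr; rewrite mulrBl => h.
have rec n : r (n - 1) = a * r n.
  have /eqP := congr1 (fun c : wal => c n) h.
  by rewrite wcoefB wcoef_delta scalM wcoef0 subr_eq0 => /eqP.
apply: walE => -[n|n]; last by rewrite hr wcoef0.
rewrite wcoef0; have [a0|a0] := eqVneq a 0.
  by have := rec n.+1; rewrite a0 mul0r (_ : n.+1%:Z - 1 = n)//; lia.
elim: n => [|n IH].
  have := rec 0; rewrite sub0r (hr 0%N : r (-1) = 0) => /esym/eqP.
  by rewrite mulf_eq0 (negbTE a0) => /eqP.
have := rec n.+1; rewrite (_ : n.+1%:Z - 1 = n); last by lia.
by rewrite IH => /esym/eqP; rewrite mulf_eq0 (negbTE a0) => /eqP.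
Qed.

(** Over an algebraically closed field, [f] is a product of linear factors, to
    be removed one by one. *)
Lemma evZ_mul_eq0 f r : plus r -> r <> 0 -> evZ f * r = 0 -> f = 0.
Proof.
move=> hr r0 h; apply/eqP/negP => /negP f0; apply: r0.
have [l fE] := closed_field_poly_normal f.
move: h; rewrite fE -mul_polyC evZM evZC evZ_prod => h.
have {h} : \prod_(i <- l) evZ ('X - i%:P) * r = 0.
  have := congr1 (fun x => scal (lead_coef f)^-1 * x) h.
  rewrite mulr0 !mulrA -rmorphM /= mulVf ?lead_coef_eq0//.
  by rewrite rmorph1 mul1r.
elim: l {fE} => [|a l IH]; first by rewrite big_nil mul1r.
rewrite big_cons evZB evZX evZC -mulrA => h; apply: IH.
apply: (linear_factor_eq0 _ h).
by apply: plusM => //; rewrite -evZ_prod; exact: plus_evZ.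
Qed.

End PolynomialAction.

Section BlaschkeStructure.
Context {R : realType} {e : {posnum R}}.
Local Notation C := R[i].
Local Notation wal := (wal e).

(** On the unit circle the denominator of a Blaschke product is [z ^ d] times
    the conjugate of its numerator. *)
Lemma evZ_den d (P : {poly C}) : size P = d.+1 ->
  evZ (blaschke_den d P) = wdelta d * wstar (evZ P) :> wal.
Proof.
move=> sP; apply: walE => n; rewrite wcoef_delta wstarE !evZ_coef.
case: n => [k|k]; last first.
  rewrite (_ : - (Negz k - d%:Z) = Posz (d + k.+1)); last by rewrite NegzE; lia.
  by rewrite nth_default ?rmorph0// sP; lia.
rewrite coef_poly; have [kd|kd] := leqP k d.
  by rewrite ltnS kd (_ : - (k%:Z - d%:Z) = Posz (d - k)%N)//; lia.
rewrite ltnS leqNgt kd /=.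
rewrite (_ : - (k%:Z - d%:Z) = Negz (k - d).-1) ?rmorph0// NegzE; lia.
Qed.

(** The denominator is the product of the [1 - conj(a) z], for [a] a zero of
    the numerator, hence [|a| < 1]. *)
Lemma den_inverse d (P : {poly C}) : blaschke_num d P ->
  exists2 E : wal, plus E & E * evZ (blaschke_den d P) = 1.
Proof.
case=> Pm sP Pr; rewrite evZ_den//.
have [l PE] := closed_field_poly_normal P.
move: PE; rewrite (monicP Pm) scale1r => PE.
have sl : size l = d by have := sP; rewrite PE size_prod_XsubC => -[].
have hl z : z \in l -> normc z < 1 by move=> zl; apply: Pr; rewrite PE root_prod_XsubC.
rewrite PE -sl evZ_prod; elim: l hl {PE sl} => [|a l IH] hl.
  by exists 1; [exact: plus1|rewrite big_nil rmorph1 mulr1 mul1r].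
have [E pE hE] := IH (fun z zl => hl z (mem_behead (s := a :: l) zl)).
have [g pg hg] := @plus_inverse R e (a^*) (eq_ind_r (fun x => x < 1) (hl a (mem_head _ _)) (normc_conj a)).
exists (g * E); first exact: plusM.
rewrite big_cons wstarM evZB evZX evZC rmorphB /= wstar_scal starZ.
rewrite (_ : wdelta (size l).+1 = wdelta 1 * wdelta (size l)); last first.
  by rewrite -wdeltaD; congr wdelta; lia.
rewrite (_ : g * E * _ = (g * (wdelta 1 * wdelta (-1) - scal (a^*) * wdelta 1)) *
   (E * (wdelta (size l) * wstar (\prod_(i <- l) evZ ('X - i%:P))))); last by ring.
by rewrite hE mulr1 ZZm.
Qed.

(** What an eigenspace F of [K^2] knows of a Blaschke product with denominator
    D: [p] is the element of F that represents the functional [( . | c)] on F,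
    it is [D r], and F consists of the [q r] for [q] of degree at most [d]. *)
Record blaschke_structure (c : wal) (sigma : R) d (P : {poly C}) (p r : wal) : Prop := {
  bs_plus : plus r;
  bs_den : p = evZ (blaschke_den d P) * r;
  bs_F : forall j, (j <= d)%N -> in_F sigma c (wdelta j * r);
  bs_orth : forall j, (0 < j <= d)%N -> ip (wdelta j * r) c = 0;
  bs_span : forall x, plus x -> in_F sigma c x ->
    exists2 f : {poly C}, (size f <= d.+1)%N & x = evZ f * r;
  bs_proj : forall x, plus x -> in_F sigma c x -> ip p x = ip c x;
  bs_nonorth : ip r c <> 0 }.

Lemma Kk_delta_mul (c r : wal) (j : nat) :
  Kk c (wdelta j * r) = wtr (wdelta (- j%:Z) * Kk c r).
Proof.
rewrite -wstar_delta wtr_nonpos; last exact: plus_delta.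
by rewrite /Kk wstarM; congr wtr; ring.
Qed.

(** Dividing [D K p = sp P p] by D. The difference [w] of the two sides of the
    third assertion is killed by the projection after multiplication by
    [D^*]; as [D^*] is invertible among the functions with nonpositive
    frequencies, [w] itself has negative frequencies only, while both of its
    terms have nonnegative ones. *)
Lemma blaschke_quotient (c p : wal) (sp : C) d (P : {poly C}) :
  blaschke_num d P -> plus p ->
  evZ (blaschke_den d P) * Kk c p = scal sp * evZ P * p ->
  exists r : wal, [/\ plus r, p = evZ (blaschke_den d P) * r &
    Kk c r = scal sp * (wdelta d * r)].
Proof.
move=> hP hp h; have [E pE hE] := den_inverse hP.
have sP : size P = d.+1 by case: hP.
have dE := evZ_den sP; have pD : plus (evZ (blaschke_den d P) : wal) by exact: plus_evZ.
move: h hE dE pD; set D : wal := evZ (blaschke_den d P); set Q : wal := evZ P.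
move=> h hE dE pD.
have QE : Q = wdelta d * wstar D.
  rewrite dE wstarM wstarK wstar_delta mulrA -wdeltaD subrr.
  by rewrite -[wdelta 0]/(1 : wal) mul1r.
pose r := E * p; have pE' : p = D * r by rewrite /r mulrA (mulrC D) hE mul1r.
have pr : plus r by exact: plusM.
exists r; split; [exact: pr|exact: pE'|]; clearbody r.
have Kp : Kk c p = wstar D * (scal sp * (wdelta d * r)).
  transitivity (E * D * Kk c p); first by rewrite hE mul1r.
  rewrite -mulrA h pE' QE.
  transitivity (E * D * (wstar D * (scal sp * (wdelta d * r)))); first by ring.
  by rewrite hE mul1r.
apply/eqP; rewrite -subr_eq0; apply/eqP.
pose x := scal sp * (wdelta d * r); rewrite -/x in Kp *.
have px : plus x by apply: plus_scal; apply: plusM; [exact: plus_delta|exact: pr].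
have e1 : wtr (wstar D * Kk c r) = Kk c p.
  transitivity (wtr (wstar D * (wdelta (-1) * c * wstar r))); first exact: wtr_nonpos.
  by rewrite pE' /Kk wstarM; congr wtr; ring.
have e2 : wtr (wstar D * x) = Kk c p by rewrite -Kp wtr_id.
clearbody x D; pose w := Kk c r - x; rewrite -/w.
have pw : plus w by apply: plusB; [exact: plus_Kk|exact: px].
have mw : minus (wstar D * w).
  refine (wtr_eq0_minus _).
  transitivity (wtr (wstar D * Kk c r) - wtr (wstar D * x)).
    by rewrite -raddfB -(mulrBr (wstar D)).
  by rewrite e1 e2 subrr.
clearbody w.
apply: plus_minus_eq0; first exact: pw.
have -> : w = (wstar D * w) * wstar E.
  transitivity (wstar (E * D) * w); first by rewrite hE rmorph1 mul1r.
  by rewrite wstarM; ring.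
by apply: minus_mul; [exact: mw|exact: pE].
Qed.

(** [K (z^j r) = sp z^(d-j) r], so that [K^2] multiplies [z^j r] by [|sp|^2];
    and [(z^j r | c)] is the conjugate of the coefficient of index 0 of
    [K (z^(j-1) r)], which is 0. *)
Lemma quotient_F (c r : wal) (sigma : R) (sp : C) (d : nat) :
  sp * sp^* = (sigma ^+ 2)%:C -> plus r ->
  Kk c r = scal sp * (wdelta d * r) ->
  (forall j, (j <= d)%N -> in_F sigma c (wdelta j * r)) /\
  (forall j, (0 < j <= d)%N -> ip (wdelta j * r) c = 0).
Proof.
move=> hsp pr Kr.
have K j : (j <= d)%N -> Kk c (wdelta j * r) = scal sp * (wdelta (d - j)%N * r).
  move=> jd; rewrite Kk_delta_mul Kr.
  rewrite (_ : wdelta (- j%:Z) * _ = scal sp * (wdelta (- j%:Z) * wdelta d * r)); last by ring.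
  rewrite -wdeltaD (_ : - j%:Z + d = (d - j)%N); last by lia.
  by rewrite wtr_id//; apply: plus_scal; apply: plusM => //; exact: plus_delta.
split=> j.
  move=> jd; rewrite /in_F K// KkZr K ?leq_subr// subKn//.
  by rewrite mulrA -rmorphM /= mulrC in hsp *; rewrite hsp.
case: j => // j /= jd; rewrite ip_conj.
rewrite (_ : ip c _ = (Kk c (wdelta j * r)) 0).
  rewrite K ?(ltnW jd)// scalM wcoef_delta.
  by rewrite (_ : 0 - _ = Negz (d - j).-1) ?pr ?mulr0 ?rmorph0// NegzE; lia.
have cE : c * wstar (wdelta j.+1 * r) = wdelta (-1) * c * wstar (wdelta j * r).
  rewrite !wstarM !wstar_delta.
  rewrite (_ : wdelta (- j.+1%:Z) = wdelta (-1) * wdelta (- j%:Z)); last first.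
    by rewrite -wdeltaD; congr wdelta; lia.
  by ring.
by rewrite /ip cE.
Qed.

End BlaschkeStructure.

(** * Transport of the eigenspace by the flow *)

Section Transport.
Context {R : realType} {e : {posnum R}}.
Local Notation C := R[i].
Local Notation wal := (wal e).
Variables (c : R -> wal) (delta alpha sigma : R).
Hypothesis plus_c : forall t, plus (c t).
Hypothesis der_c : forall t, nder c t (szego_field c delta alpha t).

Lemma normr1_le1 : `|1 : R| <= 1. Proof. by rewrite normr1. Qed.

Lemma wdelta_mulA (m n k : int) (x : wal) : m + n = k ->
  wdelta m * (wdelta n * x) = wdelta k * x.
Proof. by move=> <-; rewrite mulrA -wdeltaD. Qed.

Lemma ip_scale2 (k : C) (x y r : wal) :
  ip (x * (scal k * r)) (y * (scal k * r)) = k * k^* * ip (x * r) (y * r).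
Proof.
have -> : x * (scal k * r) = scal k * (x * r) by rewrite mulrCA.
have -> : y * (scal k * r) = scal k * (y * r) by rewrite mulrCA.
have h a : ip (scal k * (x * r)) a = k * ip (x * r) a by exact: ipZl.
by rewrite h ip_Zr; exact: mulrA.
Qed.

(** As long as [z^(d-i) r] with [i < d] is orthogonal to 1 and to [c 0], the
    flow that starts from it keeps this property and may be shifted back once
    more. *)
Lemma flow_unshift d (r : wal) : plus r ->
  (forall j, (j <= d)%N -> in_F sigma (c 0) (wdelta j * r)) ->
  (forall j, (0 < j <= d)%N -> ip (wdelta j * r) (c 0) = 0) ->
  exists2 X : R -> wal, X 0 = wdelta d * r &
    forall i, (i <= d)%N -> flow c delta (fun t => wdelta (- i%:Z) * X t).
Proof.
move=> pr hF ho.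
have pd : plus (wdelta d * r) by apply: plusM; [exact: plus_delta|exact: pr].
have [X X0 fX] := flow_exists der_c pd.
exists X; first exact: X0.
have Y0 i : (i <= d)%N -> wdelta (- i%:Z) * X 0 = wdelta (d - i)%N * r.
  by move=> id; rewrite X0; apply: wdelta_mulA; lia.
elim=> [_|i IH id].
  rewrite (_ : (fun t => _) = X); first exact: fX.
  by apply/funext => t; rewrite oppr0 mul1r.
have fY := IH (ltnW id).
have inF t : `|t| <= 1 -> in_F sigma (c t) (wdelta (- i%:Z) * X t).
  move=> ht; apply: (flow_F plus_c der_c fY _ ht).
  by rewrite (Y0 _ (ltnW id)); apply: hF; exact: leq_subr.
have orth t : `|t| <= 1 -> ip (wdelta (- i%:Z) * X t) (c t) = 0 /\ (wdelta (- i%:Z) * X t) 0 = 0.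
  move=> ht; apply: (flow_orth plus_c der_c fY inF _ _ ht).
    by rewrite (Y0 _ (ltnW id)); apply: ho; rewrite subn_gt0 id leq_subr.
  rewrite (Y0 _ (ltnW id)) wcoef_delta (_ : 0 - _ = Negz (d - i).-1) ?pr//.
  by rewrite NegzE; lia.
have fS := flow_shift plus_c fY inF orth.
have -> : (fun t => wdelta (- i.+1%:Z) * X t) =
    (fun t => wdelta (-1) * (wdelta (- i%:Z) * X t)).
  by apply/funext => t; apply/esym/wdelta_mulA; lia.
exact: fS.
Qed.

Variables (d1 d2 : nat) (P1 P2 : {poly C}) (p1 p2 r1 r2 : wal).
Hypothesis S1 : blaschke_structure (c 0) sigma d1 P1 p1 r1.
Hypothesis S2 : blaschke_structure (c 1) sigma d2 P2 p2 r2.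

Lemma bs_neq0 c0 d P (p r : wal) : blaschke_structure c0 sigma d P p r -> r <> 0.
Proof. by move=> h r0; apply: (bs_nonorth h); rewrite r0 /ip mul0r. Qed.

(** At the final time, [X = z^d1 y] belongs to the second eigenspace together
    with [y = g r2], so that [z^d1 g] is of degree at most [d2]. *)
Lemma transport : exists (g : {poly C}),
  [/\ g != 0, (d1 + size g <= d2.+1)%N &
   forall j k, (j <= d1)%N -> (k <= d1)%N ->
     ip (wdelta j * (evZ g * r2)) (wdelta k * (evZ g * r2)) =
     ip (wdelta j * r1) (wdelta k * r1)].
Proof.
have [X X0 fX] := flow_unshift (bs_plus S1) (bs_F S1) (bs_orth S1).
pose y := wdelta (- d1%:Z) * X 1.
have XE : X 1 = wdelta d1 * y by rewrite (@wdelta_mulA _ _ 0) ?mul1r//; lia.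
have Y0 i : (i <= d1)%N -> wdelta (- i%:Z) * X 0 = wdelta (d1 - i)%N * r1.
  by move=> id; rewrite X0; apply: wdelta_mulA; lia.
have inF i : (i <= d1)%N -> in_F sigma (c 1) (wdelta (- i%:Z) * X 1).
  move=> id; apply: (flow_F plus_c der_c (fX i id) _ normr1_le1).
  by rewrite (Y0 _ id); apply: (bs_F S1); exact: leq_subr.
have py : plus y by have [+ _] := fX d1 (leqnn _); apply; exact: normr1_le1.
have [g _ yE] := bs_span S2 py (inF d1 (leqnn _)).
clearbody y.
have pX : plus (X 1).
  have [h _] := fX 0 (leq0n _).
  by have := h _ normr1_le1; rewrite oppr0 mul1r.
have FX : in_F sigma (c 1) (X 1) by have := inF _ (leq0n _); rewrite oppr0 mul1r.
have [f sf XfE] := bs_span S2 pX FX.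
have fE : f = 'X^d1 * g.
  apply/eqP; rewrite -subr_eq0; apply/eqP.
  apply: (evZ_mul_eq0 (bs_plus S2) (bs_neq0 S2)).
  by rewrite evZB evZM evZXn mulrBl -XfE -mulrA -yE -XE subrr.
have iso j k : (j <= d1)%N -> (k <= d1)%N ->
     ip (wdelta j * (evZ g * r2)) (wdelta k * (evZ g * r2)) =
     ip (wdelta j * r1) (wdelta k * r1).
  move=> jd kd; have YE i : (i <= d1)%N -> wdelta i * y = wdelta (- (d1 - i)%:Z) * X 1.
    by move=> id; rewrite XE; apply/esym/wdelta_mulA; lia.
  rewrite -yE; rewrite (YE _ jd); rewrite (YE _ kd).
  transitivity (ip (wdelta (- (d1 - j)%:Z) * X 0) (wdelta (- (d1 - k)%:Z) * X 0)).
    exact: (flow_ip (fX _ (leq_subr j d1)) (fX _ (leq_subr k d1)) normr1_le1).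
  have Yj := Y0 (d1 - j)%N (leq_subr j d1).
  have Yk := Y0 (d1 - k)%N (leq_subr k d1).
  rewrite (subKn jd) in Yj.
  rewrite (subKn kd) in Yk.
  exact: (congr2 ip Yj Yk).
have g0 : g != 0.
  apply/eqP => g0; apply: (bs_neq0 S1); apply: ip_eq0.
  have := iso 0 0 (leq0n _) (leq0n _); rewrite g0 evZ0 mul0r !mul1r.
  by move=> <-; rewrite /ip mul0r.
exists g; split; [exact: g0| |exact: iso].
by move: sf; rewrite fE mulrC size_mulXn.
Qed.

Lemma degree_le : (d1 <= d2)%N.
Proof.
have [g [g0 + _]] := transport.
by move: g0; rewrite -size_poly_gt0; lia.
Qed.

(** The degrees being equal, [g] is a constant [k], and the shifts of [r1] and
    [r2] have proportional Gram matrices. Each [D r] is orthogonal to the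
    shifts [z^j r] with [0 < j <= d], by [bs_proj] and [bs_orth]; therefore
    [(D1 - D2) r2] is orthogonal to all the shifts of which it is a
    combination, as [D1 - D2] has no constant term. *)
Lemma same_numerator : blaschke_num d1 P1 -> blaschke_num d2 P2 -> d1 = d2 -> P1 = P2.
Proof.
move=> [P1m sP1 _] [P2m sP2 _] dd; have T2 := S2; rewrite -dd in T2 sP2.
have [g [g0 sg iso]] := transport.
have /size_poly1P[k k0 gE] : size g == 1.
  by rewrite eqn_leq size_poly_gt0 g0 andbT; move: sg; rewrite -dd; lia.
set D1 := blaschke_den d1 P1; set D2 := blaschke_den d1 P2.
have kk0 : k * k^* != 0 by rewrite mulf_neq0// fmorph_eq0.
have iso' i j : (i <= d1)%N -> (j <= d1)%N ->
   k * k^* * ip (wdelta i * r2) (wdelta j * r2) = ip (wdelta i * r1) (wdelta j * r1).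
  move=> id jd; rewrite -iso// gE evZC.
  by symmetry; exact: ip_scale2.
have den_ip (P : {poly C}) r x : ip (evZ (blaschke_den d1 P) * r) x =
    \sum_(i < d1.+1) (blaschke_den d1 P)`_i * ip (wdelta i * r) x.
  have sD : (size (blaschke_den d1 P) <= d1.+1)%N by rewrite /blaschke_den size_poly.
  rewrite evZ_sum mulr_suml ip_suml.
  rewrite (big_ord_widen d1.+1
    (fun i : nat => ip (scal (blaschke_den d1 P)`_i * wdelta i * r) x) sD).
  rewrite big_mkcond; apply: eq_bigr => i _ /=; case: ltnP => hi.
    by rewrite -mulrA ipZl.
  by rewrite nth_default// mul0r.
have orth j : (0 < j <= d1)%N -> ip (evZ (D1 - D2) * r2) (wdelta j * r2) = 0.
  move=> /[dup] hj /andP[j0 jd].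
  rewrite evZB mulrBl ipBl.
  have -> : ip (evZ D2 * r2) (wdelta j * r2) = 0.
    rewrite -(bs_den T2) (bs_proj T2); last exact: (bs_F T2).
      by rewrite ip_conj (bs_orth T2)// rmorph0.
    by apply: plusM; [exact: plus_delta|exact: (bs_plus T2)].
  rewrite subr0; apply/eqP; rewrite -(mulrI_eq0 _ (mulfI kk0)) den_ip mulr_sumr.
  rewrite (eq_bigr (fun i : 'I_d1.+1 => D1`_i * ip (wdelta i * r1) (wdelta j * r1))); last first.
    by move=> i _; rewrite mulrCA iso'// -ltnS.
  rewrite -den_ip -(bs_den S1) (bs_proj S1); last exact: (bs_F S1).
    by rewrite ip_conj (bs_orth S1)// rmorph0.
  by apply: plusM; [exact: plus_delta|exact: (bs_plus S1)].
(* both constant terms are the conjugate of the leading coefficient 1 *)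
have D0 : (D1 - D2)`_0 = 0.
  rewrite coefB !coef_poly /= subn0.
  move: (monicP P1m) (monicP P2m); rewrite /lead_coef sP1 sP2 /= => -> ->.
  by rewrite subrr.
have /eqP : evZ (D1 - D2) * r2 = 0.
  apply: ip_eq0; rewrite {2}evZ_sum mulr_suml ip_conj ip_suml big1 ?rmorph0// => i _.
  rewrite -mulrA ipZl ip_conj.
  have [->|i0] := posnP i; first by rewrite D0 mul0r.
  rewrite orth ?rmorph0 ?mulr0// i0 /= -ltnS (leq_trans (ltn_ord i))//.
  by rewrite (leq_trans (size_polyD _ _))// size_polyN geq_max /D1 /D2 /blaschke_den !size_poly.
move/eqP/(evZ_mul_eq0 (bs_plus T2) (bs_neq0 T2))/eqP.
rewrite subr_eq0 => /eqP DD; apply/polyP => n.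
have [nd|nd] := leqP n d1; last by rewrite !nth_default// ?sP1 ?sP2.
have := congr1 (fun f : {poly C} => f`_(d1 - n)) DD.
rewrite !coef_poly ltnS leq_subr subKn// => /(congr1 Num.conj).
by rewrite !conjCK.
Qed.

End Transport.

(** * Sobolev functions and their coefficients *)

Section SobolevCoefficients.
Context {R : realType} {e : {posnum R}}.
Local Notation C := R[i].
Local Notation wal := (wal e).
Local Notation bnd := (bnd e).
Local Notation wt := (wt e).
Local Notation s := (1 + e%:num).
Implicit Types (f g h u v w : R -> C).

Lemma Hsnorm_sum f (M : R) (r : seq int) : uniq r -> (Hsnorm s f <= M%:E)%E ->
  \sum_(n <- r) (normc (fourier f n) / wt n) ^+ 2 <= M ^+ 2.
Proof.
move=> ur; rewrite /Hsnorm; set E := esum _ _ => hM.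
have termE n : (normc (fourier f n) / wt n) ^+ 2 =
    (1 + n%:~R ^+ 2) `^ s * normc (fourier f n) ^+ 2.
  rewrite exprMn mulrC /wt invrK; congr (_ * _).
  rewrite -powR_mulrn ?powR_ge0// -powRrM; congr (_ `^ _); by field.
have leE : ((\sum_(n <- r) (normc (fourier f n) / wt n) ^+ 2)%:E <= E)%E.
  apply: esum_ge; exists [set` r]; first by split; [exact: finite_seq|].
  rewrite -fsbig_seq// -sumEFin; apply: lee_sum => n _.
  by rewrite termE.
have E0 : (0 <= E)%E.
  by apply: esum_ge0 => n _; rewrite lee_fin mulr_ge0 ?powR_ge0// sqr_ge0.
have M0 : 0 <= M by rewrite -lee_fin; apply: le_trans hM; exact: poweR_ge0.
rewrite -lee_fin; apply: (le_trans leE).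
have -> : E = ((E `^ 2^-1) `^ 2)%E.
  by rewrite -poweRrM mulVf// poweRe1.
rewrite -powR_mulrn// -poweR_EFin.
by apply: gt0_ler_poweR; rewrite ?in_itv /= ?poweR_ge0 ?lee_fin ?M0 ?leey.
Qed.

Lemma Hsnorm_bnd f (M : R) : (Hsnorm s f <= M%:E)%E -> bnd (fourier f) M.
Proof.
move=> h n; have M0 : 0 <= M by rewrite -lee_fin; apply: le_trans h; exact: poweR_ge0.
have := @Hsnorm_sum f M [:: n] isT h.
rewrite big_seq1 ler_pXn2r ?nnegrE ?divr_ge0 ?normc_ge0 ?wt_ge0//.
by rewrite ler_pdivrMr ?wt_gt0.
Qed.

Lemma Hsplus_fin f : Hsplus s f -> exists M, (Hsnorm s f <= M%:E)%E.
Proof.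
case=> _ h; exists (fine (Hsnorm s f)); rewrite fineK// ge0_fin_numE//.
exact: poweR_ge0.
Qed.

Lemma Hsplus_wal f : Hsplus s f -> exists c : wal, forall n, fourier f n = c n.
Proof.
move=> /Hsplus_fin[M /Hsnorm_bnd h].
by exists (@Wal _ e (fourier f) (ex_intro _ M h)).
Qed.

Lemma Hsplus_L2plus f : Hsplus s f -> L2plus f. Proof. by case. Qed.

Lemma L2plus_neg f k : L2plus f -> fourier f (Negz k) = 0.
Proof. by case=> _; apply. Qed.

Lemma L2plus_plus f (c : wal) : L2plus f -> (forall n, fourier f n = c n) -> plus c.
Proof. by move=> lf fc k; rewrite -fc L2plus_neg. Qed.

Lemma plus_L2plus f (c : wal) : plus c -> L2 f -> (forall n, fourier f n = c n) -> L2plus f.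
Proof.
move=> pc lf fc; split=> // -[n|n] //; rewrite fc pc//.
Qed.

Lemma L2plus_ei (n : nat) : L2plus (ei n : R -> C).
Proof.
split; first exact: L2_ei.
by move=> [m|m] // _; rewrite fourier_ei.
Qed.

(** The projection of a function with coefficients in the algebra is the sum
    of the truncated sequence: what is left has negative frequencies, and is
    orthogonal to the Hardy space. *)
Lemma inner_synth_minus (c : wal) h : minus c -> L2plus h -> inner (synth c) h = 0.
Proof.
move=> mc hh; have [lh _] := hh.
have -> : inner (synth c) h = fourier (fun x => synth c x * (h x)^*) 0.
  rewrite fourierE; congr (_ * _); apply: cintegral_ext => x _.
  by rewrite oppr0 ei0 mulr1.
have [M hM] := walP c.
apply: (@fourier_synth_eq _ _ _ M (fun x => (h x)^*) _ _ 0%N hM (L2J lh)) => N _.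
rewrite /cpart big1_seq// => k _; rewrite mc mul0r add0r fourierJ//.
by rewrite sub0r opprK L2plus_neg// rmorph0 mulr0.
Qed.

Lemma orthoproj_fourier f g n : L2 f -> is_orthoproj L2plus f g ->
  fourier g n = if n is Posz _ then fourier f n else 0.
Proof.
move=> lf [lg hg]; case: n => n; last exact: L2plus_neg.
have := hg _ (L2plus_ei n); rewrite innerBl//; [|by case: lg|exact: L2_ei].
by move/eqP; rewrite subr_eq0 => /eqP.
Qed.

Lemma orthoproj_synth f (y : wal) : L2 f -> (forall n, fourier f n = y n) ->
  is_orthoproj L2plus f (synth (wtr y)).
Proof.
move=> lf fy; split.
  by apply: (@plus_L2plus _ (wtr y)); [exact: plus_wtr|exact: wL2|move=> n; exact: wfourier].
move=> h hh; have [lh _] := hh.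
rewrite -(inner_synth_minus (minus_sub y) hh).
apply: inner_ae => //; [|exact: wL2| |exact: aeq_refl].
  by apply: L2B => //; exact: wL2.
apply: aeq_synth; first by apply: L2B => //; exact: wL2.
by move=> n; rewrite fourierB//; [rewrite fy wfourier wcoefB|exact: wL2].
Qed.

(** Also when the projection does not exist, as the default value is 0. *)
Lemma Pi_L2plus f : L2plus (Pi f).
Proof.
rewrite /Pi; case: xgetP => [g -> [] //|_].
split; first exact: L2_cst.
by move=> n _; rewrite (_ : (fun=> 0) = (fun x => 0 * ei 0 x)) ?fourierZ ?mul0r//;
  [exact: L2_ei|apply/funext => x; rewrite mul0r].
Qed.

Lemma Pi_coef f (y : wal) n : L2 f -> (forall n, fourier f n = y n) ->
  fourier (Pi f) n = wtr y n.
Proof.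
move=> lf fy; rewrite (@orthoproj_fourier f _ _ lf); last first.
  by apply: (xgetPex (fun=> 0)); exists (synth (wtr y)); exact: orthoproj_synth.
by case: n.
Qed.

Lemma fourier_cst (a : C) n : fourier (fun=> a) n = if n == 0 then a else 0.
Proof.
have -> : (fun=> a) = (fun x : R => a * ei 0 x) by apply/funext => x; rewrite ei0 mulr1.
rewrite fourierZ ?fourier_ei; last exact: L2_ei.
by rewrite eq_sym; case: eqP; rewrite ?mulr1 ?mulr0.
Qed.

Lemma shift_L2plus w : L2plus w -> L2plus (Defs.shift w).
Proof.
have sE : Defs.shift w = (fun x => ei 1 x * w x).
  by apply/funext => x; rewrite /Defs.shift /ei mul1r.
case=> lw hw; rewrite sE; split; first exact: L2_ei_mul.
by move=> n n0; rewrite fourier_mul_ei hw//; lia.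
Qed.

(** The adjoint of the shift is explicit: it maps [g] to [z^-1 (g - g_0)]. *)
Lemma shift_adj_spec g : L2plus g -> L2plus (shift_adj g) /\
    forall w, L2plus w -> inner (shift_adj g) w = inner g (Defs.shift w).
Proof.
move=> pg; have [lg hg] := pg; rewrite /shift_adj; case: xgetP => [k -> //|hn].
case: (hn (fun x => ei (-1) x * (g x - fourier g 0))) => {hn}.
have lB : L2 (fun x => g x - fourier g 0) by apply: L2B => //; exact: L2_cst.
split.
  split; first exact: L2_ei_mul.
  move=> n n0; rewrite fourier_mul_ei fourierB//; last exact: L2_cst.
  rewrite fourier_cst opprK; case: eqP => [->|n1]; first by rewrite subrr.
  by rewrite subr0 hg//; lia.
move=> w pw; have [lw _] := pw; have [ls hs] := shift_L2plus pw.
transitivity (inner (fun x => g x - fourier g 0) (Defs.shift w)).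
  rewrite /inner; congr (_ * _); apply: cintegral_ext => x _.
  by rewrite /Defs.shift conjcM /ei intrN mulNr mul1r expiN; ring.
rewrite innerBl//; last exact: L2_cst.
rewrite [X in _ - X](_ : _ = 0) ?subr0//.
rewrite inner_conj//; last exact: L2_cst.
have sE : Defs.shift w = (fun x => ei 1 x * w x).
  by apply/funext => x; rewrite /Defs.shift /ei mul1r.
have -> : (fun=> fourier g 0) = (fun x : R => fourier g 0 * ei 0 x).
  by apply/funext => x; rewrite ei0 mulr1.
rewrite inner_conj ?conjCK//; last by apply: L2Z; exact: L2_ei.
rewrite innerZl//; last exact: L2_ei.
rewrite inner_conj//; last exact: L2_ei.
rewrite -fourierI sE fourier_mul_ei.
have := L2plus_neg 0 pw; rewrite (_ : 0 - 1 = Negz 0)// => ->.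
by rewrite rmorph0 mulr0.
Qed.

Lemma Kop_L2plus u h : L2plus (Kop u h).
Proof. exact: (shift_adj_spec (Pi_L2plus _)).1. Qed.

Lemma Kop_coef u h n :
  fourier (Kop u h) n = if n is Posz k then fourier (Hop u h) k.+1 else 0.
Proof.
case: n => k; last exact/L2plus_neg/Kop_L2plus.
rewrite fourierI; have [_ ->] := shift_adj_spec (Pi_L2plus (fun x => u x * (h x)^*)); last exact: L2plus_ei.
rewrite fourierI; apply: inner_ext => // x.
by rewrite /Defs.shift !ei_nat exprS.
Qed.

Lemma L2_coef_mul f g (c d : wal) n : L2 f -> L2 g ->
  (forall n, fourier f n = c n) -> (forall n, fourier g n = d n) ->
  L2 (fun x => f x * g x) /\ fourier (fun x => f x * g x) n = (c * d) n.
Proof.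
move=> lf lg fc gd; have fE := aeq_synth lf fc; have gE := aeq_synth lg gd.
have l : L2 (fun x => f x * g x).
  apply: (@L2_ae _ (fun x => synth c x * synth d x)).
  - exact: cintegrable_meas (L2_mul lf lg).
  - apply: aeq_sym.
    by apply: (aeq_comp2 (T := fun a b x => a x * b x)) fE gE => a b a' b' x -> ->.
  - exact/wL2_mul/wL2.
split=> //; rewrite wcoefM; apply: fourier_mul_ae => //.
exact/wL2_mul/wL2.
Qed.

Lemma coef_conj f (c : wal) n : L2 f -> (forall n, fourier f n = c n) ->
  fourier (fun x => (f x)^*) n = wstar c n.
Proof. by move=> lf fc; rewrite fourierJ// fc. Qed.

(** The dictionary between the operators K on functions and on sequences; the
    index shift comes from the adjoint of the shift. *)
Lemma Kop_wal u h (c x : wal) : L2 u -> (forall n, fourier u n = c n) ->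
  L2 h -> (forall n, fourier h n = x n) -> forall n, fourier (Kop u h) n = Kk c x n.
Proof.
move=> lu uc lh hx n; rewrite Kop_coef; case: n => k //.
have [lp pE] := L2_coef_mul 0 lu (L2J lh) uc (fun n => coef_conj n lh hx).
rewrite (Pi_coef k.+1 lp (fun n => (L2_coef_mul n lu (L2J lh) uc (fun n => coef_conj n lh hx)).2)).
rewrite -[RHS]/((wdelta (-1) * c * wstar x) k) -mulrA wcoef_delta.
by rewrite (_ : k%:Z - (-1) = k.+1)//; lia.
Qed.

End SobolevCoefficients.

(** * Eigenspaces and solutions in terms of coefficients *)

Section HankelEigenspaces.
Context {R : realType} {e : {posnum R}}.
Local Notation C := R[i].
Local Notation wal := (wal e).
Local Notation bnd := (bnd e).
Local Notation wt := (wt e).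
Local Notation s := (1 + e%:num).
Implicit Types (f g h u v w : R -> C).

(** The partial sums of the coefficient of order [N] of [u conj(h)] are
    dominated by the sum over [k >= N] of [|u_k| |h_(k-N)|], which is at most
    [w_N] times the sum of [(|u_k| / w_k) |h_(k-N)|]; the last sum is bounded
    by means of the H^s norm of [u] and the energy of [h]. *)
Lemma hankel_coef_le u h (c : wal) (M : R) (N : nat) :
  L2plus u -> (Hsnorm s u <= M%:E)%E -> (forall n, fourier u n = c n) -> L2plus h ->
  normc (fourier (fun x => synth c x * (h x)^*) N) <= (M ^+ 2 + energy h) * wt N.
Proof.
move=> pu hM uc ph; have [lh _] := ph; have pc : plus c := L2plus_plus pu uc.
have w0 : 0 <= wt N by exact: wt_ge0.
have [B hB] := walP c.
apply: (fourier_synth_le hB (L2J lh)) => K; rewrite /cpart.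
apply: (le_trans (normc_sum _ _ _)).
have su := @Hsnorm_sum R e u M [seq Posz k | k <- iota 0 K] _ hM.
have sh := @bessel R h [seq Posz k - N%:Z | k <- iota 0 K] lh _.
have {su} su : \sum_(0 <= k < K) (normc (c (Posz k)) / wt k) ^+ 2 <= M ^+ 2.
  rewrite /index_iota subn0; have := su _; rewrite big_map.
  under eq_bigr do rewrite uc.
  by apply; rewrite map_inj_uniq ?iota_uniq// => i j [].
have {sh} sh : \sum_(0 <= k < K) normc (fourier h (Posz k - N%:Z)) ^+ 2 <= energy h.
  rewrite /index_iota subn0; have := sh _; rewrite big_map.
  by apply; rewrite map_inj_uniq ?iota_uniq// => i j; lia.
apply: (@le_trans _ _ (\sum_(0 <= k < K) ((normc (c (Posz k)) / wt k) ^+ 2 +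
   normc (fourier h (Posz k - N%:Z)) ^+ 2) * wt N)); last first.
  by rewrite -mulr_suml ler_wpM2r// big_split lerD.
apply: ler_sum => k _.
rewrite (pc k) mul0r addr0 normc_M fourierJ// normc_conj opprB.
have [kN|kN] := ltnP k N.
  rewrite (_ : k%:Z - N%:Z = Negz (N - k).-1); last by rewrite NegzE; lia.
  rewrite (L2plus_neg _ ph) normc_0 mulr0 mulr_ge0// addr_ge0 ?sqr_ge0//.
set y := normc (fourier h _); set a := normc (c k).
have y0 : 0 <= y by exact: normc_ge0.
have a0 : 0 <= a / wt k by rewrite divr_ge0 ?normc_ge0 ?wt_ge0.
have le1 : a <= (a / wt k) * wt N.
  rewrite -{1}[a](@divfK _ (wt k)) ?gt_eqF ?wt_gt0// ler_wpM2l//.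
  by apply: wt_mono; rewrite !ger0_norm// ler_nat.
apply: (@le_trans _ _ ((a / wt k) * wt N * y)); first by rewrite ler_wpM2r.
rewrite mulrAC ler_wpM2r//.
move: (a / wt k) a0 y0 {le1} => b b0 y0.
have := sqr_ge0 (b - y); rewrite sqrrB.
have : 0 <= b * y by exact: mulr_ge0.
by lra.
Qed.

(** When the projection of [u conj(h)] does not exist the value of K is 0, and
    otherwise [hankel_coef_le] applies. *)
Lemma Kop_coef_wal u h : Hsplus s u -> L2plus h ->
  exists g : wal, forall n, fourier (Kop u h) n = g n.
Proof.
move=> hu ph; have [pu _] := hu; have [lu _] := pu; have [lh _] := ph.
have [M hM] := Hsplus_fin hu; have [c uc] := Hsplus_wal hu.
have uE := aeq_synth lu uc.
have M0 : 0 <= M ^+ 2 + energy h by rewrite addr_ge0 ?sqr_ge0 ?energy_ge0.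
have bK : exists M, bnd (fourier (Kop u h)) M.
  exists (M ^+ 2 + energy h) => n.
  have nn : 0 <= (M ^+ 2 + energy h) * wt n by rewrite mulr_ge0// wt_ge0.
  rewrite Kop_coef; case: n nn => k nn; last by rewrite normc_0.
  have ls : L2 (fun x => synth c x * (h x)^*) by exact: wL2_mul (L2J lh).
  have mE : aeq (fun x => u x * (h x)^*) (fun x => synth c x * (h x)^*).
    by apply: (aeq_comp2 (T := fun a b x => a x * (b x)^*)) uE (aeq_refl h) => a b a' b' x -> ->.
  have l : L2 (fun x => u x * (h x)^*).
    by apply: L2_ae ls; [exact: cintegrable_meas (L2_inner lu lh)|exact: aeq_sym].
  rewrite /Hop /Pi; case: xgetP => [g -> hg|_]; last first.
    by rewrite fourier_cst; case: eqP; rewrite normc_0.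
  rewrite (orthoproj_fourier _ l hg) (fourier_ae _ l ls mE).
  apply: (le_trans (hankel_coef_le k.+1 pu hM uc ph)).
  rewrite ler_wpM2l//; apply: wt_mono; rewrite !ger0_norm// ler_nat//.
by exists (@Wal _ e _ bK).
Qed.

(** An eigenvector [h] for a nonzero eigenvalue is a multiple of [K (K h)], so
    that its coefficients inherit the decay of the range of K. *)
Lemma Feig_wal u (c : wal) tau h : Hsplus s u -> (forall n, fourier u n = c n) ->
  tau != 0 -> Feig u tau h ->
  exists x : wal, [/\ forall n, fourier h n = x n, plus x & in_F tau c x].
Proof.
move=> hu uc t0 [ph hE]; have [pu _] := hu; have [lu _] := pu; have [lh _] := ph.
have [g gE] := Kop_coef_wal hu ph.
have pk := Kop_L2plus u h; have [lk _] := pk.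
have pkk := Kop_L2plus u (Kop u h); have [lkk _] := pkk.
have hc n : (tau ^+ 2)%:C * fourier h n = Kk c g n.
  rewrite -fourierZ// -(Kop_wal lu uc lk gE).
  by apply/esym/fourier_ae => //; exact: L2Z.
have tc0 : (tau ^+ 2)%:C != 0 :> C.
  by rewrite -[0]/((0 : R)%:C) (inj_eq (@complexI _)) expf_neq0.
have hx n : fourier h n = (scal (((tau ^+ 2)%:C)^-1) * Kk c g : wal) n.
  by rewrite scalM -hc mulKf.
exists (scal (((tau ^+ 2)%:C)^-1) * Kk c g); split=> //.
  exact: L2plus_plus ph hx.
set x := _ * _ in hx *; have kx := Kop_wal lu uc lh hx.
apply: walE => n; rewrite scalM -hx -fourierZ//.
rewrite -(Kop_wal lu uc lk kx); apply: fourier_ae => //; exact: L2Z.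
Qed.

Lemma wal_Feig u (c x : wal) tau h : L2plus u -> (forall n, fourier u n = c n) ->
  L2 h -> (forall n, fourier h n = x n) -> plus x -> in_F tau c x -> Feig u tau h.
Proof.
move=> pu uc lh hx px Fx; have [lu _] := pu.
split; first exact: plus_L2plus px lh hx.
have kx := Kop_wal lu uc lh hx.
have [lk _] := Kop_L2plus u h; have [lkk _] := Kop_L2plus u (Kop u h).
apply: fourier_aeq; [exact: lkk|exact: L2Z|].
move=> n; rewrite (fourierZ n _ lh) hx (Kop_wal lu uc lk kx).
have -> : Kk c (Kk c x) = scal (tau ^+ 2)%:C * x by exact: Fx.
exact: scalM.
Qed.

End HankelEigenspaces.

Section SobolevCurve.
Context {R : realType} {e : {posnum R}}.
Local Notation C := R[i].
Local Notation wal := (wal e).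
Local Notation s := (1 + e%:num).
Variables (alpha : R) (u0 : R -> C) (u : R -> R -> C) (c : R -> wal).
Hypothesis sol : szego_solution alpha s u0 u.
Hypothesis uc : forall t n, fourier (u t) n = c t n.

(** The H^s norm controls the weighted supremum norm, see [Hsnorm_bnd]. *)
Lemma Hs_derive_nder t v (w : wal) : L2 v -> (forall n, fourier v n = w n) ->
  is_Hs_derive s u t v -> nder c t w.
Proof.
have [hu _ _] := sol => lv vw hd eps eps0.
have lu r : L2 (u r) by have [[]] := hu r.
have nb : nbhs (0 : \bar R) [set y | (y < eps%:E)%E].
  exact: (@nbhs_open_ereal_lt _ 0 (fun=> eps)).
have : nbhs (0 : R) [set h | h != 0 ->
    (Hsnorm s (fun x => (h^-1)%:C * (u (t + h) x - u t x) - v x)%R < eps%:E)%E] := hd _ nb.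
move=> /nbhs_ballP[d d0 hb].
exists d => // h hd'; have [->|h0] := eqVneq h 0.
  rewrite normr0 mulr0 addr0 subrr rs0 mul0r subrr; exact: bnd0.
have /Hsnorm_bnd hn : (Hsnorm s (fun x => (h^-1)%:C * (u (t + h) x - u t x) - v x)%R <= eps%:E)%E.
  by apply/ltW/hb => //; rewrite /ball /= sub0r normrN.
have hE n : (c (t + h) - c t - scal h%:C * w) n =
  h%:C * fourier (fun x => (h^-1)%:C * (u (t + h) x - u t x) - v x) n.
  have l1 : L2 (fun x => u (t + h) x - u t x) by exact: L2B (lu _) (lu _).
  rewrite !wcoefB scalM (fourierB n (L2Z _ l1) lv) (fourierZ n _ l1).
  rewrite (fourierB n (lu _) (lu _)) !uc vw [RHS]mulrBr; congr (_ - _).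
  by rewrite mulrA -rmorphM /= mulfV// mul1r.
by move=> n; rewrite hE normc_M normc_real (mulrC eps) -mulrA ler_wpM2l.
Qed.

Lemma nder_szego t : nder c t (szego_field c 1 alpha t).
Proof.
have [hu _ hv] := sol; have [v [hsv dv vE]] := hv t.
have [w vw] := Hsplus_wal hsv; have [[lv _] _] := hsv.
have lu r : L2 (u r) by have [[]] := hu r.
rewrite (_ : szego_field _ _ _ _ = w); first exact: Hs_derive_nder lv vw dv.
have [l1 c1] := L2_coef_mul 0 (lu t) (L2J (lu t)) (uc t) (fun n => coef_conj n (lu t) (uc t)).
have c1' n := (L2_coef_mul n (lu t) (L2J (lu t)) (uc t) (fun n => coef_conj n (lu t) (uc t))).2.
have [l2 _] := L2_coef_mul 0 l1 (lu t) c1' (uc t).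
have c2 n := (L2_coef_mul n l1 (lu t) c1' (uc t)).2.
have cub : (fun y => (normc (u t y) ^+ 2)%:C * u t y) = (fun y => u t y * (u t y)^* * u t y).
  by apply/funext => y; rewrite mulcJ.
rewrite cub in vE.
have inE : inner (u t) (fun=> 1) = c t 0.
  rewrite -uc fourierI; apply: inner_ext => // x; by rewrite ei0.
have [lp _] := Pi_L2plus (fun y => u t y * (u t y)^* * u t y).
have wE n : 'i * w n = (wtr (c t * wstar (c t) * c t) + scal (alpha%:C * c t 0)) n.
  rewrite -vw -fourierZ//; rewrite (fourier_ae n _ _ vE); last 2 first.
  - exact: L2Z.
  - by apply: L2D => //; exact: L2_cst.
  rewrite fourierD//; last exact: L2_cst.
  rewrite (Pi_coef n l2 c2) fourier_cst inE wcoefD; congr (_ + _).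
  rewrite -[scal _]mulr1 scalM wcoef1; case: eqP; rewrite ?mulr1 ?mulr0//.
apply: walE => n.
have sE : - speed 1 = scal (- 'i) :> wal by rewrite rmorphN /speed rmorph1 mulr1.
have -> : szego_field c 1 alpha t = scal (- 'i) * (wtr (c t * wstar (c t) * c t) + scal (alpha%:C * c t 0)).
  by rewrite /szego_field /modsq sE.
by rewrite scalM -wE mulrA mulNr -expr2 sqrCi opprK mul1r.
Qed.

(** The chain rule produces the factor [delta], which is the reason for the
    parameter of [szego_field]. *)
Lemma nder_szego_segment t1 delta r :
  nder (fun r => c (t1 + delta * r)) r (szego_field (fun r => c (t1 + delta * r)) delta alpha r).
Proof.
move=> eps eps0; have d0 : 0 < `|delta| + 1 by rewrite ltr_wpDl.
have [d hd0 hd] := nder_szego (t1 + delta * r) (divr_gt0 eps0 d0).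
exists (d / (`|delta| + 1)); first exact: divr_gt0.
move=> h; rewrite ltr_pdivlMr// => hh.
have le1 : `|delta * h| <= `|h| * (`|delta| + 1).
  by rewrite normrM mulrC ler_wpM2l// lerDl.
have := hd (delta * h) (le_lt_trans le1 hh).
rewrite (_ : t1 + delta * r + delta * h = t1 + delta * (r + h)); last by ring.
have -> : scal (delta * h)%:C * szego_field c 1 alpha (t1 + delta * r) =
  scal h%:C * szego_field (fun r => c (t1 + delta * r)) delta alpha r.
  rewrite /szego_field /modsq.
  set y := _ + _; clearbody y.
  have sE : scal (delta * h)%:C * speed 1 = scal h%:C * speed delta :> wal.
    rewrite /speed rmorph1 mulr1 -!rmorphM; congr scal.
    by rewrite mulrCA -rmorphM mulrC /= (mulrC h).
  by rewrite !mulNr !mulrN !mulrA sE.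
move=> hb; apply: le_bnd hb.
rewrite -mulrA ler_wpM2l ?(ltW eps0)// mulrC ler_pdivrMr//.
Qed.

End SobolevCurve.

(** * From the Blaschke product to the structure of the eigenspace *)

Section BlaschkeSymbol.
Context {R : realType} {e : {posnum R}}.
Local Notation C := R[i].
Local Notation wal := (wal e).
Local Notation s := (1 + e%:num).
Implicit Types (f g h u v w : R -> C).

Lemma evZ_wide (f : {poly C}) n : (size f <= n)%N ->
  evZ f = \sum_(i < n) scal f`_i * wdelta i :> wal.
Proof.
move=> sf; rewrite evZ_sum (big_ord_widen n (fun i : nat => scal f`_i * wdelta i : wal) sf).
rewrite big_mkcond; apply: eq_bigr => i _ /=; case: ltnP => // hi.
by rewrite nth_default// rmorph0 mul0r.
Qed.

Lemma poly_expi (f : {poly C}) : L2 (fun x : R => f.[expi x]) /\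
  forall n, fourier (fun x : R => f.[expi x]) n = (evZ f : wal) n.
Proof.
have fE : (fun x : R => f.[expi x]) = (fun x => \sum_(i < size f) f`_i * ei i x).
  apply/funext => x; rewrite horner_coef; apply: eq_bigr => i _.
  by rewrite ei_nat.
have l (i : 'I_(size f)) : L2 (fun x => f`_i * ei i x) by apply: L2Z; exact: L2_ei.
rewrite fE; split; first exact: L2_sum.
move=> n; rewrite fourierI inner_sum//; last exact: L2_ei.
rewrite evZ_coef.
transitivity (\sum_(i < size f) f`_i * (Posz i == n)%:R).
  by apply: eq_bigr => i _; rewrite -fourierI fourierZ ?fourier_ei//; exact: L2_ei.
case: n => k; last by rewrite big1// => i _; rewrite mulr0.
have [kf|kf] := ltnP k (size f).
  rewrite (bigD1 (Ordinal kf))//= eqxx mulr1 big1 ?addr0// => i ik.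
  have [//|] := eqVneq (Posz i) k; last by rewrite mulr0.
  by case=> ki; case/eqP: ik; exact: val_inj.
rewrite nth_default// big1// => i _.
have [[ik]|] := eqVneq (Posz i) k; last by rewrite mulr0.
by have := ltn_ord i; rewrite ik ltnNge kf.
Qed.

(** On the circle the denominator has the modulus of the numerator, whose
    zeroes are inside the disc. *)
Lemma blaschke_den_neq0 d (P : {poly C}) (x : R) : blaschke_num d P ->
  (blaschke_den d P).[expi x] != 0.
Proof.
case=> _ sP hr; have ex0 : expi x != 0 :> C by rewrite -normc_eq0 normc_expi oner_eq0.
rewrite blaschke_denE// mulf_neq0 ?expf_neq0//.
have exV : (expi x)^-1 = (expi x)^*.
  by apply: (mulfI ex0); rewrite mulfV// mulcJ normc_expi expr1n.
rewrite exV (_ : (expi x)^* = (@conjc R) (expi x))// horner_map fmorph_eq0.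
by apply/negP => /hr; rewrite normc_expi ltxx.
Qed.

(** The [m] elements [z^j r] are independent, by [evZ_mul_eq0]; so the matrix
    of their coordinates in a basis of [m] elements is invertible. *)
Lemma shift_basis_span (V : set (R -> C)) m (r : wal) :
  has_dim V m -> plus r -> r <> 0 ->
  (forall f, V f -> L2 f /\ exists x : wal, forall n, fourier f n = x n) ->
  (forall j, (j < m)%N -> V (synth (wdelta j * r))) ->
  forall f (x : wal), V f -> (forall n, fourier f n = x n) ->
    exists2 q : {poly C}, (size q <= m)%N & x = evZ q * r.
Proof.
move=> [b [Vb bE]] pr r0 VL Vr f x Vf fx.
have [B hB] := @choice _ _ (fun i (y : wal) => forall n, fourier (b i) n = y n)
  (fun i => (VL _ (Vb i)).2).
pose L (v : 'rV[C]_m) : wal := \sum_(i < m) scal (v 0 i) * B i.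
have LE g (y : wal) : V g -> (forall n, fourier g n = y n) -> exists a : 'rV[C]_m, y = L a.
  move=> Vg gy; have [a [gE _]] := bE _ Vg; exists a; apply: walE => n.
  have [lg _] := VL _ Vg.
  have lb (i : 'I_m) : L2 (fun x => a 0 i * b i x).
    by apply: L2Z; have [] := VL _ (Vb i).
  rewrite -gy (fourier_ae n lg _ gE); last exact: L2_sum.
  rewrite fourierI inner_sum//; last exact: L2_ei.
  rewrite /L (big_morph (fun z : wal => z n) (fun y z => wcoefD y z n) (wcoef0 n)).
  apply: eq_bigr => i _; rewrite scalM -fourierI fourierZ ?hB//.
  by have [] := VL _ (Vb i).
have [A hA] := @choice _ _ (fun (j : 'I_m) (a : 'rV[C]_m) => wdelta j * r = L a)
  (fun j => LE _ _ (Vr j (ltn_ord j)) (wfourier (wdelta j * r))).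
pose M := \matrix_(j < m, i < m) A j 0 i.
have LM (v : 'rV[C]_m) : evZ (rVpoly v) * r = L (v *m M).
  rewrite (@evZ_wide _ m) ?size_poly// mulr_suml.
  transitivity (\sum_(j < m) \sum_(i < m) scal (v 0 j * A j 0 i) * B i).
    apply: eq_bigr => j _; rewrite coef_rVpoly_ord -mulrA hA /L mulr_sumr.
    by apply: eq_bigr => i _; rewrite mulrA -rmorphM.
  rewrite exchange_big; apply: eq_bigr => i _ /=.
  have -> : (v *m M) 0 i = \sum_(j < m) v 0 j * A j 0 i.
    by rewrite mxE; apply: eq_bigr => j _; rewrite mxE.
  by rewrite -mulr_suml -rmorph_sum.
have Mu : M \in unitmx.
  rewrite -row_free_unit; apply: inj_row_free => v vM.
  have : evZ (rVpoly v) * r = 0.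
    by rewrite LM vM /L big1// => i _; rewrite mxE rmorph0 mul0r.
  by move/(evZ_mul_eq0 pr r0) => v0; rewrite -(rVpolyK v) v0 linear0.
have [v ->] := LE f x Vf fx.
exists (rVpoly (v *m invmx M)); first exact: size_poly.
by rewrite LM mulmxKV.
Qed.

Lemma is_Psi_structure u (c : wal) (sigma psi : R) (P : {poly C}) :
  Hsplus s u -> (forall n, fourier u n = c n) -> 0 < sigma ->
  Sigma_K u sigma -> is_Psi u sigma psi P ->
  exists d (p r : wal), blaschke_num d P /\ blaschke_structure c sigma d P p r.
Proof.
move=> hu uc s0 [_ hS] [d [dimF hP [u' [Fu' proj] KE]]].
have [pu _] := hu; have [lu _] := pu; have pc := L2plus_plus pu uc.
have sn0 : sigma != 0 by rewrite gt_eqF.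
have FW h : Feig u sigma h -> exists x : wal, [/\ forall n, fourier h n = x n, plus x & in_F sigma c x].
  exact: Feig_wal hu uc sn0.
have FL h : Feig u sigma h -> L2 h by case=> [[]].
have [p [u'p pp Fp]] := FW _ Fu'; have lu' := FL _ Fu'.
have sF x : plus x -> in_F sigma c x -> Feig u sigma (synth x).
  by move=> px Fx; apply: (wal_Feig pu uc (wL2 x) (wfourier x) px Fx).
have ipE g h (x y : wal) : L2 g -> L2 h -> (forall n, fourier g n = x n) ->
    (forall n, fourier h n = y n) -> inner g h = ip x y.
  move=> lg lh gx hy; rewrite ip_inner; apply: inner_ae => //; try exact: wL2.
    exact: aeq_synth.
  exact: aeq_synth.
have hproj x : plus x -> in_F sigma c x -> ip p x = ip c x.
  move=> px Fx; have := proj _ (sF _ px Fx).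
  rewrite (innerBl lu lu' (wL2 x)).
  have -> := ipE u (synth x) c x lu (wL2 x) uc (wfourier x).
  have -> := ipE u' (synth x) p x lu' (wL2 x) u'p (wfourier x).
  by move=> h; exact: esym (subr0_eq h).
pose sp : C := sigma%:C * expi (- psi).
have spsp : sp * sp^* = (sigma ^+ 2)%:C.
  by rewrite mulcJ /sp normc_M normc_real normc_expi mulr1 real_normK// num_real.
have [lD fD] := poly_expi (blaschke_den d P); have [lP fP] := poly_expi P.
have [lK _] := Kop_L2plus u u'; have kp := Kop_wal lu uc lu' u'p.
have hK : evZ (blaschke_den d P) * Kk c p = scal sp * evZ P * p.
  apply: walE => n.
  have [l1 c1] := L2_coef_mul n lD lK fD kp.
  have [l2 c2] := L2_coef_mul n lP lu' fP u'p.
  rewrite -c1 -mulrA scalM -c2 -(fourierZ n sp l2).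
  apply: fourier_ae; [exact: l1|exact: L2Z|].
  apply: filterS KE => x hx cx; rewrite hx// /blaschke.
  have D0 := blaschke_den_neq0 x hP; rewrite /sp; by field.
have [r [pr pE Kr]] := blaschke_quotient hP pp hK.
have [rF ro] := quotient_F spsp pr Kr.
have r0 : r <> 0.
  move=> r0; apply: hS => h Fh; have [x [hx px Fx]] := FW _ Fh.
  have -> := ipE u h c x lu (FL _ Fh) uc hx.
  by rewrite -(hproj x px Fx) pE r0 mulr0 /ip mul0r wcoef0.
have pZr j : plus (wdelta j%:Z * r) by apply: plusM; [exact: plus_delta|exact: pr].
have spanF x : plus x -> in_F sigma c x ->
    exists2 f : {poly C}, (size f <= d.+1)%N & x = evZ f * r.
  move=> px Fx; apply: (shift_basis_span dimF pr r0 _ _ (sF _ px Fx) (wfourier x)).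
    by move=> f Ff; split; [exact: FL|have [y [hy _ _]] := FW _ Ff; exists y].
  by move=> j jd; apply: sF; [exact: pZr|exact: rF].
exists d, p, r; split; first exact: hP.
refine (Build_blaschke_structure pr pE rF ro spanF hproj _).
move=> rc; apply: hS => h Fh; have [x [hx px Fx]] := FW _ Fh.
have -> := ipE u h c x lu (FL _ Fh) uc hx; rewrite ip_conj.
have [f sf ->] := spanF x px Fx.
rewrite (evZ_wide sf) mulr_suml ip_suml big1; first exact: rmorph0.
move=> i _; rewrite -mulrA ipZl; case: i => -[|i] hi /=; first by rewrite mul1r rc mulr0.
by rewrite ro ?mulr0.
Qed.

End BlaschkeSymbol.

(** * Invariance of the zeroes *)

(** The flow from [t1] to [t2] shows that the degree does not decrease, the
    flow from [t2] back to [t1] that it does not increase. *)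
Lemma same_blaschke_numerator (R : realType) (e : {posnum R}) (alpha : R)
    (u0 : R -> R[i]) (u : R -> R -> R[i]) (sigma : R) :
  szego_solution alpha (1 + e%:num) u0 u -> 0 < sigma ->
  forall t1 t2 : R, Sigma_K (u t1) sigma -> Sigma_K (u t2) sigma ->
  forall (psi1 psi2 : R) (P1 P2 : {poly R[i]}),
    is_Psi (u t1) sigma psi1 P1 -> is_Psi (u t2) sigma psi2 P2 -> P1 = P2.
Proof.
move=> sol s0 t1 t2 S1 S2 psi1 psi2 P1 P2 B1 B2; have [hu _ _] := sol.
have [c uc] := @choice _ _ (fun t (c : wal e) => forall n, fourier (u t) n = c n)
  (fun t => Hsplus_wal (hu t)).
have pc t : plus (c t) := L2plus_plus (Hsplus_L2plus (hu t)) (uc t).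
have [d1 [p1 [r1 [hP1 bs1]]]] := is_Psi_structure (hu t1) (uc t1) s0 S1 B1.
have [d2 [p2 [r2 [hP2 bs2]]]] := is_Psi_structure (hu t2) (uc t2) s0 S2 B2.
pose c12 r := c (t1 + (t2 - t1) * r); pose c21 r := c (t2 + (t1 - t2) * r).
have der12 := nder_szego_segment sol uc t1 (t2 - t1).
have der21 := nder_szego_segment sol uc t2 (t1 - t2).
have pc12 r : plus (c12 r) by exact: pc.
have pc21 r : plus (c21 r) by exact: pc.
have b1 : blaschke_structure (c12 0) sigma d1 P1 p1 r1 by rewrite /c12 mulr0 addr0.
have b2 : blaschke_structure (c12 1) sigma d2 P2 p2 r2 by rewrite /c12 mulr1 addrC subrK.
have b1' : blaschke_structure (c21 1) sigma d1 P1 p1 r1 by rewrite /c21 mulr1 addrC subrK.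
have b2' : blaschke_structure (c21 0) sigma d2 P2 p2 r2 by rewrite /c21 mulr0 addr0.
apply: (same_numerator pc12 der12 b1 b2 hP1 hP2); apply/eqP.
by rewrite eqn_leq (degree_le pc12 der12 b1 b2) (degree_le pc21 der21 b2' b1').
Qed.

Theorem proposition4p3 (R : realType) (alpha s : R) (u0 : R -> R[i])
    (u : R -> R -> R[i]) (sigma : R) :
  alpha != 0 -> 1 < s -> Hsplus s u0 ->
  szego_solution alpha s u0 u ->
  (exists t : R, inner (fun=> 1) (u t) <> 0) ->
  0 < sigma -> singular_value_K u0 sigma ->
  forall t1 t2 : R, Sigma_K (u t1) sigma -> Sigma_K (u t2) sigma ->
  forall (psi1 psi2 : R) (P1 P2 : {poly R[i]}),
    is_Psi (u t1) sigma psi1 P1 -> is_Psi (u t2) sigma psi2 P2 ->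
  forall a : R[i], mup a P1 = mup a P2.
Proof.
move=> _ s1 _ sol _ s0 _ t1 t2 S1 S2 psi1 psi2 P1 P2 B1 B2 a.
have e0 : 0 < s - 1 by rewrite subr_gt0.
pose e := PosNum e0; have se : s = 1 + e%:num by rewrite /= addrC subrK.
rewrite se in sol.
by rewrite (same_blaschke_numerator sol s0 S1 S2 B1 B2).
Qed.
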